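(* For every sufficiently small $\epsilon>0$ and every fixed $G\in(-\epsilon,\epsilon)$ there exists a solution (for some constants $\Omega,B\in\mathbb R$) of the infinite-depth water wave problem $$\Delta\psi=-\Omega \ \text{ in } D,\qquad \psi=0\ \text{ on } S,\qquad \tfrac12|\nabla\psi|^2+Gy=B\ \text{ on } S,$$ $$\nabla\psi-(0,-\Omega y-1)\to(0,0)\quad\text{as } y\to-\infty,$$ whose profile $S$ is vertical at a point but never overhanging.
   Context: Here $G,\Omega,B$ are real constants (dimensionless gravity, constant vorticity, Bernoulli constant). Solutions. Let $\mathbb S_\infty=\{\alpha+i\beta\in\mathbb C:\beta<0\}$ and identify $\mathbb R^2$ with $\mathbb C$. A solution consists of $\Omega,B\in\mathbb R$, a domain $D\subset\mathbb R^2$ which is $2\pi$-periodic in $x$, unbounded below and bounded above by a free surface $S$, and a stream function $\psi$ on $D\cup S$, such that the displayed equations hold. $D$ and $\psi$ are $2\pi$-periodic in $x$ and symmetric under reflection in the vertical lines beneath the crest and the trough. The domain is described by a conformal bijection $z=x+iy:\mathbb S_\infty\to D$ that extends in a $C^1$ and injective fashion to $\{\beta=0\}$ with $z_\alpha\neq0$ there, such that $x-\alpha$ and $y$ are $2\pi$-periodic in $\alpha$, $x-\alpha$ and $y-\beta$ are bounded, and $S$ is the curve $\alpha\mapsto z(\alpha+i0)$. The profile is vertical at a point if $x_\alpha(\alpha_0+i0)=0$ for some $\alpha_0$. It is overhanging if $x_\alpha(\alpha+i0)<0$ for some $\alpha$ (so that $S$ is not a graph over the $x$-axis). ''Never overhanging''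 means $x_\alpha(\alpha+i0)\ge0$ for all $\alpha$. *)

(* Defs.v *)
From Stdlib Require Import Reals.
From Coquelicot Require Import Coquelicot.
Open Scope R_scope.

(* Points of the plane are elements of [R * R]; Coquelicot's [C] is this same
   type, so a map [C -> C] also takes values in the plane. *)

(* The gradient at a point of E is the derivative relative to E, so that it
   makes sense, one-sidedly, at boundary points belonging to E. *)
Definition is_gradient_on (E : R * R -> Prop) (f : R * R -> R)
    (g : R * R -> R * R) : Prop :=
  forall p : R * R, E p ->
    @filterdiff R_AbsRing
      (prod_NormedModule R_AbsRing R_NormedModule R_NormedModule)
      R_NormedModule f (within E (locally p))
      (fun v : R * R => fst (g p) * fst v + snd (g p) * snd v).

Definition C1_with_gradient (E : R * R -> Prop) (f : R * R -> R)
    (g : R * R -> R * R) : Prop :=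
  is_gradient_on E f g /\ continuous_on E g.

Definition C1_on (E : R * R -> Prop) (f : R * R -> R) : Prop :=
  exists g : R * R -> R * R, C1_with_gradient E f g.

Definition connected (E : R * R -> Prop) : Prop :=
  forall U V : R * R -> Prop,
    open U -> open V ->
    (forall p, E p -> U p \/ V p) ->
    (exists p, E p /\ U p) -> (exists p, E p /\ V p) ->
    exists p, E p /\ U p /\ V p.

Definition is_domain (E : R * R -> Prop) : Prop :=
  open E /\ (exists p, E p) /\ connected E.

Definition frontier (E : R * R -> Prop) (p : R * R) : Prop :=
  ~ locally p E /\ ~ locally p (fun q => ~ E q).

Definition lower_half_plane (w : C) : Prop := Im w < 0.
Definition closed_lower_half_plane (w : C) : Prop := Im w <= 0.

Definition free_surface (z : C -> C) (p : R * R) : Prop :=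
  exists a : R, p = z (a, 0).

Definition x_alpha (z : C -> C) (a : R) : R :=
  Derive (fun t => Re (z (t, 0))) a.
Definition y_alpha (z : C -> C) (a : R) : R :=
  Derive (fun t => Im (z (t, 0))) a.

Definition conformal_bijection (z : C -> C) (D : R * R -> Prop) : Prop :=
  (forall w, lower_half_plane w ->
     exists l : C, is_derive z w l /\ l <> RtoC 0) /\
  (forall w1 w2, lower_half_plane w1 -> lower_half_plane w2 ->
     z w1 = z w2 -> w1 = w2) /\
  (forall p, D p <-> exists w, lower_half_plane w /\ z w = p).

Record conformal_description (D : R * R -> Prop) (z : C -> C) : Prop := {
  cd_conformal : conformal_bijection z D;
  cd_C1_re : C1_on closed_lower_half_plane (fun w => Re (z w));
  cd_C1_im : C1_on closed_lower_half_plane (fun w => Im (z w));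
  cd_injective : forall w1 w2,
    closed_lower_half_plane w1 -> closed_lower_half_plane w2 ->
    z w1 = z w2 -> w1 = w2;
  cd_regular : forall a, (x_alpha z a, y_alpha z a) <> (0, 0);
  cd_periodic_re : forall a b, b <= 0 ->
    Re (z (a + 2 * PI, b)) - (a + 2 * PI) = Re (z (a, b)) - a;
  cd_periodic_im : forall a b, b <= 0 ->
    Im (z (a + 2 * PI, b)) = Im (z (a, b));
  cd_bounded : exists M : R, forall a b, b <= 0 ->
    Rabs (Re (z (a, b)) - a) <= M /\ Rabs (Im (z (a, b)) - b) <= M }.

Definition is_crest (S : R * R -> Prop) (c : R * R) : Prop :=
  S c /\ forall q, S q -> snd q <= snd c.
Definition is_trough (S : R * R -> Prop) (c : R * R) : Prop :=
  S c /\ forall q, S q -> snd c <= snd q.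

Definition reflect_x (x0 : R) (p : R * R) : R * R := (2 * x0 - fst p, snd p).
Definition shift_x (p : R * R) : R * R := (fst p + 2 * PI, snd p).

Definition invariant_under (T : R * R -> R * R) (D S : R * R -> Prop)
    (psi : R * R -> R) : Prop :=
  (forall p, D (T p) <-> D p) /\
  (forall p, D p \/ S p -> psi (T p) = psi p).

Record fluid_domain (D S : R * R -> Prop) : Prop := {
  fd_domain : is_domain D;
  fd_unbounded_below : forall M : R, exists p, D p /\ snd p < M;
  fd_frontier : forall p, frontier D p <-> S p }.

(* Here psi is of class C^2 in D and C^1 up to S, g is its gradient on the union
   of D and S, and gxx_gxy, gyx_gyy are the gradients in D of the two components
   of g, so that the Laplacian is the trace of the resulting Hessian.  The last
   condition is uniform in x.  Values of psi outside D and S play no role. *)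
Definition stream_equations (G Omega B : R) (D S : R * R -> Prop)
    (psi : R * R -> R) : Prop :=
  exists g gxx_gxy gyx_gyy : R * R -> R * R,
    C1_with_gradient (fun p => D p \/ S p) psi g /\
    C1_with_gradient D (fun p => fst (g p)) gxx_gxy /\
    C1_with_gradient D (fun p => snd (g p)) gyx_gyy /\
    (forall p, D p -> fst (gxx_gxy p) + snd (gyx_gyy p) = - Omega) /\
    (forall p, S p -> psi p = 0) /\
    (forall p, S p ->
       / 2 * (fst (g p) ^ 2 + snd (g p) ^ 2) + G * snd p = B) /\
    (forall eps : R, 0 < eps -> exists M : R, forall p, D p -> snd p < M ->
       Rabs (fst (g p) - 0) < eps /\
       Rabs (snd (g p) - (- Omega * snd p - 1)) < eps).

(* A crest (trough) is a highest (lowest) point of the free surface. *)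
Record water_wave (G Omega B : R) (D : R * R -> Prop) (psi : R * R -> R)
    (z : C -> C) : Prop := {
  ww_domain : fluid_domain D (free_surface z);
  ww_equations : stream_equations G Omega B D (free_surface z) psi;
  ww_periodic : invariant_under shift_x D (free_surface z) psi;
  ww_crest_symmetric : forall c, is_crest (free_surface z) c ->
    invariant_under (reflect_x (fst c)) D (free_surface z) psi;
  ww_trough_symmetric : forall c, is_trough (free_surface z) c ->
    invariant_under (reflect_x (fst c)) D (free_surface z) psi;
  ww_conformal : conformal_description D z }.

Definition vertical_at_a_point (z : C -> C) : Prop :=
  exists a : R, x_alpha z a = 0.

Definition never_overhanging (z : C -> C) : Prop :=
  forall a : R, 0 <= x_alpha z a.

(* Main.v *)
(** In the variable [zeta = exp (- i w)] look for [dz/dw = p ^ 2] with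
    [p = 1 + sum p_n zeta ^ n] and real [p_n], so that [z = w + i v] with
    [n v_n = (p ^ 2)_n], and write [Omega = 2 c].  The velocity [psi_x - i psi_y] is
    [i (m + 2 c y) + h] with [h] analytic, decaying, and it equals [i s conj p / p] on the
    surface, where [s ^ 2 = 1 - 2 G y].  Such an [h] exists exactly when
    [s conj p - 2 c y p] has no antianalytic part except a constant, that is
    [p_n + G Z_n = c Y_n] for [n >= 1] with [Y_n = sum_k v_(n+k) p_k].

    For [G = 0] Crapper's profile [p = (1 + A zeta) / (1 - A zeta)] is a solution, whose
    surface is vertical but not overhanging at [A = sqrt 2 - 1].  Prescribing [p_1] and
    eliminating [c] through the first equation, the map [p |-> c Y - G Z] is a contraction
    near this profile in a weighted l1 norm: the rank-one part of its linearization cancels,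
    and the column sums of the rest are below 1.  This yields for small [G] a family of
    profiles depending Lipschitz continuously on [p_1], overhanging at one end and not at the
    other, and the supremum of the non-overhanging [p_1] gives the wave.  Where
    [Re dz/dw >= 0] on the boundary it is positive inside, since near Crapper's wave a multiple
    of [p] moves into the sector [|Im| < Re] as [|zeta|] decreases; hence [z] is injective. *)

Require Import Defs.
From Stdlib Require Import Reals Arith Lra Lia Psatz Classical ClassicalEpsilon.
From Coquelicot Require Import Coquelicot.
Open Scope R_scope.

(** * Weighted summable sequences *)

(** The square root in the surface condition is removed by a second unknown [t]: with
    [s = 1 + G Re t] the condition becomes [Re t = - Re v - (G / 2) (Re t) ^ 2], which is polynomial
    and keeps its meaning at [G = 0]. All nonlinear terms are then convolutions and one-sided
    correlations of sequences, bounded by products of norms. The obstacle is that the map contracts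
    only by a narrow margin, with a constant near 0.97. Hence the removal of the geometric
    direction, the separate treatment of the prescribed coefficient [p_1], and explicit numerical
    constants throughout; the radius of the ball, the range of amplitudes and the bound on [G] all
    come from the slack that remains. The weight above 1 makes the series converge beyond the
    surface, so derivatives are controlled up to the boundary. Real coefficients make the reflection
    symmetry automatic. *)

(* Any weight slightly larger than 1 would do. *)
Definition rho : R := 101 / 100.

(** Bounding partial sums expresses summability and the norm bound at once, and passes directly to
    pointwise limits. *)
Definition l1_le (a : nat -> R) (M : R) : Prop :=
  forall n, sum_f_R0 (fun k => Rabs (a k) * rho ^ k) n <= M.

Lemma rho_pow_ge1 n : 1 <= rho ^ n.
Proof. apply pow_R1_Rle. unfold rho; lra. Qed.

Lemma l1_term_ge0 (a : nat -> R) k : 0 <= Rabs (a k) * rho ^ k.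
Proof.
  apply Rmult_le_pos; [apply Rabs_pos |].
  generalize (rho_pow_ge1 k); lra.
Qed.

Lemma l1_ge0 a M : l1_le a M -> 0 <= M.
Proof.
  intros H. apply Rle_trans with (2 := H 0%nat). apply l1_term_ge0.
Qed.

Lemma l1_weaken a M M' : l1_le a M -> M <= M' -> l1_le a M'.
Proof. intros H HM n. apply Rle_trans with (2 := HM). apply H. Qed.

Lemma l1_dominated a b M :
  (forall n, Rabs (a n) <= Rabs (b n)) -> l1_le b M -> l1_le a M.
Proof.
  intros H Hb n. apply Rle_trans with (2 := Hb n).
  apply sum_Rle. intros k _. apply Rmult_le_compat_r; [| apply H].
  generalize (rho_pow_ge1 k); lra.
Qed.

Lemma l1_ext a b M : (forall n, a n = b n) -> l1_le a M -> l1_le b M.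
Proof. intros H. apply l1_dominated. intros n. rewrite H. apply Rle_refl. Qed.

Lemma l1_plus a b Ma Mb : l1_le a Ma -> l1_le b Mb -> l1_le (fun n => a n + b n) (Ma + Mb).
Proof.
  intros Ha Hb n.
  apply Rle_trans with
    (sum_f_R0 (fun k => Rabs (a k) * rho ^ k + Rabs (b k) * rho ^ k) n).
  - apply sum_Rle. intros k _. rewrite <- Rmult_plus_distr_r.
    apply Rmult_le_compat_r; [| apply Rabs_triang].
    generalize (rho_pow_ge1 k); lra.
  - rewrite sum_plus. apply Rplus_le_compat; [apply Ha | apply Hb].
Qed.

Lemma l1_scal a c M : l1_le a M -> l1_le (fun n => c * a n) (Rabs c * M).
Proof.
  intros Ha n.
  rewrite (sum_eq _ (fun k => Rabs (a k) * rho ^ k * Rabs c)).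
  - rewrite <- scal_sum. apply Rmult_le_compat_l; [apply Rabs_pos | apply Ha].
  - intros k _. rewrite Rabs_mult. ring.
Qed.

Lemma l1_opp a M : l1_le a M -> l1_le (fun n => - a n) M.
Proof. apply l1_dominated. intros n. rewrite Rabs_Ropp. apply Rle_refl. Qed.

Lemma l1_minus a b Ma Mb : l1_le a Ma -> l1_le b Mb -> l1_le (fun n => a n - b n) (Ma + Mb).
Proof. intros Ha Hb. apply (l1_plus a (fun n => - b n)); [| apply l1_opp]; auto. Qed.

Lemma l1_term_le a M k : l1_le a M -> Rabs (a k) * rho ^ k <= M.
Proof.
  intros Ha. apply Rle_trans with (2 := Ha k). destruct k; simpl; [lra |].
  assert (0 <= sum_f_R0 (fun k => Rabs (a k) * rho ^ k) k); [| simpl in *; lra].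
  apply cond_pos_sum. intros; apply l1_term_ge0.
Qed.

Lemma l1_coeff a M k : l1_le a M -> Rabs (a k) <= M.
Proof.
  intros Ha. generalize (l1_term_le a M k Ha) (rho_pow_ge1 k) (Rabs_pos (a k)). nra.
Qed.

Lemma ex_series_bounded (u : nat -> R) M :
  (forall n, 0 <= u n) -> (forall n, sum_f_R0 u n <= M) ->
  ex_series u /\ Series u <= M.
Proof.
  intros Hu HM.
  destruct (ex_finite_lim_seq_incr (sum_n u) M) as [l Hl].
  - intros n. rewrite sum_Sn. unfold plus; simpl. generalize (Hu (S n)); lra.
  - intros n. rewrite sum_n_Reals. apply HM.
  - assert (is_series u l) by exact Hl.
    split; [exists l; auto |]. rewrite (is_series_unique _ _ H).
    apply (is_lim_seq_le (sum_n u) (fun _ => M) l M); auto using is_lim_seq_const.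
    intros n. rewrite sum_n_Reals. apply HM.
Qed.

Lemma nonneg_partial_sum_le (u : nat -> R) n :
  (forall n, 0 <= u n) -> ex_series u -> sum_f_R0 u n <= Series u.
Proof.
  intros Hu [l Hl]. rewrite (is_series_unique _ _ Hl).
  rewrite <- sum_n_Reals.
  apply (is_lim_seq_incr_compare (sum_n u) l); auto.
  intros k. rewrite sum_Sn. unfold plus; simpl. generalize (Hu (S k)); lra.
Qed.

Lemma l1_series a M :
  l1_le a M <-> ex_series (fun k => Rabs (a k) * rho ^ k) /\
             Series (fun k => Rabs (a k) * rho ^ k) <= M.
Proof.
  split.
  - intros H. apply ex_series_bounded; auto using l1_term_ge0.
  - intros [H1 H2] n. apply Rle_trans with (2 := H2).
    apply nonneg_partial_sum_le; auto using l1_term_ge0.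
Qed.

Lemma l1_dominates_series a M (u : nat -> R) :
  l1_le a M -> (forall k, Rabs (u k) <= Rabs (a k) * rho ^ k) ->
  ex_series (fun k => Rabs (u k)) /\ ex_series u /\
  Series (fun k => Rabs (u k)) <= M /\ Rabs (Series u) <= M.
Proof.
  intros Ha Hu. apply l1_series in Ha. destruct Ha as [H1 H2].
  assert (E : ex_series (fun k => Rabs (u k))).
  { apply (ex_series_le (fun k => Rabs (u k)) (fun k => Rabs (a k) * rho ^ k)); auto.
    intros k. unfold norm; simpl. unfold abs; simpl. rewrite Rabs_Rabsolu. apply Hu. }
  assert (L : Series (fun k => Rabs (u k)) <= M).
  { apply Rle_trans with (2 := H2). apply Series_le; auto.
    intros k; split; [apply Rabs_pos | apply Hu]. }
  repeat split; auto.
  - apply ex_series_Rabs; auto.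
  - apply Rle_trans with (2 := L). apply Series_Rabs; auto.
Qed.

(** Each partial sum is finite, so it passes to the limit. In the fixed point argument this takes
    the place of completeness of the sequence space. *)
Lemma l1_pointwise_limit (a : nat -> nat -> R) (b : nat -> R) M :
  (forall j, l1_le (a j) M) -> (forall n, is_lim_seq (fun j => a j n) (b n)) -> l1_le b M.
Proof.
  intros Ha Hb n.
  assert (L : is_lim_seq (fun j => sum_f_R0 (fun k => Rabs (a j k) * rho ^ k) n)
               (sum_f_R0 (fun k => Rabs (b k) * rho ^ k) n)).
  { induction n; simpl.
    - apply is_lim_seq_mult'; [| apply is_lim_seq_const].
      apply (is_lim_seq_abs _ (b 0%nat)), Hb.
    - apply is_lim_seq_plus'; [exact IHn |].
      apply (is_lim_seq_mult' _ _ (Rabs (b (S n))) (rho * rho ^ n));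
        [| apply is_lim_seq_const].
      apply (is_lim_seq_abs _ (b (S n))), Hb. }
  apply (is_lim_seq_le _ (fun _ => M) _ M (fun j => Ha j n) L), is_lim_seq_const.
Qed.

(** * Convolution, correlation and integration of coefficients *)

Definition conv := PS_mult.
(** On the unit circle these are the nonnegative Fourier coefficients of the series of [a] times the
    conjugate of the series of [b]; see [fourier_mult_conj]. *)
Definition hank (a b : nat -> R) (n : nat) : R := Series (fun k => a (n + k)%nat * b k).
(** Integration in the variable [log zeta]; the last factor overrides the meaningless quotient at
    [n = 0]. *)
Definition int0 (a : nat -> R) (n : nat) : R := a n / INR n * (if n then 0 else 1).

(** The weighted terms are dominated by the Cauchy product of the weighted terms of [a] and [b],
    since [rho ^ k * rho ^ (n - k) = rho ^ n]. *)
Lemma l1_conv a b Ma Mb : l1_le a Ma -> l1_le b Mb -> l1_le (conv a b) (Ma * Mb).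
Proof.
  intros Ha Hb. assert (0 <= Ma /\ 0 <= Mb) by (split; eapply l1_ge0; eauto).
  apply l1_series in Ha. destruct Ha as [Ea La].
  apply l1_series in Hb. destruct Hb as [Eb Lb].
  set (u := fun k => Rabs (a k) * rho ^ k) in *.
  set (w := fun k => Rabs (b k) * rho ^ k) in *.
  assert (Hu : forall k, 0 <= u k) by (intros; apply l1_term_ge0).
  assert (Hw : forall k, 0 <= w k) by (intros; apply l1_term_ge0).
  assert (S1 := is_series_mult u w _ _ (Series_correct _ Ea) (Series_correct _ Eb)).
  assert (S2 : is_series (fun n => sum_f_R0 (fun k => u k * w (n - k)%nat) n)
                 (Series u * Series w)).
  { apply S1.
    - apply ex_series_ext with (2 := Ea). intros; symmetry; apply Rabs_right, Rle_ge, Hu.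
    - apply ex_series_ext with (2 := Eb). intros; symmetry; apply Rabs_right, Rle_ge, Hw. }
  intros n.
  apply Rle_trans with (sum_f_R0 (fun n => sum_f_R0 (fun k => u k * w (n - k)%nat) n) n).
  - apply sum_Rle. intros j _. unfold conv, PS_mult.
    rewrite (Rmult_comm (Rabs _)).
    apply Rle_trans with (rho ^ j * sum_f_R0 (fun k => Rabs (a k * b (j - k)%nat)) j).
    + apply Rmult_le_compat_l; [generalize (rho_pow_ge1 j); lra |].
      apply Rsum_abs.
    + rewrite scal_sum. apply sum_Rle. intros k Hk. unfold u, w.
      rewrite Rabs_mult. apply Req_le.
      replace (rho ^ j) with (rho ^ k * rho ^ (j - k)) by (rewrite <- pow_add; f_equal; lia).
      ring.
  - eapply Rle_trans; [apply nonneg_partial_sum_le |].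
    + intros j. apply cond_pos_sum. intros k. apply Rmult_le_pos; auto.
    + eexists; exact S2.
    + rewrite (is_series_unique _ _ S2).
      apply Rmult_le_compat; auto.
      * apply Rle_trans with (2 := nonneg_partial_sum_le u 0 Hu Ea). apply Hu.
      * apply Rle_trans with (2 := nonneg_partial_sum_le w 0 Hw Eb). apply Hw.
Qed.

Lemma hank_ex a b Ma Mb n : l1_le a Ma -> l1_le b Mb ->
  ex_series (fun k => Rabs (a (n + k)%nat * b k)) /\
  ex_series (fun k => a (n + k)%nat * b k).
Proof.
  intros Ha Hb.
  destruct (l1_dominates_series (fun k => Ma * b k) (Rabs Ma * Mb)
     (fun k => a (n + k)%nat * b k)) as [H1 [H2 _]]; auto.
  - apply l1_scal; auto.
  - intros k. rewrite !Rabs_mult.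
    assert (0 <= Ma) by (eapply l1_ge0; eauto). rewrite (Rabs_right Ma) by lra.
    assert (H1 := l1_coeff a Ma (n + k) Ha). assert (H2 := rho_pow_ge1 k).
    assert (H3 := Rabs_pos (b k)). assert (H4 := Rabs_pos (a (n+k)%nat)).
    assert (0 <= Ma * Rabs (b k)) by (apply Rmult_le_pos; auto).
    assert (Rabs (a (n + k)%nat) * Rabs (b k) <= Ma * Rabs (b k))
      by (apply Rmult_le_compat_r; auto).
    nra.
Qed.

Lemma ex_series_sum_f (u : nat -> nat -> R) n :
  (forall j, ex_series (u j)) -> ex_series (fun k => sum_f_R0 (fun j => u j k) n) /\
  Series (fun k => sum_f_R0 (fun j => u j k) n) = sum_f_R0 (fun j => Series (u j)) n.
Proof.
  intros H. induction n; simpl; [split; auto; apply H |].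
  destruct IHn as [I1 I2]. split.
  - apply (ex_series_plus _ _ I1 (H (S n))).
  - rewrite Series_plus; auto. rewrite I2; reflexivity.
Qed.

Lemma sum_f_shift_le (u : nat -> R) n k :
  (forall j, 0 <= u j) -> sum_f_R0 (fun j => u (j + k)%nat) n <= sum_f_R0 u (n + k).
Proof.
  intros Hu. induction n; simpl.
  - destruct k; simpl; [lra |]. assert (0 <= sum_f_R0 u k) by (apply cond_pos_sum; auto). lra.
  - lra.
Qed.

(** Summing over [n] first, the shift by [k] only helps, because [rho ^ n <= rho ^ (n + k)]; the
    remaining sum over [b] needs no weight. *)
Lemma l1_hank a b Ma Mb : l1_le a Ma -> l1_le b Mb -> l1_le (hank a b) (Ma * Mb).
Proof.
  intros Ha Hb n.
  assert (Pa := l1_ge0 _ _ Ha).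
  set (u := fun j k => Rabs (a (j + k)%nat * b k) * rho ^ j).
  assert (Eu : forall j, ex_series (u j)).
  { intros j. apply (ex_series_scal_r (rho ^ j) (fun k => Rabs (a (j + k)%nat * b k))).
    apply (hank_ex a b Ma Mb j Ha Hb). }
  destruct (ex_series_sum_f u n Eu) as [E1 E2].
  apply Rle_trans with (sum_f_R0 (fun j => Series (u j)) n).
  - apply sum_Rle. intros j _. unfold u. rewrite Series_scal_r.
    apply Rmult_le_compat_r; [generalize (rho_pow_ge1 j); lra |].
    apply Series_Rabs. apply (hank_ex a b Ma Mb j Ha Hb).
  - rewrite <- E2.
    assert (Hb' := l1_dominates_series (fun k => b k) Mb b Hb).
    destruct Hb' as [X1 [_ [X2 _]]].
    { intros k. generalize (rho_pow_ge1 k) (Rabs_pos (b k)). nra. }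
    apply Rle_trans with (Series (fun k => Ma * Rabs (b k))).
    + apply Series_le.
      * intros k. split.
        { apply cond_pos_sum. intros j. unfold u. apply Rmult_le_pos; [apply Rabs_pos |].
          generalize (rho_pow_ge1 j); lra. }
        rewrite (sum_eq _ (fun j => Rabs (a (j + k)%nat) * rho ^ j * Rabs (b k))).
        2: { intros j _. unfold u. rewrite Rabs_mult. ring. }
        rewrite <- scal_sum. rewrite Rmult_comm.
        apply Rmult_le_compat_r; [apply Rabs_pos |].
        apply Rle_trans with (2 := Ha (n + k)%nat).
        apply Rle_trans with (2 := sum_f_shift_le (fun k => Rabs (a k) * rho ^ k) n k
            (l1_term_ge0 a)).
        apply sum_Rle. intros j _. apply Rmult_le_compat_l; [apply Rabs_pos |].
        rewrite pow_add. generalize (rho_pow_ge1 j) (rho_pow_ge1 k). nra.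
      * apply (ex_series_scal_l Ma (fun k => Rabs (b k))). auto.
    + rewrite Series_scal_l. apply Rmult_le_compat_l; auto.
Qed.

Lemma l1_int0 a M : l1_le a M -> l1_le (int0 a) M.
Proof.
  apply l1_dominated. intros [|n]; unfold int0.
  - rewrite Rmult_0_r, Rabs_R0. apply Rabs_pos.
  - rewrite Rmult_1_r. unfold Rdiv. rewrite Rabs_mult.
    rewrite <- (Rmult_1_r (Rabs (a (S n)))) at 2.
    apply Rmult_le_compat_l; [apply Rabs_pos |].
    assert (1 <= INR (S n)) by (rewrite S_INR; generalize (pos_INR n); lra).
    rewrite Rabs_right.
    + rewrite <- Rinv_1. apply Rinv_le_contravar; lra.
    + left. apply Rinv_0_lt_compat. lra.
Qed.

Lemma conv_comm a b n : conv a b n = conv b a n.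
Proof.
  unfold conv, PS_mult. rewrite <- sum_f_R0_skip. apply sum_eq.
  intros k Hk. replace (n - (n - k))%nat with k by lia. ring.
Qed.

Lemma conv_minus_l a a' b n : conv (fun k => a k - a' k) b n = conv a b n - conv a' b n.
Proof.
  unfold conv, PS_mult. rewrite <- minus_sum. apply sum_eq. intros; ring.
Qed.
Lemma conv_plus_l a a' b n : conv (fun k => a k + a' k) b n = conv a b n + conv a' b n.
Proof.
  unfold conv, PS_mult. rewrite <- plus_sum. apply sum_eq. intros; ring.
Qed.
Lemma conv_minus_r a b b' n : conv a (fun k => b k - b' k) n = conv a b n - conv a b' n.
Proof. rewrite !(conv_comm a). apply conv_minus_l. Qed.
Lemma conv_plus_r a b b' n : conv a (fun k => b k + b' k) n = conv a b n + conv a b' n.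
Proof. rewrite !(conv_comm a). apply conv_plus_l. Qed.
Lemma conv_scal_l c a b n : conv (fun k => c * a k) b n = c * conv a b n.
Proof.
  unfold conv, PS_mult. rewrite scal_sum. apply sum_eq. intros; ring.
Qed.
Lemma conv_ext a a' b b' n : (forall k, a k = a' k) -> (forall k, b k = b' k) ->
  conv a b n = conv a' b' n.
Proof. intros Ha Hb. unfold conv, PS_mult. apply sum_eq. intros. rewrite Ha, Hb. reflexivity. Qed.

Lemma hank_minus_l a a' b Ma Ma' Mb n : l1_le a Ma -> l1_le a' Ma' -> l1_le b Mb ->
  hank (fun k => a k - a' k) b n = hank a b n - hank a' b n.
Proof.
  intros Ha Ha' Hb. unfold hank. rewrite <- Series_minus.
  - apply Series_ext. intros; ring.
  - apply (hank_ex a b Ma Mb n); auto.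
  - apply (hank_ex a' b Ma' Mb n); auto.
Qed.

Lemma hank_plus_l a a' b Ma Ma' Mb n : l1_le a Ma -> l1_le a' Ma' -> l1_le b Mb ->
  hank (fun k => a k + a' k) b n = hank a b n + hank a' b n.
Proof.
  intros Ha Ha' Hb. unfold hank. rewrite <- Series_plus.
  - apply Series_ext. intros; ring.
  - apply (hank_ex a b Ma Mb n); auto.
  - apply (hank_ex a' b Ma' Mb n); auto.
Qed.

Lemma hank_minus_r a b b' Ma Mb Mb' n : l1_le a Ma -> l1_le b Mb -> l1_le b' Mb' ->
  hank a (fun k => b k - b' k) n = hank a b n - hank a b' n.
Proof.
  intros Ha Hb Hb'. unfold hank. rewrite <- Series_minus.
  - apply Series_ext. intros; ring.
  - apply (hank_ex a b Ma Mb n); auto.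
  - apply (hank_ex a b' Ma Mb' n); auto.
Qed.

Lemma hank_plus_r a b b' Ma Mb Mb' n : l1_le a Ma -> l1_le b Mb -> l1_le b' Mb' ->
  hank a (fun k => b k + b' k) n = hank a b n + hank a b' n.
Proof.
  intros Ha Hb Hb'. unfold hank. rewrite <- Series_plus.
  - apply Series_ext. intros; ring.
  - apply (hank_ex a b Ma Mb n); auto.
  - apply (hank_ex a b' Ma Mb' n); auto.
Qed.

Lemma hank_scal_l c a b n : hank (fun k => c * a k) b n = c * hank a b n.
Proof. unfold hank. rewrite <- Series_scal_l. apply Series_ext. intros; ring. Qed.
Lemma hank_scal_r c a b n : hank a (fun k => c * b k) n = c * hank a b n.
Proof. unfold hank. rewrite <- Series_scal_l. apply Series_ext. intros; ring. Qed.
Lemma hank_ext a a' b b' n : (forall k, a k = a' k) -> (forall k, b k = b' k) ->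
  hank a b n = hank a' b' n.
Proof. intros Ha Hb. apply Series_ext. intros. rewrite Ha, Hb. reflexivity. Qed.

Lemma int0_minus a b n : int0 (fun k => a k - b k) n = int0 a n - int0 b n.
Proof. unfold int0. destruct n; unfold Rdiv; ring. Qed.
Lemma int0_plus a b n : int0 (fun k => a k + b k) n = int0 a n + int0 b n.
Proof. unfold int0. destruct n; unfold Rdiv; ring. Qed.
Lemma int0_ext a b n : (forall k, a k = b k) -> int0 a n = int0 b n.
Proof. intros H. unfold int0. rewrite H. reflexivity. Qed.

(** * The linearization at Crapper's wave *)

(* The amplitude of the vertical Crapper wave: [(1 + A zeta) / (1 - A zeta)] has argument
   at most [PI / 4] on the unit disc if and only if [A <= sqrt 2 - 1]. *)
Definition A0 : R := sqrt 2 - 1.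

Lemma A0_sqr : A0 * A0 = 1 - 2 * A0.
Proof.
  unfold A0. assert (H := sqrt_sqrt 2). lra.
Qed.

Lemma A0_bounds : 414213 / 1000000 < A0 < 414214 / 1000000.
Proof.
  unfold A0. split.
  - assert (1414213 / 1000000 < sqrt 2); [| lra].
    rewrite <- (sqrt_square (1414213 / 1000000)) by lra.
    apply sqrt_lt_1; lra.
  - assert (sqrt 2 < 1414214 / 1000000); [| lra].
    rewrite <- (sqrt_square (1414214 / 1000000)) by lra.
    apply sqrt_lt_1; lra.
Qed.

(** Taylor coefficients of [(1 + A x) / (1 - A x)]. *)
Definition crapper (A : R) (n : nat) : R := match n with 0%nat => 1 | _ => 2 * A ^ n end.

Lemma l1_geometric A : 0 <= A -> A * rho < 1 -> l1_le (pow A) (/ (1 - A * rho)).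
Proof.
  intros HA Hq n.
  assert (0 <= A * rho) by (unfold rho; lra).
  rewrite (sum_eq _ (fun k => (A * rho) ^ k)).
  - rewrite tech3 by lra.
    apply Rmult_le_reg_r with (1 - A * rho); [lra |].
    unfold Rdiv. rewrite Rmult_assoc, Rinv_l by lra.
    assert (0 <= (A * rho) ^ S n) by (apply pow_le; auto). lra.
  - intros k _. rewrite Rpow_mult_distr, Rabs_right; auto.
    apply Rle_ge, pow_le; auto.
Qed.

Lemma l1_crapper A : 0 <= A -> A * rho < 1 ->
  l1_le (crapper A) ((1 + A * rho) / (1 - A * rho)).
Proof.
  intros HA Hq n.
  replace ((1 + A * rho) / (1 - A * rho)) with (2 * / (1 - A * rho) - 1) by (field; lra).
  assert (E : sum_f_R0 (fun k => Rabs (crapper A k) * rho ^ k) n =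
              2 * sum_f_R0 (fun k => Rabs (A ^ k) * rho ^ k) n - 1).
  { induction n.
    - simpl. rewrite Rabs_R1. ring.
    - rewrite !tech5, IHn.
      change (crapper A (S n)) with (2 * A ^ S n).
      rewrite Rabs_mult, (Rabs_right 2) by lra. ring. }
  rewrite E. generalize (l1_geometric A HA Hq n). lra.
Qed.

Lemma l1_finite a M m : (forall n, (m < n)%nat -> a n = 0) ->
  sum_f_R0 (fun k => Rabs (a k) * rho ^ k) m <= M -> l1_le a M.
Proof.
  intros H HM n. apply Rle_trans with (2 := HM).
  destruct (le_lt_dec n m) as [L | L].
  - clear HM. induction L; [lra |]. rewrite tech5.
    generalize (l1_term_ge0 a (S m)); intros.
    assert (sum_f_R0 (fun k => Rabs (a k) * rho ^ k) n
         <= sum_f_R0 (fun k => Rabs (a k) * rho ^ k) m); [| lra].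
    clear - L. induction L; [lra |]. rewrite tech5.
    generalize (l1_term_ge0 a (S m)); intros. lra.
  - clear HM. assert (L' : (m <= n)%nat) by lia. clear L. revert H. induction L'; intros; [lra |].
    rewrite tech5. rewrite (H (S m0)) by lia. rewrite Rabs_R0, Rmult_0_l, Rplus_0_r. auto.
Qed.

Lemma l1_tail a M m : (forall n, (n <= m)%nat -> a n = 0) ->
  l1_le (fun j => a (S m + j)%nat) M -> l1_le a (rho ^ S m * M).
Proof.
  intros H HM n.
  assert (0 <= M) by (eapply l1_ge0; eauto).
  assert (H1 := rho_pow_ge1 (S m)).
  assert (Z : forall k, (k <= m)%nat -> sum_f_R0 (fun k => Rabs (a k) * rho ^ k) k = 0).
  { intros k Hk. rewrite (sum_eq _ (fun _ => 0)).
    - rewrite sum_cte. ring.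
    - intros i Hi. rewrite H by lia. rewrite Rabs_R0. ring. }
  destruct (le_lt_dec n m) as [L | L].
  - rewrite Z by lia. nra.
  - rewrite (tech2 _ m n L), Z by lia. rewrite Rplus_0_l.
    rewrite (sum_eq _ (fun j => Rabs (a (S m + j)%nat) * rho ^ j * rho ^ S m)).
    + rewrite <- scal_sum. apply Rmult_le_compat_l; [lra | apply HM].
    + intros i _. rewrite pow_add. ring.
Qed.

(** Kills the geometric sequence [A0 ^ n], hence the rank-one Hankel operator that
    Crapper's wave contributes to the linearized equation. *)
Definition strip (X : nat -> R) (n : nat) : R :=
  match n with 0%nat | 1%nat => 0 | _ => X n - A0 ^ (n - 1) * X 1%nat end.

Lemma strip_minus X Y n : strip (fun k => X k - Y k) n = strip X n - strip Y n.
Proof. destruct n as [|[|n]]; simpl; ring. Qed.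
Lemma strip_plus X Y n : strip (fun k => X k + Y k) n = strip X n + strip Y n.
Proof. destruct n as [|[|n]]; simpl; ring. Qed.
Lemma strip_scal c X n : strip (fun k => c * X k) n = c * strip X n.
Proof. destruct n as [|[|n]]; simpl; ring. Qed.
Lemma strip_ext X Y n : (forall k, X k = Y k) -> strip X n = strip Y n.
Proof. intros H. destruct n as [|[|n]]; simpl; rewrite ?H; reflexivity. Qed.

(** The subtracted sequence has norm [rho * |X 1|] times [rho * A0 / (1 - rho * A0)], and this
    ratio, about 0.72, is below 1. *)
Lemma l1_strip X M : l1_le X M -> l1_le (strip X) (2 * M).
Proof.
  intros HX. assert (B := A0_bounds).
  assert (T := l1_term_le X M 1 HX).
  set (a := fun n => match n with 0%nat | 1%nat => 0 | _ => X n end).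
  set (b := fun n => match n with 0%nat | 1%nat => 0 | _ => A0 ^ (n - 1) * X 1%nat end).
  apply l1_ext with (fun n => a n - b n).
  { intros [|[|n]]; simpl; ring. }
  replace (2 * M) with (M + M) by ring. apply l1_minus.
  - apply l1_dominated with (2 := HX). intros [|[|n]]; simpl; rewrite ?Rabs_R0;
      apply Rabs_pos || apply Rle_refl.
  - assert (Hb : l1_le b (rho ^ 2 * (Rabs (X 1%nat * A0) * / (1 - A0 * rho)))).
    { apply l1_tail.
      - intros [|[|n]]; simpl; lia || reflexivity.
      - apply l1_ext with (fun j => X 1%nat * A0 * A0 ^ j).
        + intros j. simpl. ring.
        + apply l1_scal, l1_geometric; unfold rho; lra. }
    apply l1_weaken with (1 := Hb). apply Rle_trans with (2 := T).
    rewrite Rabs_mult, (Rabs_right A0) by lra.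
    replace (rho ^ 2 * (Rabs (X 1%nat) * A0 * / (1 - A0 * rho)))
      with (Rabs (X 1%nat) * rho ^ 1 * (rho * A0 / (1 - A0 * rho)))
      by (unfold Rdiv; ring).
    rewrite <- (Rmult_1_r (Rabs (X 1%nat) * rho ^ 1)) at 2.
    apply Rmult_le_compat_l; [apply l1_term_ge0 |].
    apply Rmult_le_reg_r with (1 - A0 * rho); [unfold rho; lra |].
    unfold Rdiv. rewrite Rmult_assoc, Rinv_l by (unfold rho; lra). unfold rho; lra.
Qed.

(** Entry (n, m) of the matrix of [d |-> strip (hank d (crapper A0))]. *)
Definition column (m n : nat) : R :=
  match n with
  | 0%nat | 1%nat => 0
  | _ => (if le_dec n m then crapper A0 (m - n) else 0) - A0 ^ (n - 1) * crapper A0 (m - 1)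
  end.

(** Below the diagonal, for [n > m], the entries are [- 2 * A0 ^ (n + m - 2)], a geometric tail. The
    constant 1.44 is twice the bound 0.72 for [rho * A0 / (1 - rho * A0)]. *)
Lemma l1_column_split m : (2 <= m)%nat ->
  l1_le (column m) (sum_f_R0 (fun k => Rabs (column m k) * rho ^ k) m +
     rho ^ m * (144 / 100 * A0 ^ (2 * m - 2))).
Proof.
  intros Hm. assert (B := A0_bounds).
  set (a := fun n => if le_dec n m then column m n else 0).
  set (b := fun n => if le_dec n m then 0 else 2 * A0 ^ (n + m - 2)).
  apply l1_ext with (fun n => a n - b n).
  { intros n. unfold a, b. destruct (le_dec n m); [ring |].
    unfold column. destruct n as [|[|n]]; try lia.
    destruct (le_dec (S (S n)) m); [lia |].
    destruct m as [|[|m]]; try lia. cbn [crapper].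
    replace (S (S m) - 1)%nat with (S m) by lia. cbn [crapper].
    replace (S (S n) + S (S m) - 2)%nat with ((S (S n) - 1) + S m)%nat by lia.
    rewrite pow_add. ring. }
  apply l1_minus.
  - apply l1_finite with m.
    + intros n Hn. unfold a. destruct (le_dec n m); [lia | reflexivity].
    + apply Req_le, sum_eq. intros k Hk. unfold a. destruct (le_dec k m); [reflexivity | lia].
  - assert (Hb : l1_le b (rho ^ S m * (Rabs (2 * A0 ^ (2 * m - 1)) * / (1 - A0 * rho)))).
    { apply l1_tail.
      - intros n Hn. unfold b. destruct (le_dec n m); [reflexivity | lia].
      - apply l1_ext with (fun j => 2 * A0 ^ (2 * m - 1) * A0 ^ j).
        + intros j. unfold b. destruct (le_dec (S m + j) m); [lia |].
          rewrite Rmult_assoc, <- pow_add. do 2 f_equal. lia.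
        + apply l1_scal, l1_geometric; unfold rho; lra. }
    apply l1_weaken with (1 := Hb).
    rewrite Rabs_right by (apply Rle_ge; apply Rmult_le_pos; [lra | apply pow_le; lra]).
    replace (2 * m - 1)%nat with (S (2 * m - 2)) by lia.
    rewrite <- !tech_pow_Rmult. set (u := rho ^ m). set (v := A0 ^ (2 * m - 2)).
    replace (rho * u * (2 * (A0 * v) * / (1 - A0 * rho)))
      with (u * v * (2 * (rho * A0 / (1 - A0 * rho)))) by (unfold Rdiv; ring).
    replace (u * (144 / 100 * v)) with (u * v * (144 / 100)) by ring.
    apply Rmult_le_compat_l.
    + apply Rmult_le_pos; unfold u, v; [generalize (rho_pow_ge1 m); lra |].
      apply pow_le; lra.
    + assert (rho * A0 / (1 - A0 * rho) <= 72 / 100); [| lra].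
      apply Rmult_le_reg_r with (1 - A0 * rho); [unfold rho; lra |].
      unfold Rdiv. rewrite Rmult_assoc, Rinv_l by (unfold rho; lra). unfold rho; lra.
Qed.

(** Once every power is reduced to degree one by [A0_sqr], the numerical estimates become linear in
    [A0]. *)
Lemma A0_pows : A0 ^ 2 = 1 - 2 * A0 /\ A0 ^ 3 = 5 * A0 - 2 /\ A0 ^ 4 = 5 - 12 * A0 /\
  A0 ^ 5 = 29 * A0 - 12 /\ A0 ^ 6 = 29 - 70 * A0 /\ A0 ^ 8 = 169 - 408 * A0.
Proof.
  assert (H := A0_sqr).
  assert (H2 : A0 ^ 2 = 1 - 2 * A0) by (simpl; lra).
  assert (H3 : A0 ^ 3 = 5 * A0 - 2).
  { replace (A0 ^ 3) with (A0 * A0 ^ 2) by ring. rewrite H2. lra. }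
  assert (H4 : A0 ^ 4 = 5 - 12 * A0).
  { replace (A0 ^ 4) with (A0 * A0 ^ 3) by ring. rewrite H3. lra. }
  assert (H5 : A0 ^ 5 = 29 * A0 - 12).
  { replace (A0 ^ 5) with (A0 * A0 ^ 4) by ring. rewrite H4. lra. }
  assert (H6 : A0 ^ 6 = 29 - 70 * A0).
  { replace (A0 ^ 6) with (A0 * A0 ^ 5) by ring. rewrite H5. lra. }
  repeat split; auto.
  replace (A0 ^ 8) with (A0 ^ 4 * A0 ^ 4) by ring. rewrite H4. lra.
Qed.

(** Both terms of an entry are nonnegative and the subtracted one is the smaller: it carries the
    higher power of [A0], and on the diagonal [2 * A0 ^ 2 <= 1]. *)
Lemma column_abs_le m n : (2 <= m)%nat -> (n <= m)%nat ->
  Rabs (column m n) <= crapper A0 (m - n).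
Proof.
  intros Hm Hn. assert (B := A0_bounds).
  assert (P : forall k, 0 <= A0 ^ k) by (intros; apply pow_le; lra).
  assert (Q : forall k, 0 <= crapper A0 k).
  { intros [|k]; simpl; [lra |]. generalize (P (S k)); simpl; lra. }
  unfold column. destruct n as [|[|n]]; rewrite ?Rabs_R0; auto.
  destruct (le_dec (S (S n)) m); [| lia].
  destruct m as [|m]; [lia |]. replace (S m - 1)%nat with m by lia.
  destruct m as [|m]; [lia |]. change (crapper A0 (S m)) with (2 * A0 ^ S m).
  replace (S (S n) - 1)%nat with (S n) by lia.
  assert (E : A0 ^ S n * (2 * A0 ^ S m) <= crapper A0 (S (S m) - S (S n))).
  { replace (A0 ^ S n * (2 * A0 ^ S m)) with (2 * (A0 ^ (S n + S m))) by (rewrite pow_add; ring).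
    destruct (Nat.eq_dec n m) as [-> | N].
    - rewrite Nat.sub_diag. simpl crapper.
      replace (S m + S m)%nat with (2 + (m + m))%nat by lia. rewrite pow_add.
      assert (A0 ^ (m + m) <= 1).
      { rewrite <- (pow1 (m + m)). apply pow_incr. lra. }
      destruct A0_pows as [-> _]. generalize (P (m + m)%nat). nra.
    - replace (S (S m) - S (S n))%nat with (S (m - n - 1)) by lia.
      change (crapper A0 (S (m - n - 1))) with (2 * A0 ^ S (m - n - 1)).
      apply Rmult_le_compat_l; [lra |].
      replace (S n + S m)%nat with (S (m - n - 1) + (2 * n + 2))%nat by lia.
      rewrite pow_add.
      assert (A0 ^ (2 * n + 2) <= 1).
      { rewrite <- (pow1 (2 * n + 2)). apply pow_incr. lra. }
      generalize (P (S (m - n - 1))). nra. }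
  assert (0 <= A0 ^ S n * (2 * A0 ^ S m)).
  { generalize (P (S n)) (P (S m)). intros. apply Rmult_le_pos; lra. }
  rewrite Rabs_right; lra.
Qed.

(** The full sum is [(1 + A0) / (1 - A0) = 1 + sqrt 2]. *)
Lemma crapper_partial_sum m : sum_f_R0 (crapper A0) m <= 2415 / 1000.
Proof.
  assert (B := A0_bounds).
  assert (E : sum_f_R0 (crapper A0) m = 2 * sum_f_R0 (pow A0) m - 1).
  { induction m; [simpl; ring |]. rewrite !tech5, IHm. simpl; ring. }
  rewrite E. rewrite tech3 by lra.
  assert (0 <= A0 ^ S m) by (apply pow_le; lra).
  assert ((1 - A0 ^ S m) / (1 - A0) <= 17072 / 10000); [| lra].
  apply Rmult_le_reg_r with (1 - A0); [lra |].
  unfold Rdiv. rewrite Rmult_assoc, Rinv_l by lra. lra.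
Qed.

(** The factor [m] is compensated by the division in [int0], and the remaining 0.56
    is small enough: 0.56 * 2 * 2.44 * 0.354 < 0.97, where 2.44 bounds the norm of
    [P0] and 0.354 the factor [speed] in [theta_p]. *)
Lemma l1_column m : (2 <= m)%nat -> l1_le (column m) (56 / 100 * INR m * rho ^ m).
Proof.
  intros Hm. apply l1_weaken with (1 := l1_column_split m Hm).
  assert (B := A0_bounds). destruct A0_pows as (E2 & E3 & E4 & E5 & E6 & E8).
  assert (K : forall n, (n <= m)%nat -> rho ^ n <= rho ^ m).
  { intros n Hn. apply Rle_pow; auto. unfold rho; lra. }
  assert (R1 := rho_pow_ge1 m).
  (* From column 5 on, the crude sum 2.415 and the tail stay below [0.56 * 5 = 2.8]. Columns 2, 3
     and 4 need the subtraction inside each entry. *)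
  destruct (le_lt_dec 5 m) as [L | L].
  - assert (S1 : sum_f_R0 (fun k => Rabs (column m k) * rho ^ k) m <= rho ^ m * (2415 / 1000)).
    { apply Rle_trans with (rho ^ m * sum_f_R0 (fun k => crapper A0 (m - k)) m).
      - rewrite scal_sum. apply sum_Rle. intros k Hk.
        apply Rmult_le_compat; auto using Rabs_pos.
        + generalize (rho_pow_ge1 k); lra.
        + apply column_abs_le; auto.
      - apply Rmult_le_compat_l; [lra |]. rewrite sum_f_R0_skip. apply crapper_partial_sum. }
    assert (5 <= INR m) by (apply (le_INR 5 m) in L; simpl in L; lra).
    assert (A0 ^ (2 * m - 2) <= 2 / 1000).
    { replace (2 * m - 2)%nat with (8 + (2 * m - 10))%nat by lia. rewrite pow_add.
      assert (A0 ^ (2 * m - 10) <= 1).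
      { rewrite <- (pow1 (2 * m - 10)). apply pow_incr. lra. }
      assert (0 <= A0 ^ (2 * m - 10)) by (apply pow_le; lra). nra. }
    nra.
  - assert (C : forall n r M, (n <= m)%nat -> 0 <= r <= M -> Rabs r * rho ^ n <= M * rho ^ m).
    { intros n r M Hn Hr. rewrite Rabs_right by lra.
      apply Rmult_le_compat; try lra; auto. generalize (rho_pow_ge1 n); lra. }
    destruct m as [|[|[|[|[|m]]]]]; try lia; unfold sum_f_R0, column;
      cbn [le_dec crapper Nat.sub Nat.mul Nat.add].
    + destruct (le_dec 2 2) as [_|]; [| lia].
      assert (C1 := C 2%nat (1 - A0 ^ 1 * (2 * A0 ^ 1)) (66 / 100) ltac:(lia)).
      assert (0 <= 1 - A0 ^ 1 * (2 * A0 ^ 1) <= 66 / 100) by nra.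
      specialize (C1 H). rewrite !Rabs_R0. rewrite E2.
      simpl INR. nra.
    (* The tightest column, which dictates 0.56: the sum 0.687 + 0.942 + 1.44 * [A0 ^ 4] is about
       1.671, against 0.56 * 3 = 1.68. *)
    + destruct (le_dec 2 3) as [_|]; [| lia]. destruct (le_dec 3 3) as [_|]; [| lia].
      assert (C1 := C 2%nat (2 * A0 ^ 1 - A0 ^ 1 * (2 * A0 ^ 2)) (687 / 1000) ltac:(lia)).
      assert (C2 := C 3%nat (1 - A0 ^ 2 * (2 * A0 ^ 2)) (942 / 1000) ltac:(lia)).
      assert (0 <= 2 * A0 ^ 1 - A0 ^ 1 * (2 * A0 ^ 2) <= 687 / 1000) by nra.
      assert (0 <= 1 - A0 ^ 2 * (2 * A0 ^ 2) <= 942 / 1000) by nra.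
      specialize (C1 H). specialize (C2 H0). rewrite !Rabs_R0. rewrite E4.
      simpl INR. nra.
    + destruct (le_dec 2 4) as [_|]; [| lia]. destruct (le_dec 3 4) as [_|]; [| lia].
      destruct (le_dec 4 4) as [_|]; [| lia].
      assert (C1 := C 2%nat (2 * A0 ^ 2 - A0 ^ 1 * (2 * A0 ^ 3)) (30 / 100) ltac:(lia)).
      assert (C2 := C 3%nat (2 * A0 ^ 1 - A0 ^ 2 * (2 * A0 ^ 3)) (83 / 100) ltac:(lia)).
      assert (C3 := C 4%nat (1 - A0 ^ 3 * (2 * A0 ^ 3)) 1 ltac:(lia)).
      assert (0 <= 2 * A0 ^ 2 - A0 ^ 1 * (2 * A0 ^ 3) <= 30 / 100) by nra.
      assert (0 <= 2 * A0 ^ 1 - A0 ^ 2 * (2 * A0 ^ 3) <= 83 / 100) by nra.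
      assert (0 <= 1 - A0 ^ 3 * (2 * A0 ^ 3) <= 1) by nra.
      specialize (C1 H). specialize (C2 H0). specialize (C3 H1). rewrite !Rabs_R0. rewrite E6.
      simpl INR. nra.
Qed.

Lemma Series_shift_zero (u : nat -> R) n :
  ex_series u -> (forall k, (k < n)%nat -> u k = 0) ->
  Series u = Series (fun k => u (n + k)%nat).
Proof.
  intros E Z. destruct n as [|n]; [reflexivity |].
  rewrite (Series_incr_n u (S n)) by (auto; lia).
  rewrite (sum_eq _ (fun _ => 0)).
  - rewrite sum_cte. simpl. ring.
  - intros k Hk. apply Z. simpl in Hk. lia.
Qed.

Lemma ex_series_zero (u : nat -> R) : (forall k, u k = 0) -> ex_series u.
Proof.
  intros H. apply ex_series_ext with (fun k => 0 * (/ 2) ^ k).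
  - intros k. rewrite H. apply Rmult_0_l.
  - apply (ex_series_scal_l 0 (pow (/ 2))), ex_series_geom. rewrite Rabs_right; lra.
Qed.

Lemma Series_zero (u : nat -> R) : (forall k, u k = 0) -> Series u = 0.
Proof.
  intros H. rewrite (Series_ext _ (fun k => 0 * u k)).
  - rewrite Series_scal_l. ring.
  - intros k. rewrite H. ring.
Qed.

(** The substitution [m = n + k] turns the correlation into a sum over columns. Padding with zeros
    for [m < n] allows rows [n] and 1 to be subtracted term by term. *)
Lemma strip_hank_column e M n : l1_le e M -> e 0%nat = 0 -> e 1%nat = 0 ->
  ex_series (fun m => int0 e m * column m n) /\
  strip (hank (int0 e) (crapper A0)) n = Series (fun m => int0 e m * column m n).
Proof.
  intros He E0 E1. set (d := int0 e).
  assert (B := A0_bounds).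
  assert (Hd : l1_le d M) by (apply l1_int0; auto).
  assert (HP : l1_le (crapper A0) ((1 + A0 * rho) / (1 - A0 * rho)))
    by (apply l1_crapper; unfold rho; lra).
  assert (d0 : d 0%nat = 0) by (unfold d, int0; ring).
  assert (d1 : d 1%nat = 0) by (unfold d, int0; rewrite E1; unfold Rdiv; ring).
  destruct n as [|[|n]].
  - split; [apply ex_series_zero; intros; simpl; ring |].
    symmetry; apply Series_zero; intros; simpl; ring.
  - split; [apply ex_series_zero; intros; simpl; ring |].
    symmetry; apply Series_zero; intros; simpl; ring.
  - set (N := S (S n)).
    set (f := fun (q m : nat) => if le_dec q m then d m * crapper A0 (m - q) else 0).
    assert (G : forall q, ex_series (f q) /\ hank d (crapper A0) q = Series (f q)).
    { intros q. assert (Eq : ex_series (f q)).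
      { destruct q as [|q].
        - apply ex_series_ext with (fun k => d (0 + k)%nat * crapper A0 k).
          + intros k. unfold f. destruct (le_dec 0 k); [| lia]. rewrite Nat.sub_0_r. reflexivity.
          + apply (hank_ex _ _ _ _ 0 Hd HP).
        - apply (ex_series_incr_n (f (S q)) (S q)).
          apply ex_series_ext with (fun k => d (S q + k)%nat * crapper A0 k).
          + intros k. unfold f. destruct (le_dec (S q) (S q + k)); [| lia].
            do 2 f_equal. lia.
          + apply (hank_ex _ _ _ _ (S q) Hd HP). }
      split; auto. rewrite (Series_shift_zero (f q) q Eq).
      - apply Series_ext. intros k. unfold f. destruct (le_dec q (q + k)); [| lia].
        do 2 f_equal. lia.
      - intros k Hk. unfold f. destruct (le_dec q k); [lia | reflexivity]. }
    destruct (G N) as [GN1 GN2]. destruct (G 1%nat) as [G11 G12].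
    assert (T : forall m, f N m - A0 ^ (N - 1) * f 1%nat m = d m * column m N).
    { intros m. unfold f, column. unfold N.
      destruct m as [|[|m]].
      - destruct (le_dec (S (S n)) 0); [lia |]. destruct (le_dec 1 0); [lia |].
        rewrite d0. ring.
      - destruct (le_dec (S (S n)) 1); [lia |]. rewrite d1.
        destruct (le_dec 1 1); ring.
      - destruct (le_dec 1 (S (S m))); [| lia].
        destruct (le_dec (S (S n)) (S (S m))); ring. }
    split.
    + apply ex_series_ext with (1 := T).
      apply (ex_series_minus (f N) (fun m => A0 ^ (N - 1) * f 1%nat m)); auto.
      apply (ex_series_scal_l (A0 ^ (N - 1)) (f 1%nat)); auto.
    + transitivity (hank d (crapper A0) N - A0 ^ (N - 1) * hank d (crapper A0) 1%nat);
        [reflexivity |].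
      rewrite GN2, G12, <- Series_scal_l, <- Series_minus; auto.
      * apply Series_ext. intros m. rewrite <- T. reflexivity.
      * apply (ex_series_scal_l (A0 ^ (N - 1)) (f 1%nat)); auto.
Qed.

Lemma ex_series_abs_int0_column e M n : l1_le e M -> e 0%nat = 0 -> e 1%nat = 0 ->
  ex_series (fun m => Rabs (int0 e m * column m n)).
Proof.
  intros He E0 E1.
  apply (l1_dominates_series e M (fun m => int0 e m * column m n)); auto.
  intros m. rewrite Rabs_mult.
  destruct m as [|[|m]].
  - unfold int0. rewrite Rmult_0_r, Rabs_R0, Rmult_0_l. apply l1_term_ge0.
  - unfold int0. rewrite E1. unfold Rdiv. rewrite !Rmult_0_l, Rabs_R0, Rmult_0_l. lra.
  - assert (H := l1_coeff _ _ n (l1_column (S (S m)) ltac:(lia))).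
    unfold int0. rewrite Rmult_1_r. unfold Rdiv. rewrite Rabs_mult.
    assert (I : 0 < INR (S (S m))) by (apply lt_0_INR; lia).
    rewrite (Rabs_right (/ INR (S (S m)))) by (left; apply Rinv_0_lt_compat; auto).
    rewrite Rmult_assoc. apply Rmult_le_compat_l; [apply Rabs_pos |].
    apply Rmult_le_reg_l with (INR (S (S m))); auto.
    rewrite <- Rmult_assoc, Rinv_r, Rmult_1_l by lra.
    apply Rle_trans with (1 := H). generalize (rho_pow_ge1 (S (S m))). nra.
Qed.

(** The column-sum criterion for operators on l1. As [e] starts at index 2, only columns covered by
    [l1_column] occur, and the factor [m] in that bound cancels the division in [int0]. *)
Lemma l1_strip_hank e M : l1_le e M -> e 0%nat = 0 -> e 1%nat = 0 ->
  l1_le (strip (hank (int0 e) (crapper A0))) (56 / 100 * M).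
Proof.
  intros He E0 E1 L.
  set (u := fun n m => Rabs (int0 e m * column m n) * rho ^ n).
  assert (Eu : forall n, ex_series (u n)).
  { intros n. apply (ex_series_scal_r (rho ^ n) (fun m => Rabs (int0 e m * column m n))).
    apply (ex_series_abs_int0_column e M n); auto. }
  destruct (ex_series_sum_f u L Eu) as [S1 S2].
  apply Rle_trans with (sum_f_R0 (fun n => Series (u n)) L).
  - apply sum_Rle. intros n _. unfold u. rewrite Series_scal_r.
    apply Rmult_le_compat_r; [generalize (rho_pow_ge1 n); lra |].
    destruct (strip_hank_column e M n He E0 E1) as [_ ->].
    apply Series_Rabs, (ex_series_abs_int0_column e M n); auto.
  - rewrite <- S2. assert (He' := He). apply l1_series in He. destruct He as [H1 H2].
    apply Rle_trans with (Series (fun m => 56 / 100 * (Rabs (e m) * rho ^ m))).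
    + apply Series_le.
      * intros m. split.
        { apply cond_pos_sum. intros n. unfold u. apply Rmult_le_pos; [apply Rabs_pos |].
          generalize (rho_pow_ge1 n); lra. }
        rewrite (sum_eq _ (fun n => Rabs (column m n) * rho ^ n * Rabs (int0 e m))).
        2: { intros n _. unfold u. rewrite Rabs_mult. ring. }
        rewrite <- scal_sum.
        destruct m as [|[|m]].
        { unfold int0. rewrite Rmult_0_r, Rabs_R0, Rmult_0_l.
          generalize (l1_term_ge0 e 0); lra. }
        { unfold int0. rewrite E1. unfold Rdiv. rewrite !Rmult_0_l, Rabs_R0. lra. }
        apply Rle_trans with
          (Rabs (int0 e (S (S m))) * (56 / 100 * INR (S (S m)) * rho ^ S (S m))).
        { apply Rmult_le_compat_l; [apply Rabs_pos |]. apply l1_column. lia. }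
        unfold int0. rewrite Rmult_1_r. unfold Rdiv. rewrite Rabs_mult.
        assert (I : 0 < INR (S (S m))) by (apply lt_0_INR; lia).
        rewrite (Rabs_right (/ INR (S (S m)))) by (left; apply Rinv_0_lt_compat; auto).
        apply Req_le. field. lra.
      * apply (ex_series_scal_l (56 / 100) (fun k => Rabs (e k) * rho ^ k)); auto.
    + rewrite Series_scal_l. apply Rmult_le_compat_l; [lra | exact H2].
Qed.

(** A geometric [v] makes [hank v w] proportional to [A0 ^ n] whatever [w] is. The value [v 0] could
    enter only row 0, which [strip] clears. *)
Lemma strip_hank_geometric w Mw v : l1_le w Mw ->
  (forall n, (1 <= n)%nat -> v n = 4 * A0 ^ n) ->
  forall n, strip (hank v w) n = 0.
Proof.
  intros Hw Hv n. destruct n as [|[|n]]; [reflexivity | reflexivity |].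
  change (hank v w (S (S n)) - A0 ^ (S (S n) - 1) * hank v w 1%nat = 0).
  unfold hank. rewrite <- Series_scal_l.
  rewrite (Series_ext (fun k => v (S (S n) + k)%nat * w k)
     (fun k => A0 ^ (S (S n) - 1) * (v (1 + k)%nat * w k))); [ring |].
  intros k. rewrite !Hv by lia.
  replace (S (S n) + k)%nat with ((S (S n) - 1) + (1 + k))%nat by lia.
  rewrite (pow_add _ (S (S n) - 1)). ring.
Qed.

(** With [x = A zeta], this is [((1 + x) / (1 - x)) ^ 2 = 1 + 4 x / (1 - x) ^ 2]. *)
Lemma conv_crapper A n : (1 <= n)%nat -> conv (crapper A) (crapper A) n = 4 * INR n * A ^ n.
Proof.
  intros Hn. unfold conv, PS_mult. destruct n as [|n]; [lia |].
  rewrite tech5, Nat.sub_diag.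
  assert (E : forall j, (j <= n)%nat ->
    sum_f_R0 (fun k => crapper A k * crapper A (S n - k)%nat) j = (4 * INR j + 2) * A ^ S n).
  { induction j; intros Hj.
    - simpl. ring.
    - rewrite tech5, IHj by lia. rewrite S_INR.
      replace (S n - S j)%nat with (S (n - j - 1)) by lia.
      change (crapper A (S j)) with (2 * A ^ S j).
      change (crapper A (S (n - j - 1))) with (2 * A ^ S (n - j - 1)).
      replace (2 * A ^ S j * (2 * A ^ S (n - j - 1))) with (4 * (A ^ S j * A ^ S (n - j - 1))) by ring.
      rewrite <- pow_add. replace (S j + S (n - j - 1))%nat with (S n) by lia. ring. }
  rewrite E by lia. rewrite S_INR. cbn [crapper]. ring.
Qed.

Lemma int0_conv_crapper A n : (1 <= n)%nat -> int0 (conv (crapper A) (crapper A)) n = 4 * A ^ n.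
Proof.
  intros Hn. unfold int0. rewrite conv_crapper by auto.
  destruct n; [lia |]. rewrite S_INR. generalize (pos_INR n). intros. field. lra.
Qed.

(** The correlation is geometric again. At [g = 0] the equations [p_n = c Y_n], [n >= 1], therefore
    all reduce to the same equation for [c], which is why Crapper's profile is a solution. *)
Lemma hank_crapper A n : 0 <= A -> A * rho < 1 -> (1 <= n)%nat ->
  hank (int0 (conv (crapper A) (crapper A))) (crapper A) n =
  4 * A ^ n * ((1 + A ^ 2) / (1 - A ^ 2)).
Proof.
  intros HA HAr Hn.
  assert (A < 1) by (unfold rho in HAr; lra).
  assert (A2 : 0 <= A ^ 2 < 1) by nra.
  unfold hank.
  rewrite (Series_ext _ (fun k => 4 * A ^ n * (A ^ k * crapper A k))).
  2: { intros k. rewrite int0_conv_crapper by lia. rewrite pow_add. ring. }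
  rewrite Series_scal_l. f_equal.
  assert (G : is_series (fun k => (A ^ 2) ^ k) (/ (1 - A ^ 2))).
  { apply is_series_geom. rewrite Rabs_right; lra. }
  rewrite (Series_incr_1 (fun k => A ^ k * crapper A k)).
  - simpl pow at 1. cbn [crapper].
    rewrite (Series_ext _ (fun k => (2 * A ^ 2) * (A ^ 2) ^ k)).
    + rewrite Series_scal_l.
      replace (Series (pow (A ^ 2))) with (/ (1 - A ^ 2))
        by (symmetry; apply is_series_unique; exact G).
      field. lra.
    + intros k. rewrite <- pow_mult. replace (2 * k)%nat with (k + k)%nat by lia.
      rewrite pow_add. simpl. ring.
  - apply ex_series_incr_1.
    apply ex_series_ext with (fun k => (2 * A ^ 2) * (A ^ 2) ^ k).
    + intros k. rewrite <- pow_mult. replace (2 * k)%nat with (k + k)%nat by lia.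
      rewrite pow_add. cbn [crapper]. simpl. ring.
    + apply (ex_series_scal_l (2 * A ^ 2) (pow (A ^ 2))). eexists; exact G.
Qed.

(** * The fixed point equation *)

(* Coefficients of [v] where [dz/dw = p ^ 2] and [z = w + i v]; of the antianalytic parts
   of [2 y p] and [(s - 1) / g conj p], where [s = 1 + g Re t]; and of [2 (Re t) ^ 2]
   (up to real parts). *)
Definition vcoef (p : nat -> R) : nat -> R := int0 (conv p p).
Definition ycoef (p : nat -> R) : nat -> R := hank (vcoef p) p.
Definition zcoef (p t : nat -> R) (n : nat) : R := / 2 * (conv t p n + hank p t n).
Definition qcoef (t : nat -> R) (n : nat) : R :=
  conv t t n + 2 * hank t t n - (if n then hank t t 0%nat else 0).
(** The constant [c], half the vorticity, read off from [p_1 + g Z_1 = c Y_1] with [p_1 = a]. *)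
Definition speed (a g : R) (p t : nat -> R) : R := (a + g * zcoef p t 1) / ycoef p 1.
Definition shifted_geometric (n : nat) : R := match n with 0%nat => 0 | S k => A0 ^ k end.
(** Since [a = c Y_1 - g Z_1] by the choice of [speed], the geometric terms cancel for [n >= 2] and
    the value is [c Y_n - g Z_n]. In this form the rank-one part of the correlation is removed
    before differences are estimated. *)
Definition theta_p (a g : R) (p t : nat -> R) (n : nat) : R :=
  (if n then 1 else 0) + a * shifted_geometric n
  + speed a g p t * strip (ycoef p) n - g * strip (zcoef p t) n.
(** In real parts on the surface, a fixed point satisfies the relation for [s ^ 2] of
    [wave_bernoulli]. *)
Definition theta_t (g : R) (p t : nat -> R) (n : nat) : R :=
  - vcoef p n - g / 4 * qcoef t n.

Definition P0 : nat -> R := crapper A0.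
Definition V0 : nat -> R := vcoef P0.

(** The weight 10 on [t] absorbs the Lipschitz constant 4.9 of [vcoef], which counts as 0.49 in this
    norm. *)
Definition pair_close (p t p' t' : nat -> R) (M : R) : Prop :=
  l1_le (fun n => p n - p' n) M /\ l1_le (fun n => t n - t' n) (10 * M).
Definition rad : R := 1 / 100000.
Definition near_crapper (p t : nat -> R) : Prop :=
  p 0%nat = 1 /\ pair_close p t P0 (fun n => - V0 n) rad.

Lemma nb_P0 : l1_le P0 (244 / 100).
Proof.
  assert (B := A0_bounds).
  apply l1_weaken with (1 := l1_crapper A0 ltac:(lra) ltac:(unfold rho; lra)).
  apply Rmult_le_reg_r with (1 - A0 * rho); [unfold rho; lra |].
  unfold Rdiv. rewrite Rmult_assoc, Rinv_l by (unfold rho; lra). unfold rho; lra.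
Qed.

Lemma l1_shifted_geometric : l1_le shifted_geometric 2.
Proof.
  assert (B := A0_bounds).
  apply l1_weaken with (rho ^ 1 * / (1 - A0 * rho)).
  - apply l1_tail.
    + intros [|n] Hn; [reflexivity | lia].
    + apply (l1_geometric A0); unfold rho; lra.
  - apply Rmult_le_reg_r with (1 - A0 * rho); [unfold rho; lra |].
    rewrite Rmult_assoc, Rinv_l by (unfold rho; lra). unfold rho; lra.
Qed.

(** From [p ^ 2 - p' ^ 2 = (p + p') (p - p')]. *)
Lemma l1_vcoef_diff p p' Mp Mp' M : l1_le p Mp -> l1_le p' Mp' ->
  l1_le (fun n => p n - p' n) M -> l1_le (fun n => vcoef p n - vcoef p' n) ((Mp + Mp') * M).
Proof.
  intros Hp Hp' Hw.
  apply l1_ext with (int0 (conv (fun k => p k + p' k) (fun k => p k - p' k))).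
  - intros n. unfold vcoef. rewrite <- int0_minus. apply int0_ext. intros k.
    rewrite conv_plus_l, !conv_minus_r, (conv_comm p' p). ring.
  - apply l1_int0, l1_conv; auto. apply l1_plus; auto.
Qed.

Lemma l1_vcoef p Mp : l1_le p Mp -> l1_le (vcoef p) (Mp * Mp).
Proof. intros Hp. apply l1_int0, l1_conv; auto. Qed.

Lemma l1_ycoef_diff p p' Mp Mp' M : l1_le p Mp -> l1_le p' Mp' ->
  l1_le (fun n => p n - p' n) M ->
  l1_le (fun n => ycoef p n - ycoef p' n) ((Mp + Mp') * M * Mp + Mp' * Mp' * M).
Proof.
  intros Hp Hp' Hw.
  assert (Hv := l1_vcoef p Mp Hp). assert (Hv' := l1_vcoef p' Mp' Hp').
  assert (Hd := l1_vcoef_diff p p' Mp Mp' M Hp Hp' Hw).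
  apply l1_ext with (fun n => hank (fun k => vcoef p k - vcoef p' k) p n
                              + hank (vcoef p') (fun k => p k - p' k) n).
  - intros n. unfold ycoef.
    rewrite (hank_minus_l _ _ _ _ _ _ n Hv Hv' Hp), (hank_minus_r _ _ _ _ _ _ n Hv' Hp Hp').
    ring.
  - apply l1_plus; apply l1_hank; auto.
Qed.

Lemma l1_zcoef p t Mp Mt : l1_le p Mp -> l1_le t Mt -> l1_le (zcoef p t) (Mp * Mt).
Proof.
  intros Hp Ht.
  replace (Mp * Mt) with (Rabs (/ 2) * (Mt * Mp + Mp * Mt)) by (rewrite Rabs_right; lra).
  apply (l1_scal (fun n => conv t p n + hank p t n)).
  apply l1_plus; [apply l1_conv | apply l1_hank]; auto.
Qed.

Lemma l1_zcoef_diff p t p' t' Mp Mp' Mt Mt' M N : l1_le p Mp -> l1_le p' Mp' -> l1_le t Mt -> l1_le t' Mt' ->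
  l1_le (fun n => p n - p' n) M -> l1_le (fun n => t n - t' n) N ->
  l1_le (fun n => zcoef p t n - zcoef p' t' n) (/ 2 * (N * Mp + Mt' * M + (M * Mt + Mp' * N))).
Proof.
  intros Hp Hp' Ht Ht' Hw Hu.
  apply l1_ext with (fun n => / 2 * (conv (fun k => t k - t' k) p n + conv t' (fun k => p k - p' k) n
     + (hank (fun k => p k - p' k) t n + hank p' (fun k => t k - t' k) n))).
  - intros n. unfold zcoef.
    rewrite (hank_minus_l _ _ _ _ _ _ n Hp Hp' Ht), (hank_minus_r _ _ _ _ _ _ n Hp' Ht Ht').
    rewrite conv_minus_l, conv_minus_r. ring.
  - eapply l1_weaken; [apply l1_scal | rewrite Rabs_right by lra; apply Rle_refl].
    repeat apply l1_plus; first [apply l1_conv | apply l1_hank]; auto.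
Qed.

Lemma l1_at0 x M : l1_le x M -> l1_le (fun n => if n then x 0%nat else 0) M.
Proof.
  apply l1_dominated. intros [|n]; [apply Rle_refl |]. rewrite Rabs_R0. apply Rabs_pos.
Qed.

Lemma l1_qcoef t Mt : l1_le t Mt -> l1_le (qcoef t) (4 * (Mt * Mt)).
Proof.
  intros Ht. assert (Hh := l1_hank t t _ _ Ht Ht).
  apply l1_weaken with ((Mt * Mt + Rabs 2 * (Mt * Mt)) + Mt * Mt).
  - apply l1_minus; [apply l1_plus |].
    + apply l1_conv; auto.
    + apply l1_scal; auto.
    + apply l1_at0; auto.
  - rewrite Rabs_right; lra.
Qed.

Lemma l1_qcoef_diff t t' Mt Mt' N : l1_le t Mt -> l1_le t' Mt' -> l1_le (fun n => t n - t' n) N ->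
  l1_le (fun n => qcoef t n - qcoef t' n) (4 * ((Mt + Mt') * N)).
Proof.
  intros Ht Ht' Hu.
  set (h := fun n => hank (fun k => t k - t' k) t n + hank t' (fun k => t k - t' k) n).
  assert (Eh : forall n, hank t t n - hank t' t' n = h n).
  { intros n. unfold h.
    rewrite (hank_minus_l _ _ _ _ _ _ n Ht Ht' Ht), (hank_minus_r _ _ _ _ _ _ n Ht' Ht Ht').
    ring. }
  assert (Hh : l1_le h (N * Mt + Mt' * N)) by (apply l1_plus; apply l1_hank; auto).
  apply l1_ext with (fun n => conv (fun k => t k + t' k) (fun k => t k - t' k) n + 2 * h n
     - (if n then h 0%nat else 0)).
  - intros n. unfold qcoef. rewrite conv_plus_l, !conv_minus_r, (conv_comm t' t).
    destruct n; rewrite <- !Eh; ring.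
  - apply l1_weaken with ((Mt + Mt') * N + Rabs 2 * (N * Mt + Mt' * N) + (N * Mt + Mt' * N)).
    + apply l1_minus; [apply l1_plus |].
      * apply l1_conv; auto. apply l1_plus; auto.
      * apply l1_scal; auto.
      * apply l1_at0; auto.
    + rewrite Rabs_right by lra. lra.
Qed.

Lemma V0_eq n : (1 <= n)%nat -> V0 n = 4 * A0 ^ n.
Proof. apply int0_conv_crapper. Qed.

Lemma near_crapper_bounds p t : near_crapper p t -> l1_le p (245 / 100) /\ l1_le t 7.
Proof.
  intros [_ [Hp Ht]]. split.
  - apply l1_ext with (fun n => (p n - P0 n) + P0 n); [intros; ring |].
    apply l1_weaken with (rad + 244 / 100); [| unfold rad; lra].
    apply l1_plus; auto using nb_P0.
  - apply l1_ext with (fun n => (t n - - V0 n) - V0 n); [intros; ring |].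
    apply l1_weaken with (10 * rad + 244 / 100 * (244 / 100)); [| unfold rad; lra].
    apply l1_minus; auto. apply l1_vcoef, nb_P0.
Qed.

(** Expanding at [P0], the difference of the correlations is [hank (v - v') P0 + hank (v - v') (p -
    P0) + hank (v' - V0) w + hank V0 w] with [w = p - p']. The last term is killed by [strip], the
    two middle ones are of order [rad * M], and the first has main part [hank (int0 (2 P0 w)) P0].
    The constant 2.734 is just above 0.56 * 2 * 2.44. *)
Lemma strip_ycoef_diff p p' t t' M D : near_crapper p t -> near_crapper p' t' ->
  l1_le (fun n => p n - p' n) M -> Rabs (p 1%nat - p' 1%nat) <= D ->
  l1_le (fun n => strip (ycoef p) n - strip (ycoef p') n) (2734 / 1000 * M + 25 * D).
Proof.
  intros N N' Hw HD.
  destruct (near_crapper_bounds _ _ N) as [Hp _]. destruct (near_crapper_bounds _ _ N') as [Hp' _].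
  destruct N as [p0 [Hr _]]. destruct N' as [p0' [Hr' _]].
  assert (PP := nb_P0). assert (B := A0_bounds).
  assert (M0 := l1_ge0 _ _ Hw).
  assert (D0 : 0 <= D) by (generalize (Rabs_pos (p 1%nat - p' 1%nat)); lra).
  set (w := fun n => p n - p' n) in *.
  (* The prescribed coefficient, controlled by [D], is separated from the indices [n >= 2], to which
     the sharp bound [l1_strip_hank] applies. *)
  set (w1 := fun n => match n with 1%nat => w 1%nat | _ => 0 end).
  set (w2 := fun n => match n with 0%nat | 1%nat => 0 | _ => w n end).
  assert (Hw2 : l1_le w2 M).
  { apply l1_dominated with (2 := Hw). intros [|[|n]]; simpl; rewrite ?Rabs_R0;
      apply Rabs_pos || apply Rle_refl. }
  assert (Hw1 : l1_le w1 (rho * D)).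
  { apply l1_finite with 1%nat.
    - intros [|[|n]]; simpl; lia || reflexivity.
    - simpl. rewrite Rabs_R0. fold (w 1%nat) in HD. unfold rho; lra. }
  assert (Ew : forall n, w n = w1 n + w2 n).
  { intros [|[|n]]; unfold w1, w2; try ring. unfold w. rewrite p0, p0'. ring. }
  set (e1 := fun n => 2 * conv P0 w1 n). set (e2 := fun n => 2 * conv P0 w2 n).
  assert (He1 : l1_le e1 (2 * (244 / 100 * (rho * D)))).
  { eapply l1_weaken; [apply l1_scal, l1_conv; eauto | rewrite Rabs_right by lra; apply Rle_refl]. }
  assert (He2 : l1_le e2 (2 * (244 / 100 * M))).
  { eapply l1_weaken; [apply l1_scal, l1_conv; eauto | rewrite Rabs_right by lra; apply Rle_refl]. }
  set (s := fun n => (p n - P0 n) + (p' n - P0 n)).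
  assert (Hs : l1_le s (rad + rad)) by (apply l1_plus; auto).
  set (e3 := conv s w).
  assert (He3 : l1_le e3 ((rad + rad) * M)) by (apply l1_conv; auto).
  assert (Hv := l1_vcoef p _ Hp). assert (Hv' := l1_vcoef p' _ Hp').
  assert (HV : l1_le V0 (244 / 100 * (244 / 100))) by apply l1_vcoef, PP.
  assert (Hvd := l1_vcoef_diff p p' _ _ _ Hp Hp' Hw).
  assert (HVd := l1_vcoef_diff p' P0 _ _ _ Hp' PP Hr').
  assert (Evd : forall n, vcoef p n - vcoef p' n = int0 e1 n + int0 e2 n + int0 e3 n).
  { intros n. unfold vcoef. rewrite <- int0_minus, <- !int0_plus. apply int0_ext. intros k.
    unfold e1, e2, e3.
    replace (conv p p k - conv p' p' k) with (conv (fun k => p k + p' k) w k).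
    2: { unfold w. rewrite conv_plus_l, !conv_minus_r, (conv_comm p' p). ring. }
    replace (2 * conv P0 w1 k + 2 * conv P0 w2 k) with (2 * conv P0 w k).
    2: { rewrite (conv_ext P0 P0 w (fun k => w1 k + w2 k)) by auto. rewrite conv_plus_r. ring. }
    rewrite <- conv_scal_l, <- conv_plus_l. apply conv_ext; auto. intros j. unfold s. ring. }
  apply l1_ext with (fun n => strip (hank (int0 e2) P0) n + strip (hank (int0 e1) P0) n
    + strip (hank (int0 e3) P0) n
    + strip (hank (fun k => vcoef p k - vcoef p' k) (fun k => p k - P0 k)) n
    + strip (hank (fun k => vcoef p' k - V0 k) w) n).
  - intros n. rewrite <- strip_minus.
    rewrite <- (Rplus_0_r (_ + strip _ n)).
    rewrite <- (strip_hank_geometric w M V0 Hw V0_eq n).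
    rewrite <- !strip_plus. apply strip_ext. intros k. unfold ycoef.
    assert (I1 := l1_int0 _ _ He1). assert (I2 := l1_int0 _ _ He2). assert (I3 := l1_int0 _ _ He3).
    assert (F1 : hank (int0 e2) P0 k + hank (int0 e1) P0 k + hank (int0 e3) P0 k
               = hank (fun k => vcoef p k - vcoef p' k) P0 k).
    { rewrite (hank_ext (fun k => vcoef p k - vcoef p' k) (fun k => int0 e1 k + int0 e2 k + int0 e3 k) P0 P0)
        by auto.
      rewrite (hank_plus_l _ _ _ _ _ _ k (l1_plus _ _ _ _ I1 I2) I3 PP).
      rewrite (hank_plus_l _ _ _ _ _ _ k I1 I2 PP). ring. }
    rewrite F1.
    rewrite (hank_minus_r _ _ _ _ _ _ k Hvd Hp PP).
    rewrite (hank_minus_l _ _ _ _ _ _ k Hv Hv' Hp).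
    rewrite (hank_minus_l _ _ _ _ _ _ k Hv' HV Hw).
    unfold w. rewrite !(hank_minus_r _ _ _ _ _ _ k Hv' Hp Hp'). ring.
  - apply l1_weaken with (56 / 100 * (2 * (244 / 100 * M))
       + 2 * (2 * (244 / 100 * (rho * D)) * (244 / 100))
       + 2 * ((rad + rad) * M * (244 / 100))
       + 2 * ((245 / 100 + 245 / 100) * M * rad)
       + 2 * ((245 / 100 + 244 / 100) * rad * M)).
    + repeat apply l1_plus.
      * apply l1_strip_hank; auto.
        -- unfold e2, conv, PS_mult. simpl. ring.
        -- unfold e2, conv, PS_mult. simpl. ring.
      * apply l1_strip, l1_hank; auto. apply l1_int0; auto.
      * apply l1_strip, l1_hank; auto. apply l1_int0; auto.
      * apply l1_strip, l1_hank; auto.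
      * apply l1_strip, l1_hank; auto.
    + unfold rho, rad. lra.
Qed.

Lemma ycoef_P0_1 : ycoef P0 1%nat = 4 * (1 - A0).
Proof.
  assert (B := A0_bounds). unfold ycoef, vcoef, P0.
  rewrite hank_crapper by (unfold rho; lra || lia).
  destruct A0_pows as [-> _]. rewrite pow_1. field. lra.
Qed.

Lemma strip_ycoef_P0 n : strip (ycoef P0) n = 0.
Proof. apply strip_hank_geometric with (244 / 100); [apply nb_P0 | apply V0_eq]. Qed.

Lemma ycoef_near p t : near_crapper p t ->
  2342 / 1000 <= ycoef p 1%nat <= 2345 / 1000 /\ l1_le (strip (ycoef p)) (40 * rad).
Proof.
  intros N. destruct (near_crapper_bounds _ _ N) as [Hp _]. destruct N as [_ [Hr _]].
  assert (B := A0_bounds).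
  assert (H := l1_ycoef_diff p P0 _ _ _ Hp nb_P0 Hr).
  split.
  - assert (H1 := l1_coeff _ _ 1 H). simpl in H1. rewrite ycoef_P0_1 in H1.
    apply Rabs_le_between in H1. unfold rad in H1. lra.
  - apply l1_ext with (strip (fun n => ycoef p n - ycoef P0 n)).
    + intros n. rewrite strip_minus, strip_ycoef_P0. ring.
    + apply l1_weaken with (1 := l1_strip _ _ H). unfold rad. lra.
Qed.

(** [M] measures the unknowns and [D] the data [a], [g] and the first coefficient. The critical term
    is [speed] times the variation of [strip (ycoef p)]: at the base point [speed] is
    [1 / (2 sqrt 2)], and 0.3539 * 2.734 < 0.968. The variation of [speed] costs little, since it
    multiplies [strip (ycoef p')], which is of order [rad]. *)
Lemma theta_lipschitz a a' g g' p t p' t' M D :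
  near_crapper p t -> near_crapper p' t' ->
  Rabs g <= 1 / 10000000 -> Rabs g' <= 1 / 10000000 ->
  Rabs (a - 2 * A0) <= 1 / 100000 -> Rabs (a' - 2 * A0) <= 1 / 100000 ->
  pair_close p t p' t' M ->
  Rabs (p 1%nat - p' 1%nat) <= D -> Rabs (a - a') <= D -> Rabs (g - g') <= D ->
  pair_close (theta_p a g p t) (theta_t g p t) (theta_p a' g' p' t') (theta_t g' p' t')
    (98 / 100 * M + 60 * D).
Proof.
  intros N N' Hg Hg' Ha Ha' [Hw Hu] HD1 HDa HDg.
  assert (B := A0_bounds). assert (M0 := l1_ge0 _ _ Hw).
  assert (D0 : 0 <= D) by (generalize (Rabs_pos (a - a')); lra).
  destruct (near_crapper_bounds _ _ N) as [Hp Ht].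
  destruct (near_crapper_bounds _ _ N') as [Hp' Ht'].
  assert (Hz := l1_zcoef _ _ _ _ Hp Ht). assert (Hz' := l1_zcoef _ _ _ _ Hp' Ht').
  assert (Hzd := l1_zcoef_diff _ _ _ _ _ _ _ _ _ _ Hp Hp' Ht Ht' Hw Hu).
  assert (Hgz : l1_le (fun n => g * zcoef p t n - g' * zcoef p' t' n) (M / 100000 + 18 * D)).
  { apply l1_ext with (fun n => g * (zcoef p t n - zcoef p' t' n) + (g - g') * zcoef p' t' n);
      [intros; ring |].
    eapply l1_weaken; [apply l1_plus; apply l1_scal; [apply Hzd | apply Hz'] |].
    apply Rplus_le_compat.
    - apply Rle_trans with (1 / 10000000 * (32 * M)); [| lra].
      apply Rmult_le_compat; [apply Rabs_pos | lra | auto | lra].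
    - rewrite Rmult_comm. apply Rmult_le_compat; try apply Rabs_pos; lra. }
  split.
  - assert (Hs := strip_ycoef_diff p p' t t' M D N N' Hw HD1).
    destruct (ycoef_near _ _ N) as [Y1 _]. destruct (ycoef_near _ _ N') as [Y1' Hs'].
    assert (Yd := l1_coeff _ _ 1 (l1_ycoef_diff _ _ _ _ _ Hp Hp' Hw)). simpl in Yd.
    assert (Zd := l1_coeff _ _ 1 Hgz). simpl in Zd.
    assert (Z1 := l1_coeff _ _ 1 Hz). assert (Z1' := l1_coeff _ _ 1 Hz').
    set (y1 := ycoef p 1%nat) in *. set (y1' := ycoef p' 1%nat) in *.
    assert (N1 : Rabs (a + g * zcoef p t 1) <= 8285 / 10000).
    { assert (Rabs (g * zcoef p t 1) <= 1 / 10000000 * (245 / 100 * 7)).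
      { rewrite Rabs_mult. apply Rmult_le_compat; auto using Rabs_pos. }
      apply Rabs_le_between in Ha. apply Rabs_le_between in H. apply Rabs_le_between. lra. }
    assert (N1' : Rabs (a' + g' * zcoef p' t' 1) <= 8285 / 10000).
    { assert (Rabs (g' * zcoef p' t' 1) <= 1 / 10000000 * (245 / 100 * 7)).
      { rewrite Rabs_mult. apply Rmult_le_compat; auto using Rabs_pos. }
      apply Rabs_le_between in Ha'. apply Rabs_le_between in H. apply Rabs_le_between. lra. }
    assert (IY : 0 < / y1 <= 427 / 1000).
    { split; [apply Rinv_0_lt_compat; lra |].
      apply Rmult_le_reg_r with y1; [lra |]. rewrite Rinv_l by lra. lra. }
    assert (IY' : 0 < / y1' <= 427 / 1000).
    { split; [apply Rinv_0_lt_compat; lra |].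
      apply Rmult_le_reg_r with y1'; [lra |]. rewrite Rinv_l by lra. lra. }
    assert (C : Rabs (speed a g p t) <= 3539 / 10000).
    { unfold speed. fold y1. unfold Rdiv. rewrite Rabs_mult, (Rabs_right (/ y1)) by lra.
      apply Rle_trans with (8285 / 10000 * (427 / 1000)); [| lra].
      apply Rmult_le_compat; try apply Rabs_pos; lra. }
    assert (Cd : Rabs (speed a g p t - speed a' g' p' t') <= 10 * M + 10 * D).
    { unfold speed. fold y1 y1'.
      replace ((a + g * zcoef p t 1) / y1 - (a' + g' * zcoef p' t' 1) / y1')
        with (((a - a') + (g * zcoef p t 1 - g' * zcoef p' t' 1)) * / y1
              - (a' + g' * zcoef p' t' 1) * (y1 - y1') * (/ y1 * / y1')) by (field; lra).
      eapply Rle_trans; [apply Rabs_triang |]. rewrite Rabs_Ropp, !Rabs_mult.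
      rewrite (Rabs_right (/ y1)), (Rabs_right (/ y1')) by lra.
      apply Rle_trans with ((D + (M / 100000 + 18 * D)) * (427 / 1000)
        + 8285 / 10000 * ((245 / 100 + 245 / 100) * M * (245 / 100) + 245 / 100 * (245 / 100) * M)
          * (427 / 1000 * (427 / 1000))); [| lra].
      apply Rplus_le_compat.
      - apply Rmult_le_compat; try apply Rabs_pos; try lra.
        eapply Rle_trans; [apply Rabs_triang |]. lra.
      - apply Rmult_le_compat.
        + apply Rmult_le_pos; apply Rabs_pos.
        + apply Rmult_le_pos; lra.
        + apply Rmult_le_compat; try apply Rabs_pos; lra.
        + apply Rmult_le_compat; lra. }
    apply l1_ext with (fun n => (a - a') * shifted_geometric n
      + speed a g p t * (strip (ycoef p) n - strip (ycoef p') n)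
      + (speed a g p t - speed a' g' p' t') * strip (ycoef p') n
      - strip (fun n => g * zcoef p t n - g' * zcoef p' t' n) n).
    + intros n. unfold theta_p. rewrite strip_minus, !strip_scal. ring.
    + eapply l1_weaken.
      * apply l1_minus; [apply l1_plus; [apply l1_plus |] |].
        -- apply l1_scal, l1_shifted_geometric.
        -- apply l1_scal, Hs.
        -- apply l1_scal, Hs'.
        -- apply l1_strip, Hgz.
      * apply Rle_trans with (D * 2 + 3539 / 10000 * (2734 / 1000 * M + 25 * D)
          + (10 * M + 10 * D) * (40 * rad) + 2 * (M / 100000 + 18 * D)).
        -- repeat apply Rplus_le_compat; try lra; apply Rmult_le_compat_r; auto; unfold rad; lra.
        -- unfold rad. lra.
  - assert (Hv := l1_vcoef_diff _ _ _ _ _ Hp Hp' Hw).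
    assert (Hq' := l1_qcoef _ _ Ht'). assert (Hq := l1_qcoef_diff _ _ _ _ _ Ht Ht' Hu).
    apply l1_ext with (fun n => - (vcoef p n - vcoef p' n) - g / 4 * (qcoef t n - qcoef t' n)
                                - (g - g') / 4 * qcoef t' n).
    + intros n. unfold theta_t, Rdiv. ring.
    + eapply l1_weaken.
      * apply l1_minus; [apply l1_minus |].
        -- apply l1_opp, Hv.
        -- apply l1_scal, Hq.
        -- apply l1_scal, Hq'.
      * unfold Rdiv. rewrite !Rabs_mult, (Rabs_right (/ 4)) by lra.
        assert (Rabs g * / 4 * (4 * ((7 + 7) * (10 * M))) <= 1 / 10000000 * (140 * M)) by nra.
        assert (Rabs (g - g') * / 4 * (4 * (7 * 7)) <= 49 * D) by nra.
        lra.
Qed.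

(** * Solutions near Crapper's wave *)

Lemma ex_lim_seq_geometric (u : nat -> R) C q : 0 <= q < 1 ->
  (forall k, Rabs (u (S k) - u k) <= C * q ^ k) -> exists l : R, is_lim_seq u l.
Proof.
  intros Hq Hu.
  assert (E : ex_series (fun k => u (S k) - u k)).
  { apply (ex_series_le (fun k => u (S k) - u k) (fun k => C * q ^ k)); [exact Hu |].
    apply (ex_series_scal_l C (pow q)), ex_series_geom. rewrite Rabs_right; lra. }
  destruct E as [l Hl]. exists (l + u 0%nat).
  apply is_lim_seq_incr_1.
  apply is_lim_seq_ext with (fun n => sum_n (fun k => u (S k) - u k) n + u 0%nat).
  - intros n. induction n.
    + rewrite sum_O. ring.
    + rewrite sum_Sn. unfold plus; simpl. lra.
  - apply is_lim_seq_plus'; [exact Hl | apply is_lim_seq_const].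
Qed.

(** Banach's theorem for real families, with a relation [close x y M] in place of a metric: it has
    to control coordinates and to survive pointwise limits. It serves both for pairs of sequences
    and for points of the plane ([hm_open]). *)
Lemma contraction_fixed_point (I : Type) (close : (I -> R) -> (I -> R) -> R -> Prop)
  (adm : (I -> R) -> Prop) (T : (I -> R) -> I -> R) (q K M0 : R) (x0 : I -> R) :
  0 <= q < 1 ->
  (forall x, close x x 0) ->
  (forall x y M, close x y M -> close y x M) ->
  (forall x y z M N, close x y M -> close y z N -> close x z (M + N)) ->
  (forall x y M N, close x y M -> M <= N -> close x y N) ->
  (forall x y M i, close x y M -> Rabs (x i - y i) <= K * M) ->
  (forall (x : nat -> I -> R) (l y : I -> R) M, (forall j, close (x j) y M) ->
     (forall i, is_lim_seq (fun j => x j i) (l i)) -> close l y M) ->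
  (forall (x : nat -> I -> R) (l : I -> R), (forall j, adm (x j)) ->
     (forall i, is_lim_seq (fun j => x j i) (l i)) -> adm l) ->
  adm x0 -> (forall x, adm x -> adm (T x)) ->
  (forall x y M, adm x -> adm y -> close x y M -> close (T x) (T y) (q * M)) ->
  0 <= K -> 0 <= M0 -> close (T x0) x0 M0 ->
  exists x, adm x /\ forall i, T x i = x i.
Proof.
  intros Hq Crefl Csym Ctri Cle Ccoord Clim Alim A0 AT CT HK HM C0.
  set (X := fix X k := match k with 0%nat => x0 | S k => T (X k) end).
  assert (AX : forall k, adm (X k)) by (induction k; simpl; auto).
  assert (CX : forall k, close (X (S k)) (X k) (M0 * q ^ k)).
  { induction k.
    - simpl. rewrite Rmult_1_r. auto.
    - replace (M0 * q ^ S k) with (q * (M0 * q ^ k)) by (simpl; ring).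
      apply (CT (X (S k)) (X k)); auto. }
  assert (L : forall i, exists l : R, is_lim_seq (fun j => X j i) l).
  { intros i. apply ex_lim_seq_geometric with (K * M0) q; auto.
    intros k. rewrite Rmult_assoc. apply (Ccoord (X (S k)) (X k)); auto. }
  set (x := fun i => real (Lim_seq (fun j => X j i))).
  assert (Lx : forall i, is_lim_seq (fun j => X j i) (x i)).
  { intros i. destruct (L i) as [l Hl]. unfold x. rewrite (is_lim_seq_unique _ _ Hl). exact Hl. }
  assert (Ax : adm x) by exact (Alim X x AX Lx).
  (* The geometric series bounds the distance from [X k] to all later iterates, then [j] tends to
     infinity. The sharper bound with [q ^ k - q ^ (j + k)] is what the induction on [j] carries. *)
  assert (Cx : forall k, close x (X k) (M0 / (1 - q) * q ^ k)).
  { intros k. apply Clim with (fun j => X (j + k)%nat).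
    - intros j.
      assert (0 <= M0 / (1 - q)) by (apply Rmult_le_pos; [lra | left; apply Rinv_0_lt_compat; lra]).
      apply Cle with (M0 / (1 - q) * (q ^ k - q ^ (j + k))).
      2: { assert (0 <= q ^ (j + k)) by (apply pow_le; lra). nra. }
      clear H.
      induction j as [|j IH].
      + simpl. apply Cle with 0; [apply Crefl | apply Req_le; ring].
      + simpl. apply Cle with (M0 * q ^ (j + k) + (M0 / (1 - q) * (q ^ k - q ^ (j + k)))).
        * apply (Ctri (X (S (j + k))) (X (j + k)%nat)); auto.
        * apply Req_le. simpl. field. lra.
    - intros i. apply -> (is_lim_seq_incr_n (fun j => X j i)). apply Lx. }
  exists x. split; auto.
  intros i.
  (* Both [T x] and [x] are within a multiple of [q ^ k] of [X (S k)]. *)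
  assert (E : forall k, Rabs (T x i - x i) <= K * (2 * (M0 / (1 - q))) * q ^ k).
  { intros k. rewrite Rmult_assoc. apply Ccoord.
    apply Cle with (q * (M0 / (1 - q) * q ^ k) + M0 / (1 - q) * q ^ S k).
    - apply Ctri with (X (S k)); auto. apply CT; auto.
    - assert (0 <= M0 / (1 - q)) by (apply Rmult_le_pos; [lra | left; apply Rinv_0_lt_compat; lra]).
      assert (0 <= q ^ k) by (apply pow_le; lra).
      assert (0 <= M0 / (1 - q) * q ^ k) by (apply Rmult_le_pos; auto). simpl. nra. }
  assert (Z : Rabs (T x i - x i) <= 0).
  { apply (is_lim_seq_le (fun _ => Rabs (T x i - x i))
       (fun k => K * (2 * (M0 / (1 - q))) * q ^ k) (Rabs (T x i - x i)) 0 E).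
    - apply is_lim_seq_const.
    - replace 0 with (K * (2 * (M0 / (1 - q))) * 0) by ring.
      apply is_lim_seq_mult'; [apply is_lim_seq_const |].
      apply is_lim_seq_geom. rewrite Rabs_right; lra. }
  assert (Z1 := Rabs_pos (T x i - x i)).
  assert (Z2 : T x i - x i = 0) by (apply Rabs_eq_0; lra). lra.
Qed.

Lemma close_refl p t : pair_close p t p t 0.
Proof.
  split; intros n; (rewrite (sum_eq _ (fun _ => 0)); [rewrite sum_cte; lra |]);
    intros; rewrite Rminus_diag, Rabs_R0; ring.
Qed.

Lemma close_sym p t p' t' M : pair_close p t p' t' M -> pair_close p' t' p t M.
Proof.
  intros [H1 H2]. split; [apply l1_dominated with (2 := H1) | apply l1_dominated with (2 := H2)];
    intros n; rewrite Rabs_minus_sym; apply Rle_refl.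
Qed.

Lemma close_trans p t p' t' p'' t'' M N :
  pair_close p t p' t' M -> pair_close p' t' p'' t'' N -> pair_close p t p'' t'' (M + N).
Proof.
  intros [H1 H2] [H3 H4]. split.
  - apply l1_ext with (2 := l1_plus _ _ _ _ H1 H3). intros; ring.
  - rewrite Rmult_plus_distr_l. apply l1_ext with (2 := l1_plus _ _ _ _ H2 H4). intros; ring.
Qed.

Lemma close_weaken p t p' t' M N : pair_close p t p' t' M -> M <= N -> pair_close p t p' t' N.
Proof.
  intros [H1 H2] H. split; [apply l1_weaken with (1 := H1) | apply l1_weaken with (1 := H2)]; lra.
Qed.

Lemma close_ext p t p' t' q s q' s' M : (forall n, p n = q n) -> (forall n, t n = s n) ->
  (forall n, p' n = q' n) -> (forall n, t' n = s' n) -> pair_close p t p' t' M -> pair_close q s q' s' M.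
Proof.
  intros E1 E2 E3 E4 [H1 H2]. split; [apply l1_ext with (2 := H1) | apply l1_ext with (2 := H2)];
    intros n; rewrite ?E1, ?E2, ?E3, ?E4; reflexivity.
Qed.

Lemma close_limit (p t : nat -> nat -> R) (p' t' p'' t'' : nat -> R) M :
  (forall j, pair_close (p j) (t j) p'' t'' M) ->
  (forall n, is_lim_seq (fun j => p j n) (p' n)) ->
  (forall n, is_lim_seq (fun j => t j n) (t' n)) -> pair_close p' t' p'' t'' M.
Proof.
  intros H Hp Ht. split.
  - apply l1_pointwise_limit with (fun j n => p j n - p'' n); [intros; apply H |].
    intros n. apply is_lim_seq_minus'; auto using is_lim_seq_const.
  - apply l1_pointwise_limit with (fun j n => t j n - t'' n); [intros; apply H |].
    intros n. apply is_lim_seq_minus'; auto using is_lim_seq_const.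
Qed.

(** Small enough for [0.98 * rad + 60 * delta0 <= rad], which keeps the iteration inside
    [near_crapper]. *)
Definition delta0 : R := 1 / 1000000000.

Lemma crapper_p1 A : crapper A 1 = 2 * A.
Proof. cbn [crapper]. rewrite pow_1. reflexivity. Qed.

Lemma near_crapper_base : near_crapper P0 (fun n => - V0 n).
Proof.
  split; [reflexivity |]. apply close_weaken with (1 := close_refl _ _). unfold rad; lra.
Qed.

Lemma theta_crapper_base n :
  theta_p (2 * A0) 0 P0 (fun n => - V0 n) n = P0 n /\
  theta_t 0 P0 (fun n => - V0 n) n = - V0 n.
Proof.
  split.
  - unfold theta_p. rewrite strip_ycoef_P0. destruct n as [|n]; simpl; ring.
  - unfold theta_t. fold V0. unfold Rdiv. ring.
Qed.

Lemma theta_p_0 a g p t : theta_p a g p t 0 = 1.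
Proof. unfold theta_p. simpl. ring. Qed.
Lemma theta_p_1 a g p t : theta_p a g p t 1 = a.
Proof. unfold theta_p. simpl. ring. Qed.

Definition solves (a g : R) (p t : nat -> R) : Prop :=
  near_crapper p t /\ p 1%nat = a /\
  (forall n, theta_p a g p t n = p n) /\ (forall n, theta_t g p t n = t n).

(** Comparison with the base point, which is fixed by the map at [a = 2 * A0], [g = 0]. *)
Lemma theta_near a g p t : near_crapper p t -> p 1%nat = a ->
  Rabs (a - 2 * A0) <= delta0 -> Rabs g <= delta0 ->
  near_crapper (theta_p a g p t) (theta_t g p t).
Proof.
  intros N p1 Ha Hg. split; [apply theta_p_0 |].
  assert (L := theta_lipschitz a (2 * A0) g 0 p t P0 (fun n => - V0 n) rad delta0 N near_crapper_base).
  apply close_weaken with (98 / 100 * rad + 60 * delta0); [| unfold rad, delta0; lra].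
  apply (close_ext (theta_p a g p t) (theta_t g p t)
     (theta_p (2 * A0) 0 P0 (fun n => - V0 n)) (theta_t 0 P0 (fun n => - V0 n)));
    try reflexivity; try (intros n; apply theta_crapper_base).
  unfold delta0 in *.
  apply L; rewrite ?Rminus_diag, ?Rminus_0_r, ?Rabs_R0; try lra.
  - apply N.
  - rewrite p1. change (P0 1%nat) with (2 * A0 ^ 1). rewrite pow_1. exact Ha.
Qed.

Lemma solution_exists a g : Rabs (a - 2 * A0) <= delta0 -> Rabs g <= delta0 ->
  exists p t, solves a g p t.
Proof.
  intros Ha Hg.
  (* The pair [(p, t)] is packed into one real family, the form that [contraction_fixed_point]
     takes. *)
  set (ppart := fun (x : bool * nat -> R) n => x (true, n)).
  set (tpart := fun (x : bool * nat -> R) n => x (false, n)).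
  set (mk := fun (p t : nat -> R) (i : bool * nat) => if fst i then p (snd i) else t (snd i)).
  set (T := fun x => mk (theta_p a g (ppart x) (tpart x)) (theta_t g (ppart x) (tpart x))).
  set (adm := fun x => near_crapper (ppart x) (tpart x) /\ ppart x 1%nat = a).
  set (cl := fun x y M => pair_close (ppart x) (tpart x) (ppart y) (tpart y) M).
  (* The iteration starts from [P0] with its first coefficient replaced by [a]. All iterates then
     share that coefficient, so [theta_lipschitz] applies with [D = 0]. *)
  set (b := fun n => match n with 1%nat => a | _ => P0 n end).
  assert (Nb : near_crapper b (fun n => - V0 n)).
  { split; [reflexivity |]. split.
    - apply l1_finite with 1%nat.
      + intros [|[|n]] Hn; simpl; try lia. unfold P0. simpl. ring.
      + change (Rabs (1 - 1) * rho ^ 0 + Rabs (a - 2 * A0 ^ 1) * rho ^ 1 <= rad).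
        rewrite Rminus_diag, Rabs_R0, !pow_1. unfold rad, delta0, rho in *. lra.
    - apply (l1_weaken _ (10 * 0)); [apply (close_refl P0 (fun n => - V0 n)) | unfold rad; lra]. }
  assert (AT : forall x, adm x -> adm (T x)).
  { intros x [H1 H2]. split; [| apply theta_p_1]. apply theta_near; auto. }
  destruct (contraction_fixed_point (bool * nat) cl adm T (98 / 100) 10 (2 * rad)
    (mk b (fun n => - V0 n))) as [x [[A1 A2] Ex]]; unfold cl.
  - lra.
  - intros; apply close_refl.
  - intros; apply close_sym; auto.
  - intros x y z M N. apply close_trans.
  - intros x y M N. apply close_weaken.
  - intros x y M [[|] n] [H1 H2].
    + apply Rle_trans with (1 := l1_coeff _ _ n H1). generalize (l1_ge0 _ _ H1). lra.
    + apply (l1_coeff _ _ n H2).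
  - intros x l y M H HL. apply close_limit with (fun j => ppart (x j)) (fun j => tpart (x j)); auto;
      intros n; apply HL.
  - intros x l H HL. split; [split |].
    + assert (E := is_lim_seq_ext _ (fun _ => 1) _ (fun j => proj1 (proj1 (H j))) (HL (true, 0%nat))).
      apply is_lim_seq_unique in E. rewrite Lim_seq_const in E. injection E. auto.
    + apply close_limit with (fun j => ppart (x j)) (fun j => tpart (x j)); try (intros n; apply HL).
      intros j. apply (H j).
    + assert (E := is_lim_seq_ext _ (fun _ => a) _ (fun j => proj2 (H j)) (HL (true, 1%nat))).
      apply is_lim_seq_unique in E. rewrite Lim_seq_const in E. injection E. auto.
  - split; [exact Nb | reflexivity].
  - exact AT.
  - intros x y M [H1 H2] [H3 H4] C.
    apply close_weaken with (98 / 100 * M + 60 * 0); [| lra].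
    unfold delta0 in *.
    apply theta_lipschitz; rewrite ?Rminus_diag, ?Rabs_R0; auto; try lra.
    rewrite H2, H4, Rminus_diag, Rabs_R0. lra.
  - lra.
  - unfold rad; lra.
  - replace (2 * rad) with (rad + rad) by ring.
    apply close_trans with P0 (fun n => - V0 n).
    + apply (theta_near a g b (fun n => - V0 n)); auto.
    + apply close_sym. apply Nb.
  - exists (ppart x), (tpart x). split; [exact A1 |]. split; [exact A2 |].
    split; intros n; [apply (Ex (true, n)) | apply (Ex (false, n))].
Qed.

(** The affine map [0.98 M + 60 D] has the fixed point [3000 D], and its iterates from [M0] converge
    to it. *)
Lemma l1_geometric_improvement (w : nat -> R) (u : nat -> R) D M0 : 
  (forall M, l1_le w M -> l1_le u (10 * M) -> l1_le w (98 / 100 * M + 60 * D) /\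
     l1_le u (10 * (98 / 100 * M + 60 * D))) ->
  l1_le w M0 -> l1_le u (10 * M0) -> l1_le w (3000 * D).
Proof.
  intros H Hw Hu.
  assert (K : forall k, l1_le w (3000 * D + (98 / 100) ^ k * (M0 - 3000 * D)) /\
     l1_le u (10 * (3000 * D + (98 / 100) ^ k * (M0 - 3000 * D)))).
  { induction k as [|k [I1 I2]].
    - replace (3000 * D + (98 / 100) ^ 0 * (M0 - 3000 * D)) with M0 by (simpl; ring). auto.
    - destruct (H _ I1 I2) as [J1 J2].
      replace (3000 * D + (98 / 100) ^ S k * (M0 - 3000 * D)) with
        (98 / 100 * (3000 * D + (98 / 100) ^ k * (M0 - 3000 * D)) + 60 * D)
        by (simpl; field). auto. }
  intros n.
  apply (is_lim_seq_le (fun _ => sum_f_R0 (fun k => Rabs (w k) * rho ^ k) n)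
     (fun k => 3000 * D + (98 / 100) ^ k * (M0 - 3000 * D))
     (sum_f_R0 (fun k => Rabs (w k) * rho ^ k) n) (3000 * D)).
  - intros k. apply (K k).
  - apply is_lim_seq_const.
  - replace (3000 * D) with (3000 * D + 0 * (M0 - 3000 * D)) at 1 by ring.
    apply is_lim_seq_plus'; [apply is_lim_seq_const |].
    apply is_lim_seq_mult'; [| apply is_lim_seq_const].
    apply is_lim_seq_geom. rewrite Rabs_right; lra.
Qed.

(** Both solutions are fixed points, so [theta_lipschitz] bounds their distance in terms of itself.
    With [D = 0] this is uniqueness of [p]. *)
Lemma solution_lipschitz a a' g g' p t p' t' D : solves a g p t -> solves a' g' p' t' ->
  Rabs (a - 2 * A0) <= delta0 -> Rabs (a' - 2 * A0) <= delta0 ->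
  Rabs g <= delta0 -> Rabs g' <= delta0 ->
  Rabs (a - a') <= D -> Rabs (g - g') <= D ->
  l1_le (fun n => p n - p' n) (3000 * D).
Proof.
  intros (N & p1 & E1 & E2) (N' & p1' & E1' & E2') Ha Ha' Hg Hg' HD HDg.
  apply l1_geometric_improvement with (fun n => t n - t' n) (2 * rad).
  - intros M H1 H2.
    assert (C : pair_close (theta_p a g p t) (theta_t g p t) (theta_p a' g' p' t') (theta_t g' p' t')
      (98 / 100 * M + 60 * D)).
    { unfold delta0 in *. apply theta_lipschitz; auto; try lra.
      - split; auto.
      - rewrite p1, p1'. exact HD. }
    apply (close_ext _ _ _ _ p t p' t') in C; auto. 
  - replace (2 * rad) with (rad + rad) by ring.
    apply (close_trans p t P0 (fun n => - V0 n) p' t'); [apply N | apply close_sym, N'].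
  - replace (2 * rad) with (rad + rad) by ring.
    apply (close_trans p t P0 (fun n => - V0 n) p' t'); [apply N | apply close_sym, N'].
Qed.

(** [A ^ (n + 1) - A0 ^ (n + 1)] is [A - A0] times the convolution of two geometric sequences, each
    of norm at most 2. *)
Lemma l1_crapper_diff A : Rabs (A - A0) <= delta0 ->
  l1_le (fun n => crapper A n - P0 n) (9 * Rabs (A - A0)).
Proof.
  intros HA. assert (B := A0_bounds).
  assert (BA : 41 / 100 <= A <= 42 / 100).
  { apply Rabs_le_between in HA. unfold delta0 in HA. lra. }
  assert (HI : forall x, 41 / 100 <= x <= 42 / 100 -> l1_le (pow x) 2).
  { intros x Hx. eapply l1_weaken; [apply l1_geometric; unfold rho; lra |].
    apply Rmult_le_reg_r with (1 - x * rho); [unfold rho; lra |].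
    rewrite Rinv_l by (unfold rho; lra). unfold rho; lra. }
  assert (HC := l1_conv _ _ _ _ (HI A BA) (HI A0 ltac:(lra))).
  set (x := fun n => match n with 0%nat => 0 | S k => 2 * (A - A0) * conv (pow A) (pow A0) k end).
  apply l1_ext with x.
  - intros [|n]; unfold x, P0; cbn [crapper]; [ring |].
    assert (E : (A - A0) * conv (pow A) (pow A0) n = A ^ S n - A0 ^ S n).
    { unfold conv, PS_mult. induction n as [|n IH]; [simpl; ring |].
      rewrite tech5, Nat.sub_diag.
      rewrite (sum_eq _ (fun k => A ^ k * A0 ^ (n - k) * A0)).
      - rewrite <- scal_sum. rewrite Rmult_plus_distr_l.
        replace ((A - A0) * (A0 * sum_f_R0 (fun k => A ^ k * A0 ^ (n - k)) n))
          with (A0 * ((A - A0) * sum_f_R0 (fun k => A ^ k * A0 ^ (n - k)) n)) by ring.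
        rewrite IH. simpl. ring.
      - intros k Hk. replace (S n - k)%nat with (S (n - k)) by lia. simpl. ring. }
    rewrite Rmult_assoc, E. ring.
  - assert (Hx : l1_le x (rho ^ 1 * (Rabs (2 * (A - A0)) * (2 * 2)))).
    { apply l1_tail.
      - intros [|n] Hn; [reflexivity | lia].
      - apply (l1_scal (conv (pow A) (pow A0)) (2 * (A - A0))), HC. }
    apply l1_weaken with (1 := Hx).
    rewrite Rabs_mult, (Rabs_right 2) by lra. unfold rho. generalize (Rabs_pos (A - A0)). lra.
Qed.

(** With [g = 0] the terms in [A0] cancel and, for [n >= 2], [theta_p] equals [a * Y_n / Y_1], where
    [Y_n / Y_1 = A ^ (n - 1)] by [hank_crapper]. *)
Lemma crapper_solves A : Rabs (A - A0) <= delta0 ->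
  solves (2 * A) 0 (crapper A) (fun n => - vcoef (crapper A) n).
Proof.
  intros HA. assert (B := A0_bounds).
  assert (BA : 41 / 100 <= A <= 42 / 100).
  { apply Rabs_le_between in HA. unfold delta0 in HA. lra. }
  assert (Hd := l1_crapper_diff A HA).
  assert (Hp : l1_le (crapper A) (245 / 100)).
  { apply l1_ext with (fun n => (crapper A n - P0 n) + P0 n); [intros; ring |].
    eapply l1_weaken; [apply l1_plus; [exact Hd | apply nb_P0] |].
    unfold delta0 in HA. lra. }
  split; [| split; [apply crapper_p1 | split]].
  - split; [reflexivity |]. split.
    + eapply l1_weaken; [exact Hd |]. unfold rad, delta0 in *. lra.
    + apply l1_ext with (fun n => - (vcoef (crapper A) n - vcoef P0 n)).
      { intros n. unfold V0. ring. }
      eapply l1_weaken; [apply l1_opp, (l1_vcoef_diff _ _ _ _ _ Hp nb_P0 Hd) |].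
      unfold rad, delta0 in *. lra.
  - assert (Y : forall n, (1 <= n)%nat -> ycoef (crapper A) n = 4 * A ^ n * ((1 + A ^ 2) / (1 - A ^ 2))).
    { intros n Hn. apply hank_crapper; auto; unfold rho; lra. }
    intros [|[|n]]; [apply theta_p_0 | rewrite theta_p_1, crapper_p1; reflexivity |].
    unfold theta_p, speed, strip. rewrite !Y by lia.
    replace (S (S n) - 1)%nat with (S n) by lia.
    change (shifted_geometric (S (S n))) with (A0 ^ S n).
    cbn [crapper]. rewrite <- !(tech_pow_Rmult A (S n)).
    assert (0 < A ^ 2 < 1) by (simpl; nra).
    rewrite pow_1. field. repeat split; lra.
  - intros n. unfold theta_t, Rdiv. ring.
Qed.

Lemma solves_equations a g p t : solves a g p t ->
  (forall n, (1 <= n)%nat -> p n + g * zcoef p t n = speed a g p t * ycoef p n) /\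
  (forall n, t n = - vcoef p n - g / 4 * qcoef t n).
Proof.
  intros (N & p1 & E1 & E2). split.
  - assert (Y1 : ycoef p 1%nat <> 0) by (generalize (ycoef_near _ _ N); lra).
    assert (S1 : speed a g p t * ycoef p 1%nat = a + g * zcoef p t 1%nat) by (unfold speed; field; auto).
    intros [|[|n]] Hn; [lia | rewrite p1, S1; ring |].
    rewrite <- E1 at 1. unfold theta_p, strip.
    replace (S (S n) - 1)%nat with (S n) by lia. cbn [shifted_geometric].
    replace (speed a g p t * (ycoef p (S (S n)) - A0 ^ S n * ycoef p 1%nat))
      with (speed a g p t * ycoef p (S (S n)) - A0 ^ S n * (speed a g p t * ycoef p 1%nat)) by ring.
    rewrite S1. ring.
  - intros n. rewrite <- E2 at 1. reflexivity.
Qed.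

(** * Fourier series on the lower half-plane *)

(* [mode n w = exp (- i n w)]. *)
Definition mode (n : nat) (w : C) : C :=
  (exp (INR n * Im w) * cos (INR n * Re w), - (exp (INR n * Im w) * sin (INR n * Re w))).
Definition fourier (a : nat -> R) (w : C) : C :=
  (Series (fun n => a n * Re (mode n w)), Series (fun n => a n * Im (mode n w))).
Definition summable (a : nat -> R) : Prop := ex_series (fun n => Rabs (a n)).
Definition nmul (a : nat -> R) (n : nat) : R := INR n * a n.

Lemma mode_plus n m w : mode (n + m) w = Cmult (mode n w) (mode m w).
Proof.
  unfold mode, Cmult, Re, Im. simpl. rewrite plus_INR, !Rmult_plus_distr_r, exp_plus, cos_plus, sin_plus.
  f_equal; ring.
Qed.

Lemma mode_0 w : mode 0 w = (1, 0).
Proof.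
  unfold mode. simpl. rewrite !Rmult_0_l, exp_0, cos_0, sin_0. f_equal; ring.
Qed.

Lemma exp_INR_le_1 n b : b <= 0 -> 0 < exp (INR n * b) <= 1.
Proof.
  intros Hb. split; [apply exp_pos |].
  rewrite <- exp_0. destruct (Req_dec (INR n * b) 0) as [-> | N]; [lra |].
  left. apply exp_increasing. generalize (pos_INR n). nra.
Qed.

Lemma mode_bound n w : Im w <= 0 -> Rabs (Re (mode n w)) <= 1 /\ Rabs (Im (mode n w)) <= 1.
Proof.
  intros Hw. destruct (exp_INR_le_1 n (Im w) Hw). unfold mode, Re at 1, Im at 2. simpl.
  rewrite Rabs_Ropp, !Rabs_mult, (Rabs_right (exp _)) by lra.
  assert (Rabs (cos (INR n * Re w)) <= 1) by (apply Rabs_le_between, COS_bound).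
  assert (Rabs (sin (INR n * Re w)) <= 1) by (apply Rabs_le_between, SIN_bound).
  generalize (Rabs_pos (cos (INR n * Re w))) (Rabs_pos (sin (INR n * Re w))). intros. 
  split; nra.
Qed.

Lemma summable_mult a (f : nat -> R) : summable a -> (forall n, Rabs (f n) <= 1) ->
  summable (fun n => a n * f n).
Proof.
  intros Ha Hf. apply (ex_series_le (fun n => Rabs (a n * f n)) (fun n => Rabs (a n))); auto.
  intros n. unfold norm; simpl; unfold abs; simpl. rewrite Rabs_Rabsolu, Rabs_mult.
  generalize (Hf n) (Rabs_pos (a n)). nra.
Qed.

Lemma summable_ex a : summable a -> ex_series a.
Proof. apply ex_series_Rabs. Qed.

Lemma l1_summable a M : l1_le a M -> summable a.
Proof.
  intros H. apply (l1_dominates_series a M a H). intros k.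
  generalize (rho_pow_ge1 k) (Rabs_pos (a k)). nra.
Qed.

Lemma fourier_ex a w : Im w <= 0 -> summable a ->
  ex_series (fun n => a n * Re (mode n w)) /\ ex_series (fun n => a n * Im (mode n w)).
Proof.
  intros Hw Ha. split; apply summable_ex, summable_mult; auto; intros n; apply mode_bound, Hw.
Qed.

Lemma fourier_ext a b w : (forall n, a n = b n) -> fourier a w = fourier b w.
Proof.
  intros H. unfold fourier. f_equal; apply Series_ext; intros n; rewrite H; reflexivity.
Qed.

Lemma fourier_plus a b w : Im w <= 0 -> summable a -> summable b ->
  fourier (fun n => a n + b n) w = Cplus (fourier a w) (fourier b w).
Proof.
  intros Hw Ha Hb. destruct (fourier_ex a w Hw Ha). destruct (fourier_ex b w Hw Hb).
  unfold fourier, Cplus; cbn [fst snd]; f_equal; rewrite <- Series_plus by auto; apply Series_ext;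
    intros; ring.
Qed.

Lemma fourier_scal c a w : fourier (fun n => c * a n) w = Cmult (RtoC c) (fourier a w).
Proof.
  unfold fourier, Cmult, RtoC; cbn [fst snd]; f_equal.
  - rewrite (Series_ext _ (fun n => c * (a n * Re (mode n w)))) by (intros; ring).
    rewrite Series_scal_l. ring.
  - rewrite (Series_ext _ (fun n => c * (a n * Im (mode n w)))) by (intros; ring).
    rewrite Series_scal_l. ring.
Qed.

Lemma summable_scal c a : summable a -> summable (fun n => c * a n).
Proof.
  intros H. apply ex_series_ext with (fun n => Rabs c * Rabs (a n)).
  - intros n. rewrite Rabs_mult. reflexivity.
  - apply (ex_series_scal_l (Rabs c) (fun n => Rabs (a n))). exact H.
Qed.

Lemma summable_le a b : (forall n, Rabs (a n) <= b n) -> ex_series b -> summable a.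
Proof.
  intros H. apply (ex_series_le (fun n => Rabs (a n)) b).
  intros n. unfold norm; simpl; unfold abs; simpl. rewrite Rabs_Rabsolu. apply H.
Qed.

Lemma summable_plus a b : summable a -> summable b -> summable (fun n => a n + b n).
Proof.
  intros Ha Hb. apply summable_le with (fun n => Rabs (a n) + Rabs (b n)).
  - intros n. apply Rabs_triang.
  - apply (ex_series_plus (fun n => Rabs (a n)) (fun n => Rabs (b n))); auto.
Qed.

Lemma fourier_minus a b w : Im w <= 0 -> summable a -> summable b ->
  fourier (fun n => a n - b n) w = Cminus (fourier a w) (fourier b w).
Proof.
  intros Hw Ha Hb.
  rewrite (fourier_ext _ (fun n => a n + (-1) * b n)) by (intros; ring).
  rewrite fourier_plus, fourier_scal; auto using summable_scal.
  unfold Cminus. f_equal. apply injective_projections; simpl; ring.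
Qed.

Lemma summable_minus a b : summable a -> summable b -> summable (fun n => a n - b n).
Proof.
  intros Ha Hb. apply summable_le with (fun n => Rabs (a n) + Rabs (b n)).
  - intros n. unfold Rminus. rewrite <- (Rabs_Ropp (b n)). apply Rabs_triang.
  - apply (ex_series_plus (fun n => Rabs (a n)) (fun n => Rabs (b n))); auto.
Qed.

Definition delta_seq (c : R) (n : nat) : R := match n with 0%nat => c | _ => 0 end.

Lemma l1_delta_seq c : l1_le (delta_seq c) (Rabs c).
Proof.
  intros n. rewrite <- (Rmult_1_r (Rabs c)). induction n.
  - simpl. lra.
  - rewrite tech5. simpl delta_seq. rewrite Rabs_R0. lra.
Qed.

Lemma fourier_delta_seq c w : fourier (delta_seq c) w = RtoC c.
Proof.
  unfold fourier, RtoC. f_equal.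
  - rewrite (Series_ext _ (fun n => delta_seq c n * 1)).
    + rewrite Series_scal_r, Rmult_1_r.
      rewrite Series_incr_1.
      * simpl. rewrite (Series_ext _ (fun n => 0 * 0)) by (intros; ring).
        rewrite Series_scal_l. ring.
      * apply (summable_ex (delta_seq c)), (l1_summable _ _ (l1_delta_seq c)).
    + intros [|n]; [rewrite mode_0; simpl; reflexivity | simpl; ring].
  - rewrite (Series_ext _ (fun n => 0 * 0)).
    + rewrite Series_scal_l. ring.
    + intros [|n]; [rewrite mode_0; simpl; ring | simpl; ring].
Qed.

(** Four real Cauchy products of absolutely convergent series, recombined by [mode_plus]. *)
Lemma fourier_conv a b w : Im w <= 0 -> summable a -> summable b ->
  fourier (conv a b) w = Cmult (fourier a w) (fourier b w).
Proof.
  intros Hw Ha Hb.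
  destruct (fourier_ex a w Hw Ha) as [A1 A2]. destruct (fourier_ex b w Hw Hb) as [B1 B2].
  assert (SA1 := summable_mult a (fun n => Re (mode n w)) Ha (fun n => proj1 (mode_bound n w Hw))).
  assert (SA2 := summable_mult a (fun n => Im (mode n w)) Ha (fun n => proj2 (mode_bound n w Hw))).
  assert (SB1 := summable_mult b (fun n => Re (mode n w)) Hb (fun n => proj1 (mode_bound n w Hw))).
  assert (SB2 := summable_mult b (fun n => Im (mode n w)) Hb (fun n => proj2 (mode_bound n w Hw))).
  assert (M11 := is_series_mult _ _ _ _ (Series_correct _ A1) (Series_correct _ B1) SA1 SB1).
  assert (M12 := is_series_mult _ _ _ _ (Series_correct _ A1) (Series_correct _ B2) SA1 SB2).
  assert (M21 := is_series_mult _ _ _ _ (Series_correct _ A2) (Series_correct _ B1) SA2 SB1).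
  assert (M22 := is_series_mult _ _ _ _ (Series_correct _ A2) (Series_correct _ B2) SA2 SB2).
  unfold fourier, Cmult; cbn [fst snd]; f_equal; apply is_series_unique.
  - eapply is_series_ext; [| apply (is_series_minus _ _ _ _ M11 M22)].
    intros n. unfold plus, opp; simpl. unfold conv, PS_mult.
    rewrite (Rmult_comm (sum_f_R0 _ n)), scal_sum.
    change (sum_f_R0 (fun k => a k * Re (mode k w) * (b (n - k)%nat * Re (mode (n - k) w))) n -
            sum_f_R0 (fun k => a k * Im (mode k w) * (b (n - k)%nat * Im (mode (n - k) w))) n =
            sum_f_R0 (fun i => a i * b (n - i)%nat * Re (mode n w)) n).
    rewrite <- minus_sum. apply sum_eq. intros k Hk.
    replace (mode n w) with (Cmult (mode k w) (mode (n - k) w))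
      by (rewrite <- mode_plus; f_equal; lia).
    unfold Cmult, Re, Im. simpl. ring.
  - eapply is_series_ext; [| apply (is_series_plus _ _ _ _ M12 M21)].
    intros n. unfold plus; simpl. unfold conv, PS_mult.
    rewrite (Rmult_comm (sum_f_R0 _ n)), scal_sum.
    change (sum_f_R0 (fun k => a k * Re (mode k w) * (b (n - k)%nat * Im (mode (n - k) w))) n +
            sum_f_R0 (fun k => a k * Im (mode k w) * (b (n - k)%nat * Re (mode (n - k) w))) n =
            sum_f_R0 (fun i => a i * b (n - i)%nat * Im (mode n w)) n).
    rewrite <- plus_sum. apply sum_eq. intros k Hk.
    replace (mode n w) with (Cmult (mode k w) (mode (n - k) w))
      by (rewrite <- mode_plus; f_equal; lia).
    unfold Cmult, Re, Im. simpl. ring.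
Qed.

Lemma Series_abs_le a (f : nat -> R) c : summable a -> (forall n, Rabs (f n) <= c) ->
  Rabs (Series (fun n => a n * f n)) <= c * Series (fun n => Rabs (a n)).
Proof.
  intros Ha Hf.
  assert (Hc : 0 <= c) by (generalize (Hf 0%nat) (Rabs_pos (f 0%nat)); lra).
  assert (E : ex_series (fun n => c * Rabs (a n)))
    by (apply (ex_series_scal_l c (fun n => Rabs (a n))); auto).
  assert (L : forall n, Rabs (a n * f n) <= c * Rabs (a n)).
  { intros n. rewrite Rabs_mult. generalize (Hf n) (Rabs_pos (a n)). nra. }
  rewrite <- Series_scal_l.
  apply Rle_trans with (Series (fun n => Rabs (a n * f n))).
  - apply Series_Rabs. apply (summable_le _ _ L E).
  - apply Series_le; auto. intros n. split; [apply Rabs_pos | apply L].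
Qed.

Lemma summable_sum_le a M : l1_le a M -> Series (fun n => Rabs (a n)) <= M.
Proof.
  intros H. apply (l1_dominates_series a M a H). intros k.
  generalize (rho_pow_ge1 k) (Rabs_pos (a k)). nra.
Qed.

Lemma fourier_bound a M w : Im w <= 0 -> l1_le a M ->
  Rabs (Re (fourier a w)) <= M /\ Rabs (Im (fourier a w)) <= M.
Proof.
  intros Hw Ha. assert (S := l1_summable _ _ Ha). assert (L := summable_sum_le _ _ Ha).
  split; unfold fourier; cbn [Re Im fst snd].
  - apply Rle_trans with (1 * Series (fun n => Rabs (a n))); [| lra].
    apply (Series_abs_le a (fun n => Re (mode n w))); auto. intros; apply mode_bound, Hw.
  - apply Rle_trans with (1 * Series (fun n => Rabs (a n))); [| lra].
    apply (Series_abs_le a (fun n => Im (mode n w))); auto. intros; apply mode_bound, Hw.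
Qed.

(** Bernoulli's inequality for 1.004, with 250 = 1 / 0.004 and [1.004 ^ 2 <= rho]. The weight thus
    pays for two derivatives on the closed half-plane. *)
Lemma nmul_weight n : INR n <= 250 * rho ^ n /\ INR n * INR n <= 62500 * rho ^ n.
Proof.
  assert (Q : 1 + INR n * (4 / 1000) <= (1004 / 1000) ^ n).
  { replace (1004 / 1000) with (1 + 4 / 1000) by lra. apply poly. lra. }
  assert (Q2 : (1004 / 1000) ^ n * (1004 / 1000) ^ n <= rho ^ n).
  { rewrite <- Rpow_mult_distr. apply pow_incr. unfold rho; lra. }
  assert (P := pos_INR n). assert (P1 : 1 <= (1004 / 1000) ^ n) by lra.
  split; nra.
Qed.

Lemma nmul_series a M : l1_le a M ->
  ex_series (fun n => Rabs (INR n * INR n * a n)) /\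
  Series (fun n => Rabs (INR n * INR n * a n)) <= 62500 * M.
Proof.
  intros Ha.
  destruct (l1_dominates_series (fun n => 62500 * a n) (62500 * M)
     (fun n => INR n * INR n * a n)) as (H1 & _ & H2 & _); auto.
  - eapply l1_weaken; [apply l1_scal; eauto | rewrite Rabs_right; lra].
  - intros n. rewrite !Rabs_mult. rewrite (Rabs_right 62500) by lra.
    assert (P := pos_INR n). rewrite (Rabs_right (INR n)) by lra.
    generalize (proj2 (nmul_weight n)) (Rabs_pos (a n)). nra.
Qed.

Lemma nmul_series1 a M : l1_le a M ->
  summable (nmul a) /\ Series (fun n => Rabs (nmul a n)) <= 250 * M.
Proof.
  intros Ha.
  destruct (l1_dominates_series (fun n => 250 * a n) (250 * M) (nmul a)) as (H1 & _ & H2 & _); auto.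
  - eapply l1_weaken; [apply l1_scal; eauto | rewrite Rabs_right; lra].
  - intros n. unfold nmul. rewrite !Rabs_mult. rewrite (Rabs_right 250) by lra.
    assert (P := pos_INR n). rewrite (Rabs_right (INR n)) by lra.
    generalize (proj1 (nmul_weight n)) (Rabs_pos (a n)). nra.
Qed.

Lemma taylor_remainder (f f' f'' : R -> R) M :
  (forall s, is_derive f s (f' s)) -> (forall s, is_derive f' s (f'' s)) ->
  (forall s, 0 <= s <= 1 -> Rabs (f'' s) <= M) ->
  Rabs (f 1 - f 0 - f' 0) <= M.
Proof.
  intros H1 H2 HM.
  destruct (MVT_gen f 0 1 f') as [c [Hc Ec]].
  - intros; apply H1.
  - intros x _. apply continuity_pt_filterlim. apply (ex_derive_continuous f). eexists; apply H1.
  - rewrite Rmin_left, Rmax_right in Hc by lra.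
    destruct (MVT_gen f' 0 c f'') as [d [Hd Ed]].
    + intros; apply H2.
    + intros x _. apply continuity_pt_filterlim. apply (ex_derive_continuous f'). eexists; apply H2.
    + rewrite Rmin_left, Rmax_right in Hd by lra.
      replace (f 1 - f 0 - f' 0) with (f'' d * c) by lra.
      assert (Hd' := HM d ltac:(lra)). rewrite Rabs_mult, (Rabs_right c) by lra.
      generalize (Rabs_pos (f'' d)). nra.
Qed.

Lemma mvt_bound (f f' : R -> R) M :
  (forall s, is_derive f s (f' s)) -> (forall s, 0 <= s <= 1 -> Rabs (f' s) <= M) ->
  Rabs (f 1 - f 0) <= M.
Proof.
  intros H1 HM.
  destruct (MVT_gen f 0 1 f') as [c [Hc Ec]].
  - intros; apply H1.
  - intros x _. apply continuity_pt_filterlim. apply (ex_derive_continuous f). eexists; apply H1.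
  - rewrite Rmin_left, Rmax_right in Hc by lra. rewrite Ec, Rminus_0_r, Rmult_1_r. apply HM; lra.
Qed.

Definition dist1 (w w' : C) : R := Rabs (Re w' - Re w) + Rabs (Im w' - Im w).

Lemma linear_combination_bound x y u v : Rabs u <= 1 -> Rabs v <= 1 ->
  Rabs (x * u + y * v) <= Rabs x + Rabs y.
Proof.
  intros Hu Hv. eapply Rle_trans; [apply Rabs_triang |]. rewrite !Rabs_mult.
  generalize (Rabs_pos x) (Rabs_pos y). nra.
Qed.

Definition segment (w w' : C) (s : R) : C :=
  (Re w + s * (Re w' - Re w), Im w + s * (Im w' - Im w)).

Lemma segment_0 w w' : segment w w' 0 = w.
Proof. destruct w as [x y]. unfold segment. simpl. f_equal; ring. Qed.
Lemma segment_1 w w' : segment w w' 1 = w'.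
Proof. destruct w' as [x y]. unfold segment. simpl. f_equal; ring. Qed.

Lemma segment_lower w w' s : Im w <= 0 -> Im w' <= 0 -> 0 <= s <= 1 -> Im (segment w w' s) <= 0.
Proof. intros Hw Hw' Hs. unfold segment, Im in *. simpl. nra. Qed.

Lemma Re_mode_segment_derive n w w' s :
  is_derive (fun s => Re (mode n (segment w w' s))) s
    (INR n * ((Im w' - Im w) * Re (mode n (segment w w' s))
              + (Re w' - Re w) * Im (mode n (segment w w' s)))).
Proof.
  unfold mode, segment, Re, Im. simpl. auto_derive; auto. ring.
Qed.
Lemma Im_mode_segment_derive n w w' s :
  is_derive (fun s => Im (mode n (segment w w' s))) s
    (INR n * ((Im w' - Im w) * Im (mode n (segment w w' s))
              - (Re w' - Re w) * Re (mode n (segment w w' s)))).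
Proof.
  unfold mode, segment, Re, Im. simpl. auto_derive; auto. ring.
Qed.

(** The mean value theorem along the segment, which stays in the closed half-plane, where modes are
    bounded by 1. *)
Lemma mode_lipschitz n w w' : Im w <= 0 -> Im w' <= 0 ->
  Rabs (Re (mode n w') - Re (mode n w)) <= INR n * dist1 w w' /\
  Rabs (Im (mode n w') - Im (mode n w)) <= INR n * dist1 w w'.
Proof.
  intros Hw Hw'. assert (P := pos_INR n).
  replace (mode n w) with (mode n (segment w w' 0)) by (rewrite segment_0; reflexivity).
  replace (mode n w') with (mode n (segment w w' 1)) at 1 2 by (rewrite segment_1; reflexivity).
  split.
  - apply (mvt_bound (fun s => Re (mode n (segment w w' s)))
      (fun s => INR n * ((Im w' - Im w) * Re (mode n (segment w w' s))
              + (Re w' - Re w) * Im (mode n (segment w w' s))))).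
    + apply Re_mode_segment_derive.
    + intros s Hs. rewrite Rabs_mult, (Rabs_right (INR n)) by lra.
      apply Rmult_le_compat_l; auto. unfold dist1. rewrite Rplus_comm at 1.
      apply linear_combination_bound; apply mode_bound, segment_lower; auto.
  - apply (mvt_bound (fun s => Im (mode n (segment w w' s)))
      (fun s => INR n * ((Im w' - Im w) * Im (mode n (segment w w' s))
              - (Re w' - Re w) * Re (mode n (segment w w' s))))).
    + apply Im_mode_segment_derive.
    + intros s Hs. rewrite Rabs_mult, (Rabs_right (INR n)) by lra.
      apply Rmult_le_compat_l; auto. unfold dist1.
      rewrite <- (Rabs_Ropp (Re w' - Re w)), Rplus_comm.
      unfold Rminus at 1. rewrite <- Ropp_mult_distr_l_reverse.
      apply linear_combination_bound; apply mode_bound, segment_lower; auto.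
Qed.

Lemma mode_remainder n w w' : Im w <= 0 -> Im w' <= 0 ->
  Rabs (Re (mode n w') - Re (mode n w)
    - INR n * ((Im w' - Im w) * Re (mode n w) + (Re w' - Re w) * Im (mode n w)))
    <= INR n * INR n * (dist1 w w' * dist1 w w') /\
  Rabs (Im (mode n w') - Im (mode n w)
    - INR n * ((Im w' - Im w) * Im (mode n w) - (Re w' - Re w) * Re (mode n w)))
    <= INR n * INR n * (dist1 w w' * dist1 w w').
Proof.
  intros Hw Hw'. assert (P := pos_INR n).
  set (x := Re w' - Re w). set (y := Im w' - Im w).
  set (f := fun s => Re (mode n (segment w w' s))).
  set (h := fun s => Im (mode n (segment w w' s))).
  assert (Df : forall s, is_derive f s (INR n * (y * f s + x * h s))) by apply Re_mode_segment_derive.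
  assert (Dh : forall s, is_derive h s (INR n * (y * h s - x * f s))) by apply Im_mode_segment_derive.
  assert (Bd : forall s, 0 <= s <= 1 -> Rabs (f s) <= 1 /\ Rabs (h s) <= 1).
  { intros s Hs. apply mode_bound, segment_lower; auto. }
  set (d := dist1 w w'). assert (Ed : d = Rabs x + Rabs y) by reflexivity.
  assert (B1 : forall s, 0 <= s <= 1 -> Rabs (y * f s + x * h s) <= d).
  { intros s Hs. rewrite Ed, Rplus_comm. rewrite (Rplus_comm (Rabs x)), (Rplus_comm (x * h s)).
    apply linear_combination_bound; apply Bd; auto. }
  assert (B2 : forall s, 0 <= s <= 1 -> Rabs (y * h s - x * f s) <= d).
  { intros s Hs. rewrite Ed, <- (Rabs_Ropp x), Rplus_comm.
    unfold Rminus. rewrite Ropp_mult_distr_l.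
    apply linear_combination_bound; apply Bd; auto. }
  assert (Dpos : 0 <= d) by (rewrite Ed; generalize (Rabs_pos x) (Rabs_pos y); lra).
  assert (B3 : forall s u v, 0 <= s <= 1 -> Rabs u <= d -> Rabs v <= d ->
     Rabs (INR n * (y * (INR n * u) + x * (INR n * v))) <= INR n * INR n * (d * d)).
  { intros s u v Hs Hu Hv.
    replace (INR n * (y * (INR n * u) + x * (INR n * v))) with (INR n * INR n * (y * u + x * v)) by ring.
    rewrite Rabs_mult, (Rabs_right (INR n * INR n)) by nra.
    apply Rmult_le_compat_l; [nra |].
    eapply Rle_trans; [apply Rabs_triang |]. rewrite !Rabs_mult.
    generalize (Rabs_pos x) (Rabs_pos y). rewrite Ed in *. nra. }
  assert (E0 : f 0 = Re (mode n w)) by (unfold f; rewrite segment_0; reflexivity).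
  assert (E1 : f 1 = Re (mode n w')) by (unfold f; rewrite segment_1; reflexivity).
  assert (G0 : h 0 = Im (mode n w)) by (unfold h; rewrite segment_0; reflexivity).
  assert (G1 : h 1 = Im (mode n w')) by (unfold h; rewrite segment_1; reflexivity).
  rewrite <- E0, <- E1, <- G0, <- G1.
  split.
  - apply (taylor_remainder f (fun s => INR n * (y * f s + x * h s))
      (fun s => INR n * (y * (INR n * (y * f s + x * h s)) + x * (INR n * (y * h s - x * f s))))); auto.
    + intros s.
      evar_last.
      * apply (is_derive_scal (fun s => y * f s + x * h s) s (INR n)).
        apply (is_derive_plus (fun s => y * f s) (fun s => x * h s));
          [apply (is_derive_scal f s y), Df | apply (is_derive_scal h s x), Dh].
      * unfold plus; simpl. ring.
    + intros s Hs. apply (B3 s); auto.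
  - apply (taylor_remainder h (fun s => INR n * (y * h s - x * f s))
      (fun s => INR n * (y * (INR n * (y * h s - x * f s)) + x * (INR n * (- (y * f s + x * h s)))))); auto.
    + intros s.
      evar_last.
      * apply (is_derive_scal (fun s => y * h s - x * f s) s (INR n)).
        apply (is_derive_minus (fun s => y * h s) (fun s => x * f s));
          [apply (is_derive_scal h s y), Dh | apply (is_derive_scal f s x), Df].
      * unfold minus, plus, opp; simpl. ring.
    + intros s Hs. apply (B3 s); auto. rewrite Rabs_Ropp. auto.
Qed.

Lemma dist1_Cmod w w' : 0 <= dist1 w w' <= 2 * Cmod (Cminus w' w).
Proof.
  split.
  - unfold dist1. generalize (Rabs_pos (Re w' - Re w)) (Rabs_pos (Im w' - Im w)). lra.
  - assert (H := Rmax_Cmod (Cminus w' w)). unfold dist1.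
    assert (H1 := Rmax_l (Rabs (fst (Cminus w' w))) (Rabs (snd (Cminus w' w)))).
    assert (H2 := Rmax_r (Rabs (fst (Cminus w' w))) (Rabs (snd (Cminus w' w)))).
    simpl in *. unfold Re, Im, Rminus. lra.
Qed.

Lemma Cmod_le_dist1 w w' : Cmod (Cminus w' w) <= dist1 w w'.
Proof.
  unfold dist1, Cmod, Re, Im. simpl.
  set (x := fst w' + - fst w). set (y := snd w' + - snd w).
  unfold Rminus. fold x y.
  assert (Px := Rabs_pos x). assert (Py := Rabs_pos y).
  apply Rle_trans with (sqrt ((Rabs x + Rabs y) * (Rabs x + Rabs y))).
  - apply sqrt_le_1_alt. rewrite !Rmult_1_r.
    assert (x * x = Rabs x * Rabs x) by (rewrite <- Rabs_mult, Rabs_right; nra).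
    assert (y * y = Rabs y * Rabs y) by (rewrite <- Rabs_mult, Rabs_right; nra). nra.
  - rewrite sqrt_square; lra.
Qed.

Lemma Series_increment_le a (f g : nat -> R) d : 0 <= d -> summable (nmul a) ->
  ex_series (fun n => a n * f n) -> ex_series (fun n => a n * g n) ->
  (forall n, Rabs (f n - g n) <= INR n * d) ->
  Rabs (Series (fun n => a n * f n) - Series (fun n => a n * g n))
    <= d * Series (fun n => Rabs (nmul a n)).
Proof.
  intros D0 Hna Ef Eg Hfg. rewrite <- Series_minus, <- Series_scal_l by auto.
  assert (L : forall n, Rabs (a n * f n - a n * g n) <= d * Rabs (nmul a n)).
  { intros n. replace (a n * f n - a n * g n) with (a n * (f n - g n)) by ring.
    unfold nmul. rewrite !Rabs_mult, (Rabs_right (INR n)) by (apply Rle_ge, pos_INR).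
    generalize (Hfg n) (Rabs_pos (a n)). nra. }
  assert (E : ex_series (fun n => d * Rabs (nmul a n)))
    by (apply (ex_series_scal_l d (fun n => Rabs (nmul a n))); auto).
  apply Rle_trans with (Series (fun n => Rabs (a n * f n - a n * g n))).
  - apply Series_Rabs. apply (summable_le _ _ L E).
  - apply Series_le; auto. intros n; split; [apply Rabs_pos | apply L].
Qed.

Lemma fourier_lipschitz a w w' : Im w <= 0 -> Im w' <= 0 -> summable a -> summable (nmul a) ->
  Rabs (Re (fourier a w') - Re (fourier a w)) <= dist1 w w' * Series (fun n => Rabs (nmul a n)) /\
  Rabs (Im (fourier a w') - Im (fourier a w)) <= dist1 w w' * Series (fun n => Rabs (nmul a n)).
Proof.
  intros Hw Hw' Ha Hna.
  destruct (fourier_ex a w Hw Ha). destruct (fourier_ex a w' Hw' Ha).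
  destruct (dist1_Cmod w w') as [D0 _].
  unfold fourier; cbn [Re Im fst snd].
  split; apply Series_increment_le; auto; intros n; apply mode_lipschitz; auto.
Qed.

(** The derivative of [fourier a] is [- i * fourier (nmul a)]. *)
Lemma fourier_remainder a M w w' : Im w <= 0 -> Im w' <= 0 -> l1_le a M ->
  Rabs (Re (fourier a w') - Re (fourier a w)
    - ((Im w' - Im w) * Re (fourier (nmul a) w) + (Re w' - Re w) * Im (fourier (nmul a) w)))
    <= 62500 * M * (dist1 w w' * dist1 w w') /\
  Rabs (Im (fourier a w') - Im (fourier a w)
    - ((Im w' - Im w) * Im (fourier (nmul a) w) - (Re w' - Re w) * Re (fourier (nmul a) w)))
    <= 62500 * M * (dist1 w w' * dist1 w w').
Proof.
  intros Hw Hw' Ha.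
  assert (Sa := l1_summable _ _ Ha). destruct (nmul_series1 _ _ Ha) as [Sn _].
  destruct (nmul_series _ _ Ha) as [S2 L2].
  destruct (fourier_ex a w Hw Sa) as [A1 A2]. destruct (fourier_ex a w' Hw' Sa) as [A3 A4].
  destruct (fourier_ex (nmul a) w Hw Sn) as [A5 A6].
  set (d2 := dist1 w w' * dist1 w w').
  assert (D0 : 0 <= d2) by (destruct (dist1_Cmod w w'); unfold d2; nra).
  assert (G : forall f g k h x y, 
    ex_series (fun n => a n * f n) -> ex_series (fun n => a n * g n) ->
    ex_series (fun n => nmul a n * h n) -> ex_series (fun n => nmul a n * k n) ->
    (forall n, Rabs (f n - g n - INR n * (x * h n + y * k n)) <= INR n * INR n * d2) ->
    Rabs (Series (fun n => a n * f n) - Series (fun n => a n * g n)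
      - (x * Series (fun n => nmul a n * h n) + y * Series (fun n => nmul a n * k n)))
      <= 62500 * M * d2).
  { intros f g k h x y E1 E2 E3 E4 Hfg.
    assert (E3' : ex_series (fun n => x * (nmul a n * h n)))
      by (apply (ex_series_scal_l x (fun n => nmul a n * h n)); auto).
    assert (E4' : ex_series (fun n => y * (nmul a n * k n)))
      by (apply (ex_series_scal_l y (fun n => nmul a n * k n)); auto).
    rewrite <- !Series_scal_l, <- Series_plus, <- Series_minus, <- Series_minus; auto.
    2: apply (ex_series_minus (fun n => a n * f n) (fun n => a n * g n)); auto.
    2: apply (ex_series_plus (fun n => x * (nmul a n * h n)) (fun n => y * (nmul a n * k n))); auto.
    set (u := fun n => _).
    assert (L : forall n, Rabs (u n) <= d2 * Rabs (INR n * INR n * a n)).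
    { intros n. unfold u, nmul.
      replace (a n * f n - a n * g n - (x * (INR n * a n * h n) + y * (INR n * a n * k n)))
        with (a n * (f n - g n - INR n * (x * h n + y * k n))) by ring.
      rewrite !Rabs_mult, (Rabs_right (INR n)) by (apply Rle_ge, pos_INR).
      generalize (Hfg n) (Rabs_pos (a n)). nra. }
    assert (E : ex_series (fun n => d2 * Rabs (INR n * INR n * a n)))
      by (apply (ex_series_scal_l d2 (fun n => Rabs (INR n * INR n * a n))); auto).
    apply Rle_trans with (Series (fun n => Rabs (u n))).
    - apply Series_Rabs. apply (summable_le _ _ L E).
    - apply Rle_trans with (Series (fun n => d2 * Rabs (INR n * INR n * a n))).
      + apply Series_le; auto. intros n; split; [apply Rabs_pos | apply L].
      + rewrite Series_scal_l. rewrite (Rmult_comm _ d2). apply Rmult_le_compat_l; auto. }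
  split; unfold fourier; cbn [Re Im fst snd].
  - apply (G (fun n => Re (mode n w')) (fun n => Re (mode n w)) (fun n => Im (mode n w)) (fun n => Re (mode n w))); auto.
    intros n. apply mode_remainder; auto.
  - match goal with |- context [?u * ?x - ?v * ?y] =>
      replace (u * x - v * y) with (u * x + - v * y) by ring end.
    apply (G (fun n => Im (mode n w')) (fun n => Im (mode n w)) (fun n => Re (mode n w)) (fun n => Im (mode n w))); auto.
    intros n.
    replace ((Im w' - Im w) * Im (mode n w) + - (Re w' - Re w) * Re (mode n w))
      with ((Im w' - Im w) * Im (mode n w) - (Re w' - Re w) * Re (mode n w)) by ring.
    apply mode_remainder; auto.
Qed.

(** Splits off the constant term and a factor [zeta]. For [crapper] this yields the closed form, for
    [kap] the decay at infinite depth. *)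
Lemma fourier_shift a w : Im w <= 0 -> summable a -> summable (fun n => a (S n)) ->
  fourier a w = Cplus (RtoC (a 0%nat)) (Cmult (mode 1 w) (fourier (fun n => a (S n)) w)).
Proof.
  intros Hw Ha Ha'.
  destruct (fourier_ex a w Hw Ha) as [E1 E2].
  destruct (fourier_ex (fun n => a (S n)) w Hw Ha') as [E3 E4].
  set (c := Re (mode 1 w)). set (s := Im (mode 1 w)).
  assert (R1 : Series (fun n => a (S n) * Re (mode (S n) w)) =
    c * Series (fun n => a (S n) * Re (mode n w)) - s * Series (fun n => a (S n) * Im (mode n w))).
  { rewrite <- !Series_scal_l, <- Series_minus.
    - apply Series_ext. intros n. change (S n) with (1 + n)%nat at 2.
      rewrite mode_plus. unfold Cmult, c, s, Re, Im. cbn [fst snd]. ring.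
    - apply (ex_series_scal_l c (fun n => a (S n) * Re (mode n w))); auto.
    - apply (ex_series_scal_l s (fun n => a (S n) * Im (mode n w))); auto. }
  assert (R2 : Series (fun n => a (S n) * Im (mode (S n) w)) =
    c * Series (fun n => a (S n) * Im (mode n w)) + s * Series (fun n => a (S n) * Re (mode n w))).
  { rewrite <- !Series_scal_l, <- Series_plus.
    - apply Series_ext. intros n. change (S n) with (1 + n)%nat at 2.
      rewrite mode_plus. unfold Cmult, c, s, Re, Im. cbn [fst snd]. ring.
    - apply (ex_series_scal_l c (fun n => a (S n) * Im (mode n w))); auto.
    - apply (ex_series_scal_l s (fun n => a (S n) * Re (mode n w))); auto. }
  apply injective_projections.
  - unfold fourier at 1. cbn [fst]. rewrite Series_incr_1 by auto. rewrite R1, mode_0.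
    unfold fourier, Cplus, Cmult, RtoC, c, s, Re, Im. cbn [fst snd]. ring.
  - unfold fourier at 1. cbn [snd]. rewrite Series_incr_1 by auto. rewrite R2, mode_0.
    unfold fourier, Cplus, Cmult, RtoC, c, s, Re, Im. cbn [fst snd]. ring.
Qed.

(** * Products with a conjugate on the boundary *)

Lemma mode_1_circle x : Cmult (mode 1 (x, 0)) (Cconj (mode 1 (x, 0))) = RtoC 1.
Proof.
  unfold mode, Cmult, Cconj, RtoC, Re, Im. cbn [fst snd]. rewrite Rmult_0_r, exp_0.
  assert (H := sin2_cos2 (INR 1 * x)). unfold Rsqr in H. f_equal; lra.
Qed.

Lemma l1_shift a M k : l1_le a M -> l1_le (fun n => a (n + k)%nat) M.
Proof.
  intros Ha n. apply Rle_trans with (2 := Ha (n + k)%nat).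
  apply Rle_trans with (2 := sum_f_shift_le (fun k => Rabs (a k) * rho ^ k) n k (l1_term_ge0 a)).
  apply sum_Rle. intros j _. apply Rmult_le_compat_l; [apply Rabs_pos |].
  rewrite pow_add. generalize (rho_pow_ge1 j) (rho_pow_ge1 k). nra.
Qed.

(** On the circle, the conjugate of [mode k] sends [mode (k - j)] to the conjugate of [mode j];
    these are the coefficients moved to the antianalytic side. *)
Definition reflected (a : nat -> R) (k j : nat) : R := if le_dec j k then a (k - j)%nat else 0.

Lemma summable_finite a k : (forall n, (k < n)%nat -> a n = 0) -> summable a.
Proof.
  intros H. apply (ex_series_incr_n (fun n => Rabs (a n)) (S k)).
  apply ex_series_ext with (fun n => 0 * (/ 2) ^ n).
  - intros n. rewrite H by lia. rewrite Rabs_R0. apply Rmult_0_l.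
  - apply (ex_series_scal_l 0 (pow (/ 2))), ex_series_geom. rewrite Rabs_right; lra.
Qed.

Lemma summable_reflected a k : summable (reflected a k).
Proof.
  apply summable_finite with k. intros n Hn. unfold reflected. destruct (le_dec n k); [lia | reflexivity].
Qed.

(** Each factor [conj zeta] moves one constant term to the antianalytic part, as
    [zeta * conj zeta = 1]. The constant [a k] belongs to both series, hence the subtraction. *)
Lemma fourier_conj_mode a M k x : l1_le a M ->
  Cmult (fourier a (x, 0)) (Cconj (mode k (x, 0))) =
  Cminus (Cplus (fourier (fun n => a (n + k)%nat) (x, 0))
                (Cconj (fourier (reflected a k) (x, 0)))) (RtoC (a k)).
Proof.
  intros Ha. set (w := (x, 0)). assert (Hw : Im w <= 0) by (simpl; lra).
  induction k as [|k IH].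
  - rewrite mode_0.
    rewrite (fourier_ext (fun n => a (n + 0)%nat) a) by (intros; f_equal; lia).
    rewrite (fourier_ext (reflected a 0) (delta_seq (a 0%nat))).
    + rewrite fourier_delta_seq. apply injective_projections; simpl; ring.
    + intros [|n]; reflexivity.
  - change (S k) with (1 + k)%nat at 1. rewrite mode_plus.
    set (m := mode 1 w).
    replace (Cmult (fourier a w) (Cconj (Cmult m (mode k w)))) with
      (Cmult (Cconj m) (Cmult (fourier a w) (Cconj (mode k w))))
      by (apply injective_projections; simpl; ring).
    rewrite IH.
    assert (S1 := l1_summable _ _ (l1_shift _ _ k Ha)).
    assert (S2 := l1_summable _ _ (l1_shift _ _ (S k) Ha)).
    rewrite (fourier_shift (fun n => a (n + k)%nat) w Hw S1).
    2: { apply ex_series_ext with (2 := S2). intros n. do 2 f_equal. lia. }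
    rewrite (fourier_shift (reflected a (S k)) w Hw (summable_reflected _ _)).
    2: { apply summable_finite with k. intros n Hn. unfold reflected.
         destruct (le_dec (S n) (S k)); [lia | reflexivity]. }
    rewrite (fourier_ext (fun n => a (S n + k)%nat) (fun n => a (n + S k)%nat)) by (intros; f_equal; lia).
    rewrite (fourier_ext (fun n => reflected a (S k) (S n)) (reflected a k)).
    2: { intros n. unfold reflected. destruct (le_dec (S n) (S k)), (le_dec n k); try lia; f_equal; lia. }
    fold m. replace (reflected a (S k) 0) with (a (S k)) by reflexivity.
    change (a (0 + k)%nat) with (a k).
    set (u := fourier (fun n => a (n + S k)%nat) w). set (v := fourier (reflected a k) w).
    assert (E := mode_1_circle x). fold w m in E.
    transitivity (Cplus (Cmult (Cmult m (Cconj m)) u) (Cmult (Cconj m) (Cconj v))).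
    + apply injective_projections; simpl; ring.
    + rewrite E. apply injective_projections; simpl; ring.
Qed.

Lemma Series_single (u : nat -> R) k : (forall n, n <> k -> u n = 0) -> Series u = u k.
Proof.
  intros H.
  assert (E : ex_series u).
  { apply (ex_series_incr_n u (S k)). apply ex_series_ext with (fun n => 0 * (/ 2) ^ n).
    - intros n. rewrite H by lia. apply Rmult_0_l.
    - apply (ex_series_scal_l 0 (pow (/ 2))), ex_series_geom. rewrite Rabs_right; lra. }
  rewrite (Series_incr_n u (S k)) by (auto; lia). simpl pred.
  rewrite (Series_ext _ (fun n => 0 * 0)).
  - rewrite Series_scal_l. rewrite Rmult_0_l, Rplus_0_r.
    destruct k; [reflexivity |]. rewrite tech5, (sum_eq _ (fun _ => 0)).
    + rewrite sum_cte. ring.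
    + intros i Hi. apply H. lia.
  - intros n. rewrite H by lia. ring.
Qed.

(** The error in [fourier_mult_conj]. On the circle it vanishes because it is linear in [b], zero on
    unit sequences and bounded by the norms, while finite sequences are dense. *)
Definition circle_defect (a b : nat -> R) (w : C) : C :=
  Cplus (Cminus (Cminus (Cmult (fourier a w) (Cconj (fourier b w))) (fourier (hank a b) w))
    (Cconj (fourier (hank b a) w))) (RtoC (hank a b 0)).

Lemma circle_defect_plus a b b' Ma Mb Mb' w : Im w <= 0 -> l1_le a Ma -> l1_le b Mb -> l1_le b' Mb' ->
  circle_defect a (fun n => b n + b' n) w = Cplus (circle_defect a b w) (circle_defect a b' w).
Proof.
  intros Hw Ha Hb Hb'. unfold circle_defect.
  assert (H1 := l1_hank _ _ _ _ Ha Hb). assert (H2 := l1_hank _ _ _ _ Ha Hb').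
  assert (H3 := l1_hank _ _ _ _ Hb Ha). assert (H4 := l1_hank _ _ _ _ Hb' Ha).
  rewrite (fourier_plus b b' w) by eauto using l1_summable.
  rewrite (fourier_ext (hank a (fun n => b n + b' n)) (fun n => hank a b n + hank a b' n))
    by (intros; eapply hank_plus_r; eauto).
  rewrite (fourier_ext (hank (fun n => b n + b' n) a) (fun n => hank b a n + hank b' a n))
    by (intros; eapply hank_plus_l; eauto).
  rewrite (hank_plus_r _ _ _ _ _ _ 0 Ha Hb Hb').
  rewrite !fourier_plus by eauto using l1_summable.
  apply injective_projections; simpl; ring.
Qed.

Lemma circle_defect_scal a c b w :
  circle_defect a (fun n => c * b n) w = Cmult (RtoC c) (circle_defect a b w).
Proof.
  unfold circle_defect.
  rewrite (fourier_ext (hank a (fun n => c * b n)) (fun n => c * hank a b n))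
    by (intros; apply hank_scal_r).
  rewrite (fourier_ext (hank (fun n => c * b n) a) (fun n => c * hank b a n))
    by (intros; apply hank_scal_l).
  rewrite hank_scal_r, !fourier_scal. apply injective_projections; simpl; ring.
Qed.

(** Two real products and at most three further terms, each bounded by [Ma * Mb]. *)
Lemma circle_defect_bound a b Ma Mb w : Im w <= 0 -> l1_le a Ma -> l1_le b Mb ->
  Rabs (Re (circle_defect a b w)) <= 5 * (Ma * Mb) /\
  Rabs (Im (circle_defect a b w)) <= 5 * (Ma * Mb).
Proof.
  intros Hw Ha Hb.
  destruct (fourier_bound a _ w Hw Ha) as [A1 A2]. destruct (fourier_bound b _ w Hw Hb) as [B1 B2].
  destruct (fourier_bound _ _ w Hw (l1_hank _ _ _ _ Ha Hb)) as [H1 H2].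
  destruct (fourier_bound _ _ w Hw (l1_hank _ _ _ _ Hb Ha)) as [H3 H4].
  assert (H0 := l1_coeff _ _ 0 (l1_hank _ _ _ _ Ha Hb)).
  assert (Pr : forall u v, Rabs u <= Ma -> Rabs v <= Mb -> Rabs (u * v) <= Ma * Mb).
  { intros u v Hu Hv. rewrite Rabs_mult. apply Rmult_le_compat; auto using Rabs_pos. }
  assert (P1 := Pr _ _ A1 B1). assert (P2 := Pr _ _ A1 B2).
  assert (P3 := Pr _ _ A2 B1). assert (P4 := Pr _ _ A2 B2).
  assert (P0 : 0 <= Ma * Mb) by (generalize (Rabs_pos (hank a b 0)); lra).
  unfold circle_defect, Cminus, Cplus, Cmult, Cconj, Copp, RtoC, Re, Im in *. cbn [fst snd].
  repeat match goal with H : Rabs _ <= _ |- _ => apply Rabs_le_between in H end.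
  split; apply Rabs_le_between; lra.
Qed.

Definition unit_seq (k n : nat) : R := if Nat.eq_dec n k then 1 else 0.

Lemma l1_unit_seq k : l1_le (unit_seq k) (rho ^ k).
Proof.
  apply l1_finite with k.
  - intros n Hn. unfold unit_seq. destruct (Nat.eq_dec n k); [lia | reflexivity].
  - destruct k.
    + change (Rabs 1 * rho ^ 0 <= rho ^ 0). rewrite Rabs_R1. lra.
    + rewrite tech5, (sum_eq _ (fun _ => 0)).
      * rewrite sum_cte. unfold unit_seq. destruct (Nat.eq_dec (S k) (S k)); [| lia].
        rewrite Rabs_R1. lra.
      * intros i Hi. unfold unit_seq. destruct (Nat.eq_dec i (S k)); [lia |]. rewrite Rabs_R0. ring.
Qed.

Lemma circle_defect_unit a M k x : l1_le a M -> circle_defect a (unit_seq k) (x, 0) = RtoC 0.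
Proof.
  intros Ha. unfold circle_defect.
  assert (U : forall f, Series (fun n => unit_seq k n * f n) = f k).
  { intros f. rewrite (Series_single _ k).
    - unfold unit_seq. destruct (Nat.eq_dec k k); [ring | lia].
    - intros n Hn. unfold unit_seq. destruct (Nat.eq_dec n k); [lia | ring]. }
  replace (fourier (unit_seq k) (x, 0)) with (mode k (x, 0)).
  2: { unfold fourier. rewrite !U. apply injective_projections; reflexivity. }
  rewrite (fourier_conj_mode a M k x Ha).
  assert (E : forall n, hank a (unit_seq k) n = a (n + k)%nat).
  { intros n. unfold hank. rewrite (Series_ext _ (fun j => unit_seq k j * a (n + j)%nat)) by (intros; ring).
    apply U. }
  rewrite (fourier_ext (hank a (unit_seq k)) (fun n => a (n + k)%nat)) by auto.
  rewrite (fourier_ext (hank (unit_seq k) a) (reflected a k)).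
  - rewrite E. apply injective_projections; simpl; ring.
  - intros j. unfold hank, reflected. destruct (le_dec j k) as [L | L].
    + rewrite (Series_single _ (k - j)).
      * unfold unit_seq. destruct (Nat.eq_dec (j + (k - j)) k); [ring | lia].
      * intros n Hn. unfold unit_seq. destruct (Nat.eq_dec (j + n) k); [lia | ring].
    + rewrite (Series_ext _ (fun _ => 0 * 0)); [rewrite Series_scal_l; ring |].
      intros n. unfold unit_seq. destruct (Nat.eq_dec (j + n) k); [lia | ring].
Qed.

Definition truncate (K : nat) (b : nat -> R) (n : nat) : R := if le_dec n K then b n else 0.

Lemma l1_truncate K b M : l1_le b M -> l1_le (truncate K b) M.
Proof.
  apply l1_dominated. intros n. unfold truncate. destruct (le_dec n K); [apply Rle_refl |].
  rewrite Rabs_R0. apply Rabs_pos.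
Qed.

Lemma circle_defect_ext a b b' w : (forall n, b n = b' n) -> circle_defect a b w = circle_defect a b' w.
Proof.
  intros H. unfold circle_defect.
  rewrite (fourier_ext b b') by auto.
  rewrite (fourier_ext (hank a b) (hank a b')) by (intros; apply hank_ext; auto).
  rewrite (fourier_ext (hank b a) (hank b' a)) by (intros; apply hank_ext; auto).
  rewrite (hank_ext a a b b') by auto. reflexivity.
Qed.

Lemma circle_defect_truncate a b Ma Mb K x : l1_le a Ma -> l1_le b Mb ->
  circle_defect a (truncate K b) (x, 0) = RtoC 0.
Proof.
  intros Ha Hb. assert (Hw : Im (x, 0) <= 0) by (simpl; lra).
  induction K as [|K IH].
  - rewrite (circle_defect_ext _ _ (fun n => b 0%nat * unit_seq 0 n)).
    + rewrite circle_defect_scal, (circle_defect_unit a Ma) by auto.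
      apply injective_projections; simpl; ring.
    + intros [|n]; unfold truncate, unit_seq; simpl; ring.
  - rewrite (circle_defect_ext _ _ (fun n => truncate K b n + b (S K) * unit_seq (S K) n)).
    + erewrite circle_defect_plus; eauto using l1_truncate.
      * rewrite IH, circle_defect_scal, (circle_defect_unit a Ma) by auto.
        apply injective_projections; simpl; ring.
      * apply l1_scal, l1_unit_seq.
    + intros n. unfold truncate, unit_seq.
      destruct (le_dec n (S K)), (le_dec n K), (Nat.eq_dec n (S K)); subst; try lia; ring.
Qed.

Lemma l1_truncate_error b M eps : l1_le b M -> 0 < eps ->
  exists K, l1_le (fun n => b n - truncate K b n) eps.
Proof.
  intros Hb He. apply l1_series in Hb. destruct Hb as [E _].
  assert (L := Series_correct _ E). set (s := Series _) in L.
  assert (L' : is_lim_seq (sum_n (fun k => Rabs (b k) * rho ^ k)) s) by exact L.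
  apply is_lim_seq_spec in L'. destruct (L' (mkposreal eps He)) as [K HK].
  exists K. intros n. specialize (HK K (le_n K)). simpl in HK.
  rewrite sum_n_Reals in HK. apply Rabs_lt_between in HK.
  assert (Z : forall j, (j <= K)%nat ->
    sum_f_R0 (fun k => Rabs (b k - truncate K b k) * rho ^ k) j = 0).
  { intros j Hj. rewrite (sum_eq _ (fun _ => 0)); [rewrite sum_cte; ring |].
    intros i Hi. unfold truncate. destruct (le_dec i K); [| lia].
    rewrite Rminus_diag, Rabs_R0. ring. }
  destruct (le_lt_dec n K) as [C | C].
  - rewrite Z by auto. lra.
  - rewrite (tech2 _ K n C), Z by auto.
    assert (P := nonneg_partial_sum_le _ n (l1_term_ge0 b) E). fold s in P.
    rewrite (tech2 _ K n C) in P.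
    rewrite (sum_eq _ (fun i => Rabs (b (S K + i)%nat) * rho ^ (S K + i))).
    + lra.
    + intros i _. unfold truncate. destruct (le_dec (S K + i) K); [lia |]. rewrite Rminus_0_r. reflexivity.
Qed.

Lemma fourier_mult_conj a b Ma Mb x : l1_le a Ma -> l1_le b Mb ->
  Cmult (fourier a (x, 0)) (Cconj (fourier b (x, 0))) =
  Cminus (Cplus (fourier (hank a b) (x, 0)) (Cconj (fourier (hank b a) (x, 0)))) (RtoC (hank a b 0)).
Proof.
  intros Ha Hb. assert (Hw : Im (x, 0) <= 0) by (simpl; lra).
  assert (D : forall eps, 0 < eps -> Rabs (Re (circle_defect a b (x, 0))) <= 5 * (Ma * eps) /\
                          Rabs (Im (circle_defect a b (x, 0))) <= 5 * (Ma * eps)).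
  { intros eps He. destruct (l1_truncate_error b Mb eps Hb He) as [K HK].
    rewrite (circle_defect_ext _ b (fun n => truncate K b n + (b n - truncate K b n))) by (intros; ring).
    erewrite circle_defect_plus; eauto using l1_truncate.
    erewrite circle_defect_truncate; eauto.
    replace (Cplus (RtoC 0) (circle_defect a (fun n => b n - truncate K b n) (x, 0)))
      with (circle_defect a (fun n => b n - truncate K b n) (x, 0))
      by (apply injective_projections; simpl; ring).
    apply circle_defect_bound; auto. }
  assert (PM := l1_ge0 _ _ Ha).
  assert (Z : forall r, (forall eps, 0 < eps -> Rabs r <= 5 * (Ma * eps)) -> r = 0).
  { intros r Hr. destruct (Req_dec r 0) as [| N]; auto. exfalso.
    assert (0 < Rabs r) by (apply Rabs_pos_lt; auto).
    specialize (Hr (Rabs r / (10 * (Ma + 1))) ltac:(apply Rdiv_lt_0_compat; lra)).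
    assert (E : 5 * (Ma * (Rabs r / (10 * (Ma + 1)))) = Rabs r * (Ma / (Ma + 1) / 2)) by (field; lra).
    rewrite E in Hr.
    assert (Ma / (Ma + 1) <= 1).
    { apply Rmult_le_reg_r with (Ma + 1); [lra |]. unfold Rdiv. rewrite Rmult_assoc, Rinv_l by lra. lra. }
    nra. }
  assert (Z1 := Z _ (fun e He => proj1 (D e He))). assert (Z2 := Z _ (fun e He => proj2 (D e He))).
  unfold circle_defect, Re, Im in Z1, Z2. simpl in Z1, Z2.
  apply injective_projections; simpl; lra.
Qed.

(** * Half-plane maps with [Re dz/dw >= 0] *)

Definition increment (f : C -> C) (l w w' : C) : C :=
  Cminus (Cminus (f w') (f w)) (Cmult l (Cminus w' w)).

(** Here [zd] is the derivative up to the boundary. A single [K] bounds the remainder, the Lipschitz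
    constants and the distance from the identity; the last bound keeps preimages of bounded sets
    bounded, so that compactness can be used. *)
Record half_plane_map (z zd : C -> C) (K : R) : Prop := {
  hm_quad : forall w w', Im w <= 0 -> Im w' <= 0 ->
    Rabs (Re (increment z (zd w) w w')) <= K * (dist1 w w' * dist1 w w') /\
    Rabs (Im (increment z (zd w) w w')) <= K * (dist1 w w' * dist1 w w');
  hm_lip_d : forall w w', Im w <= 0 -> Im w' <= 0 ->
    Rabs (Re (zd w') - Re (zd w)) <= K * dist1 w w' /\
    Rabs (Im (zd w') - Im (zd w)) <= K * dist1 w w';
  hm_lip : forall w w', Im w <= 0 -> Im w' <= 0 ->
    Rabs (Re (z w') - Re (z w)) <= K * dist1 w w' /\
    Rabs (Im (z w') - Im (z w)) <= K * dist1 w w';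
  hm_pos : forall w, Im w < 0 -> 0 < Re (zd w);
  hm_nonneg : forall w, Im w <= 0 -> 0 <= Re (zd w);
  hm_regular : forall w, Im w <= 0 -> zd w <> RtoC 0;
  hm_bounded : forall w, Im w <= 0 ->
    Rabs (Re (z w) - Re w) <= K /\ Rabs (Im (z w) - Im w) <= K }.

Lemma Rabs_mult_self x : Rabs x * Rabs x = x * x.
Proof. rewrite <- Rabs_mult. apply Rabs_right, Rle_ge, Rle_0_sqr. Qed.

(** Extends functions on [0, 1] by constants, so that a path defined on the whole line stays in the
    half-plane. *)
Definition clamp (s : R) : R := Rmax 0 (Rmin 1 s).

Lemma clamp_bounds s : 0 <= clamp s <= 1.
Proof.
  unfold clamp. split; [apply Rmax_l |]. apply Rmax_lub; [lra | apply Rmin_l].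
Qed.

Lemma clamp_id s : 0 <= s <= 1 -> clamp s = s.
Proof. intros H. unfold clamp. rewrite Rmin_right, Rmax_right; lra. Qed.

Lemma clamp_lipschitz s s' : Rabs (clamp s - clamp s') <= Rabs (s - s').
Proof.
  unfold clamp, Rmax, Rmin. repeat destruct Rle_dec; apply Rabs_le_between;
    unfold Rabs; destruct Rcase_abs; lra.
Qed.

(** The quadratic remainder gives the derivative inside and, for the clamped extension, continuity
    up to the end points. *)
Lemma mvt_quadratic (f f' : R -> R) K :
  (forall s s', 0 <= s <= 1 -> 0 <= s' <= 1 ->
     Rabs (f s' - f s - f' s * (s' - s)) <= K * ((s' - s) * (s' - s))) ->
  exists c, 0 < c < 1 /\ f 1 - f 0 = f' c.
Proof.
  intros HQ.
  assert (PK : 0 <= K).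
  { generalize (HQ 0 1 ltac:(lra) ltac:(lra)) (Rabs_pos (f 1 - f 0 - f' 0 * (1 - 0))). lra. }
  set (g := fun s => f (clamp s)).
  assert (Dg : forall s, 0 < s < 1 -> is_derive g s (f' s)).
  { intros s Hs. apply is_derive_Reals. intros eps He.
    set (d := Rmin (eps / (K + 1)) (Rmin s (1 - s))).
    assert (Hd : 0 < d).
    { unfold d. repeat apply Rmin_pos; try lra. apply Rdiv_lt_0_compat; lra. }
    exists (mkposreal d Hd). intros h Hh Hlt. simpl in Hlt.
    assert (d <= s /\ d <= 1 - s /\ d <= eps / (K + 1)) as (D1 & D2 & D3).
    { unfold d. repeat split.
      - eapply Rle_trans; [apply Rmin_r | apply Rmin_l].
      - eapply Rle_trans; [apply Rmin_r | apply Rmin_r].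
      - apply Rmin_l. }
    assert (- d < h < d) by (apply Rabs_lt_between; auto).
    unfold g. rewrite !clamp_id by lra.
    specialize (HQ s (s + h) ltac:(lra) ltac:(lra)).
    replace (s + h - s) with h in HQ by ring.
    replace ((f (s + h) - f s) / h - f' s) with ((f (s + h) - f s - f' s * h) * / h) by (field; auto).
    rewrite Rabs_mult. assert (0 < Rabs h) by (apply Rabs_pos_lt; auto).
    rewrite Rabs_inv. apply Rmult_lt_reg_r with (Rabs h); auto.
    rewrite Rmult_assoc, Rinv_l, Rmult_1_r by lra.
    apply Rle_lt_trans with (1 := HQ).
    replace (h * h) with (Rabs h * Rabs h) by (rewrite <- Rabs_mult, Rabs_right; nra).
    assert (K * Rabs h < eps); [| nra].
    apply Rle_lt_trans with (K * (eps / (K + 1))).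
    - apply Rmult_le_compat_l; lra.
    - apply Rmult_lt_reg_r with (K + 1); [lra |].
      replace (K * (eps / (K + 1)) * (K + 1)) with (K * eps) by (field; lra). nra. }
  assert (Cg : forall s, continuity_pt g s).
  { intros s. intros eps He.
    set (L := K + Rabs (f' (clamp s)) + 1).
    assert (HL : 0 < L) by (unfold L; generalize (Rabs_pos (f' (clamp s))); lra).
    exists (eps / L). split; [apply Rdiv_lt_0_compat; lra |].
    intros s' [_ Hs']. simpl in *. unfold R_dist in *. unfold g.
    assert (Q := HQ (clamp s) (clamp s') (clamp_bounds s) (clamp_bounds s')).
    assert (Cl := clamp_lipschitz s' s).
    set (u := clamp s' - clamp s) in *.
    assert (U1 : Rabs u <= 1).
    { unfold u. generalize (clamp_bounds s) (clamp_bounds s'). intros. apply Rabs_le_between. lra. }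
    replace (u * u) with (Rabs u * Rabs u) in Q by (rewrite <- Rabs_mult, Rabs_right; nra).
    assert (Rabs (f (clamp s') - f (clamp s)) <= L * Rabs u).
    { replace (f (clamp s') - f (clamp s)) with
        ((f (clamp s') - f (clamp s) - f' (clamp s) * u) + f' (clamp s) * u) by ring.
      eapply Rle_trans; [apply Rabs_triang |]. rewrite Rabs_mult. unfold L.
      assert (Pu := Rabs_pos u).
      assert (K * (Rabs u * Rabs u) <= K * Rabs u) by (apply Rmult_le_compat_l; nra).
      rewrite !Rmult_plus_distr_r. lra. }
    apply Rle_lt_trans with (1 := H). apply Rle_lt_trans with (L * Rabs (s' - s)); [nra |].
    apply Rmult_lt_compat_l with (r := L) in Hs'; auto.
    replace (L * (eps / L)) with eps in Hs' by (field; lra). exact Hs'. }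
  assert (pr : forall c, 0 < c < 1 -> derivable_pt g c).
  { intros c Hc. exists (f' c). apply is_derive_Reals, Dg, Hc. }
  destruct (MVT g id 0 1 pr (fun c _ => derivable_pt_id c)) as [c [Hc Ec]]; auto; try lra.
  { intros c _. apply derivable_continuous_pt, derivable_pt_id. }
  exists c. split; auto.
  rewrite derive_pt_id in Ec.
  rewrite (derive_pt_eq_0 g c (f' c)) in Ec by (apply is_derive_Reals, Dg, Hc).
  unfold id, g in Ec. rewrite !clamp_id in Ec by lra. lra.
Qed.

Lemma Re_Im_bound u : Rabs (Re u) <= Cmod u /\ Rabs (Im u) <= Cmod u.
Proof.
  assert (H := Rmax_Cmod u). split; (eapply Rle_trans; [| exact H]); [apply Rmax_l | apply Rmax_r].
Qed.

Lemma Cmod_le_Re_Im u : Cmod u <= Rabs (Re u) + Rabs (Im u).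
Proof.
  assert (H := Cmod_le_dist1 (RtoC 0) u). unfold dist1 in H.
  replace (Cminus u (RtoC 0)) with u in H by (apply injective_projections; simpl; ring).
  simpl in H. rewrite !Rminus_0_r in H. exact H.
Qed.

Lemma dist1_segment w w' s s' :
  dist1 (segment w w' s) (segment w w' s') = Rabs (s' - s) * dist1 w w'.
Proof.
  unfold dist1, segment, Re, Im. cbn [fst snd].
  rewrite Rmult_plus_distr_l, <- !Rabs_mult. f_equal; f_equal; ring.
Qed.

Lemma dist1_sym w w' : dist1 w w' = dist1 w' w.
Proof.
  unfold dist1. rewrite (Rabs_minus_sym (Re w)), (Rabs_minus_sym (Im w)). reflexivity.
Qed.

Lemma dist1_triangle u v w : dist1 u w <= dist1 u v + dist1 v w.
Proof.
  unfold dist1.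
  assert (H1 := Rabs_triang (Re v - Re u) (Re w - Re v)).
  assert (H2 := Rabs_triang (Im v - Im u) (Im w - Im v)).
  replace (Re v - Re u + (Re w - Re v)) with (Re w - Re u) in H1 by ring.
  replace (Im v - Im u + (Im w - Im v)) with (Im w - Im u) in H2 by ring. lra.
Qed.

Lemma dist1_eq_0 u v : dist1 u v = 0 -> u = v.
Proof.
  unfold dist1. intros E.
  assert (H1 := Rabs_pos (Re v - Re u)). assert (H2 := Rabs_pos (Im v - Im u)).
  assert (E1 : Rabs (Re v - Re u) = 0) by lra. assert (E2 : Rabs (Im v - Im u) = 0) by lra.
  apply injective_projections; [apply Rabs_eq_0 in E1 | apply Rabs_eq_0 in E2];
    unfold Re, Im in *; lra.
Qed.

Section Half_plane_map.
Context (z zd : C -> C) (K : R) (H : half_plane_map z zd K).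

Lemma hm_K_ge0 : 0 <= K.
Proof.
  destruct (hm_bounded _ _ _ H (RtoC 0) ltac:(simpl; lra)) as [B _].
  generalize (Rabs_pos (Re (z (RtoC 0)) - Re (RtoC 0))). lra.
Qed.

(** Complex functions have no mean value theorem, but the real part of [z * u] has one, and [u] can
    be adapted to the direction of interest. *)
Lemma hm_mean_value u w w' : Im w <= 0 -> Im w' <= 0 ->
  exists c, 0 < c < 1 /\
    Re (Cmult (Cminus (z w') (z w)) u) =
    Re (Cmult (Cmult (zd (segment w w' c)) (Cminus w' w)) u).
Proof.
  intros Hw Hw'. set (d := dist1 w w').
  assert (PK := hm_K_ge0).
  destruct (mvt_quadratic (fun s => Re (Cmult (z (segment w w' s)) u))
    (fun s => Re (Cmult (Cmult (zd (segment w w' s)) (Cminus w' w)) u))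
    (K * (d * d) * (Rabs (Re u) + Rabs (Im u)))) as [c [Hc Ec]].
  - intros s s' Hs Hs'.
    assert (I1 := segment_lower w w' s Hw Hw' Hs). assert (I2 := segment_lower w w' s' Hw Hw' Hs').
    destruct (hm_quad _ _ _ H _ _ I1 I2) as [Q1 Q2].
    rewrite dist1_segment in Q1, Q2. fold d in Q1, Q2.
    replace (Rabs (s' - s) * d * (Rabs (s' - s) * d)) with ((s' - s) * (s' - s) * (d * d)) in Q1, Q2.
    2: { replace ((s' - s) * (s' - s)) with (Rabs (s' - s) * Rabs (s' - s)); [ring | apply Rabs_mult_self]. }
    set (v := increment z (zd (segment w w' s)) (segment w w' s) (segment w w' s')) in *.
    replace (Re (Cmult (z (segment w w' s')) u) - Re (Cmult (z (segment w w' s)) u)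
      - Re (Cmult (Cmult (zd (segment w w' s)) (Cminus w' w)) u) * (s' - s))
      with (Re v * Re u - Im v * Im u).
    2: { unfold v, increment.
         replace (Cminus (segment w w' s') (segment w w' s))
           with (Cmult (RtoC (s' - s)) (Cminus w' w)).
         2: { unfold segment, Re, Im. apply injective_projections; simpl; ring. }
         unfold Cminus, Cplus, Cmult, Copp, RtoC, Re, Im. cbn [fst snd]. ring. }
    eapply Rle_trans; [apply Rabs_triang |]. rewrite Rabs_Ropp, !Rabs_mult.
    assert (0 <= (s' - s) * (s' - s)) by apply Rle_0_sqr. assert (0 <= d * d) by apply Rle_0_sqr.
    assert (U1 := Rabs_pos (Re u)). assert (U2 := Rabs_pos (Im u)).
    apply Rle_trans with (K * ((s' - s) * (s' - s) * (d * d)) * Rabs (Re u)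
       + K * ((s' - s) * (s' - s) * (d * d)) * Rabs (Im u)).
    + apply Rplus_le_compat; apply Rmult_le_compat_r; auto.
    + apply Req_le. ring.
  - exists c. split; auto. rewrite <- Ec, segment_0, segment_1.
    unfold Cminus, Cplus, Cmult, Copp, Re, Im. cbn [fst snd]. ring.
Qed.

Lemma segment_interior w w' c : Im w <= 0 -> Im w' <= 0 -> (Im w < 0 \/ Im w' < 0) ->
  0 < c < 1 -> Im (segment w w' c) < 0.
Proof.
  intros Hw Hw' D Hc. unfold segment, Im in *. cbn [fst snd]. destruct D; nra.
Qed.

(** The Noshiro-Warschawski argument: for [u] the conjugate of [w' - w], the mean value is
    [Re zd * |w' - w| ^ 2]. One interior end point suffices, since the open segment then lies in the
    open half-plane. *)
Lemma hm_injective_interior w w' : Im w <= 0 -> Im w' <= 0 -> (Im w < 0 \/ Im w' < 0) ->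
  z w = z w' -> w = w'.
Proof.
  intros Hw Hw' D E.
  set (u := Cconj (Cminus w' w)).
  destruct (hm_mean_value u w w' Hw Hw') as [c [Hc Ec]].
  assert (P := hm_pos _ _ _ H _ (segment_interior w w' c Hw Hw' D Hc)).
  rewrite E in Ec.
  assert (Ec' : Re (zd (segment w w' c)) *
     ((fst w' - fst w) * (fst w' - fst w) + (snd w' - snd w) * (snd w' - snd w)) = 0).
  { transitivity (Re (Cmult (Cmult (zd (segment w w' c)) (Cminus w' w)) u)).
    - unfold u, Cminus, Cplus, Cmult, Copp, Cconj, Re, Im. cbn [fst snd]. ring.
    - rewrite <- Ec. unfold Cminus, Cplus, Cmult, Copp, Re, Im. cbn [fst snd]. ring. }
  apply Rmult_integral in Ec'. destruct Ec' as [Ec' | Ec']; [lra |].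
  apply Rplus_sqr_eq_0 in Ec'. destruct Ec' as [A1 A2].
  apply injective_projections; lra.
Qed.

(** Two boundary points remain, and there [Re zd] may vanish. Along the boundary [x] is
    nondecreasing, so equal values make it constant in between; [y] has a critical point in between
    by Rolle, and [zd] would vanish there. *)
Lemma hm_injective w w' : Im w <= 0 -> Im w' <= 0 -> z w = z w' -> w = w'.
Proof.
  intros Hw Hw' E.
  destruct (Rlt_dec (Im w) 0) as [L | L]; [apply hm_injective_interior; auto |].
  destruct (Rlt_dec (Im w') 0) as [L' | L']; [apply hm_injective_interior; auto |].
  destruct w as [a b]. destruct w' as [a' b'].
  assert (b = 0) by (simpl in *; lra). assert (b' = 0) by (simpl in *; lra). subst b b'.
  assert (W : forall a a', a <= a' -> z (a, 0) = z (a', 0) -> a = a').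
  { clear - H. intros a a' Haa E.
    assert (L0 : forall x, Im (x, 0) <= 0) by (intros; simpl; lra).
    (* x is nondecreasing along the boundary, hence constant on [a, a'] *)
    assert (M : forall x y, x <= y -> Re (z (x, 0)) <= Re (z (y, 0))).
    { intros x y Hxy.
      destruct (hm_mean_value (RtoC 1) (x, 0) (y, 0) (L0 x) (L0 y)) as [c [Hc Ec]].
      assert (P := hm_nonneg _ _ _ H (segment (x, 0) (y, 0) c) (segment_lower _ _ c (L0 x) (L0 y) ltac:(lra))).
      unfold Cminus, Cplus, Cmult, Copp, RtoC, Re, Im in *. cbn [fst snd] in *. nra. }
    destruct (Req_dec a a') as [| N]; auto. exfalso.
    (* [(0, -1)] is [- i], so this is Rolle's theorem for [Im z]. *)
    destruct (hm_mean_value (0, -1) (a, 0) (a', 0) (L0 a) (L0 a')) as [c [Hc Ec]].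
    rewrite E in Ec.
    set (w := segment (a, 0) (a', 0) c) in *.
    assert (Lw : Im w <= 0) by (apply segment_lower; simpl; lra).
    assert (Y0 : Im (zd w) = 0).
    { unfold Cminus, Cplus, Cmult, Copp, RtoC, Re, Im in *. cbn [fst snd] in *.
      assert (snd (zd w) * (a' - a) = 0) by lra. apply Rmult_integral in H0. destruct H0; lra. }
    assert (Ew : w = (a + c * (a' - a), 0)).
    { unfold w, segment. apply injective_projections; simpl; ring. }
    set (x := a + c * (a' - a)) in *. assert (Hx : a < x < a') by (unfold x; nra).
    assert (X0 : Re (zd w) = 0).
    { destruct (hm_nonneg _ _ _ H w Lw) as [P |]; [| auto]. exfalso.
      set (l := Re (zd w)) in *.
      (* A step so short that a positive [l * e] exceeds the remainder [K * e ^ 2], although [x]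
         does not change before [a']. *)
      set (e := Rmin (a' - x) (l / (2 * (K + 1)))).
      assert (PK := hm_K_ge0).
      assert (He : 0 < e) by (apply Rmin_pos; [lra | apply Rdiv_lt_0_compat; lra]).
      assert (E1 : e <= a' - x) by apply Rmin_l.
      assert (E2 : e <= l / (2 * (K + 1))) by apply Rmin_r.
      assert (E3 : 2 * (K + 1) * e <= l).
      { apply Rmult_le_compat_l with (r := 2 * (K + 1)) in E2; [| lra].
        replace (2 * (K + 1) * (l / (2 * (K + 1)))) with l in E2 by (field; lra). exact E2. }
      destruct (hm_quad _ _ _ H w (x + e, 0) Lw (L0 _)) as [Q _].
      assert (C1 : Re (z (x + e, 0)) = Re (z w)).
      { rewrite Ew. apply Rle_antisym; [| apply M; lra].
        apply Rle_trans with (Re (z (a', 0))); [apply M; lra |].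
        rewrite <- E. apply M; lra. }
      assert (D : dist1 w (x + e, 0) = e).
      { rewrite Ew. unfold dist1, Re, Im. cbn [fst snd].
        rewrite Rminus_diag, Rabs_R0, Rabs_right; lra. }
      rewrite D in Q.
      assert (V : Re (increment z (zd w) w (x + e, 0)) = - (l * e)).
      { unfold increment, Cminus, Cplus, Cmult, Copp. unfold Re, Im in *. cbn [fst snd].
        rewrite C1. fold l. rewrite Ew. cbn [fst snd]. ring. }
      rewrite V, Rabs_Ropp, Rabs_right in Q by nra. nra. }
    apply (hm_regular _ _ _ H w Lw). apply injective_projections; auto. }
  f_equal. destruct (Rle_dec a a'); [apply W; auto |]. symmetry. apply W; auto. lra.
Qed.

Lemma hm_dist_le w w' : Im w <= 0 -> Im w' <= 0 -> dist1 (z w) (z w') <= 2 * K * dist1 w w'.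
Proof.
  intros Hw Hw'. destruct (hm_lip _ _ _ H w w' Hw Hw'). unfold dist1 at 1. lra.
Qed.

(** By compactness, the values taken away from [w0] keep a positive distance from a point [p] that
    they miss. Only a bounded set of [w] matters, as [z] stays at bounded distance from the
    identity. *)
Lemma hm_far p w0 delta : 0 < delta ->
  (forall w, Im w <= 0 -> delta / 2 <= dist1 w0 w -> z w <> p) ->
  exists eta, 0 < eta /\
  forall w, Im w <= 0 -> delta <= dist1 w0 w -> eta <= dist1 p (z w).
Proof.
  intros Hd Hp. assert (PK := hm_K_ge0).
  set (m := fun u v => dist1 p (z (u, v))).
  (* Each gauge ball excludes a bad [w]: above the axis it misses the half-plane, near [w0] it
     misses the points at distance [delta], elsewhere the Lipschitz bound keeps [z] off [p]. The
     final 1 is a default for a case that [Hp] rules out. *)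
  set (g := fun u v => if Rlt_dec 0 v then v / 2 else
     if Rlt_dec (dist1 w0 (u, v)) (delta / 2) then delta / 8 else
     if Rlt_dec 0 (m u v) then m u v / (8 * (K + 1)) else 1).
  assert (Pg : forall u v, 0 < g u v).
  { intros u v. unfold g. repeat destruct Rlt_dec; try lra. apply Rdiv_lt_0_compat; lra. }
  (* If [z w] is within 1 of [p], then [w] is within [R] of [w0], because
     [dist1 (z w) w <= 2 * K]. *)
  set (R := dist1 w0 p + 1 + 2 * K).
  destruct (compactness_value_2d (Re w0 - R) (Re w0 + R) (Im w0 - R) (Im w0 + R)
     (fun u v => mkposreal (g u v) (Pg u v))) as [[d Pd] Hc]. simpl in Hc.
  exists (Rmin 1 d). split; [apply Rmin_pos; lra |].
  intros w Hw Hdw. apply Rnot_lt_le. intros Hlt.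
  assert (L1 : dist1 p (z w) < 1) by (eapply Rlt_le_trans; [exact Hlt | apply Rmin_l]).
  assert (L2 : dist1 p (z w) < d) by (eapply Rlt_le_trans; [exact Hlt | apply Rmin_r]).
  assert (Bw : dist1 w0 w <= R).
  { destruct (hm_bounded _ _ _ H w Hw).
    assert (T1 := dist1_triangle w0 p w). assert (T2 := dist1_triangle p (z w) w).
    assert (dist1 (z w) w <= 2 * K) by (rewrite dist1_sym; unfold dist1; lra).
    unfold R. lra. }
  assert (Bx : Rabs (Re w - Re w0) <= R /\ Rabs (Im w - Im w0) <= R).
  { unfold dist1 in Bw. generalize (Rabs_pos (Re w - Re w0)) (Rabs_pos (Im w - Im w0)). lra. }
  destruct Bx as [Bx By]. apply Rabs_le_between in Bx. apply Rabs_le_between in By.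
  apply (Hc (Re w) (Im w)); try lra.
  intros (u & v & _ & _ & Hu & Hv & Hd').
  assert (Duv : dist1 (u, v) w < 2 * g u v) by (unfold dist1; simpl; lra).
  apply Rabs_lt_between in Hv.
  assert (T := dist1_triangle w0 (u, v) w).
  unfold g in *. destruct (Rlt_dec 0 v) as [Lv | Lv].
  { lra. }
  destruct (Rlt_dec (dist1 w0 (u, v)) (delta / 2)) as [Ln | Ln]; [lra |].
  destruct (Rlt_dec 0 (m u v)) as [Lm | Lm].
  - assert (D := hm_dist_le (u, v) w ltac:(simpl; lra) Hw).
    assert (T2 := dist1_triangle p (z w) (z (u, v))). fold (m u v) in T2.
    rewrite (dist1_sym (z w)) in T2.
    assert (E : m u v = 8 * (K + 1) * (m u v / (8 * (K + 1)))) by (field; lra).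
    set (q := m u v / (8 * (K + 1))) in *.
    assert (0 < q) by (apply Rdiv_lt_0_compat; lra).
    assert (2 * K * dist1 (u, v) w <= 2 * K * (2 * q)) by (apply Rmult_le_compat_l; lra).
    nra.
  - assert (M0 : 0 <= m u v) by apply dist1_Cmod.
    apply (Hp (u, v)); [simpl; lra | lra |].
    symmetry. apply dist1_eq_0. fold (m u v). lra.
Qed.

Lemma Cmod_pos u : u <> RtoC 0 -> 0 < Cmod u.
Proof. intros Hu. apply Cmod_gt_0. exact Hu. Qed.

Lemma hm_increment_dist w w' : Im w <= 0 -> Im w' <= 0 ->
  Cmod (increment z (zd w) w w') <= 2 * K * (dist1 w w' * dist1 w w').
Proof.
  intros Hw Hw'. destruct (hm_quad _ _ _ H w w' Hw Hw').
  eapply Rle_trans; [apply Cmod_le_Re_Im |]. lra.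
Qed.

(** [hm_far] first forces [w] close to [w0]; there the linear part, of size [Cmod (zd w0)],
    dominates the quadratic remainder. *)
Lemma hm_inverse_lipschitz w0 : Im w0 <= 0 -> exists C eta, 0 < C /\ 0 < eta /\
  forall w, Im w <= 0 -> dist1 (z w0) (z w) < eta -> dist1 w0 w <= C * dist1 (z w0) (z w).
Proof.
  intros H0. assert (PK := hm_K_ge0).
  set (l := zd w0). assert (Pl : 0 < Cmod l) by (apply Cmod_pos, (hm_regular _ _ _ H); auto).
  set (delta := Cmod l / (8 * (K + 1))).
  assert (Pd : 0 < delta) by (apply Rdiv_lt_0_compat; lra).
  destruct (hm_far (z w0) w0 delta Pd) as [eta [Pe He]].
  { intros w Hw Hd E. rewrite (hm_injective w w0 Hw H0 E) in Hd.
    unfold dist1 in Hd. rewrite !Rminus_diag, Rabs_R0 in Hd. lra. }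
  exists (4 / Cmod l), eta. repeat split; auto; [apply Rdiv_lt_0_compat; lra |].
  intros w Hw Hlt.
  destruct (Rlt_dec (dist1 w0 w) delta) as [L | L].
  2: { exfalso. apply (Rlt_not_le _ _ Hlt), He; auto. lra. }
  assert (Q := hm_increment_dist w0 w H0 Hw). fold l in Q.
  set (d := dist1 w0 w) in *.
  assert (D0 : 0 <= d) by apply dist1_Cmod.
  assert (M : Cmod (Cmult l (Cminus w w0)) <= Cmod (Cminus (z w) (z w0)) + 2 * K * (d * d)).
  { replace (Cmult l (Cminus w w0)) with (Cplus (Cminus (z w) (z w0)) (Copp (increment z l w0 w))).
    2: { unfold increment, Cminus. apply injective_projections; simpl; ring. }
    eapply Rle_trans; [apply Cmod_triangle |]. rewrite Cmod_opp. lra. }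
  rewrite Cmod_mult in M.
  assert (M1 := Cmod_le_dist1 (z w0) (z w)). assert (M2 := proj2 (dist1_Cmod w0 w)).
  fold d in M2.
  assert (E : Cmod l = 8 * (K + 1) * delta) by (unfold delta; field; lra).
  assert (2 * K * (d * d) <= Cmod l * d / 4).
  { assert (d * d <= delta * d) by (apply Rmult_le_compat_r; lra).
    assert (K * (d * d) <= K * (delta * d)) by (apply Rmult_le_compat_l; auto).
    assert (0 <= delta * d) by (apply Rmult_le_pos; lra).
    rewrite E. lra. }
  assert (F : Cmod l * d / 2 <= Cmod l * Cmod (Cminus w w0)).
  { unfold Rdiv. rewrite Rmult_assoc. apply Rmult_le_compat_l; lra. }
  assert (G : Cmod l * d <= 4 * dist1 (z w0) (z w)) by lra.
  apply Rmult_le_reg_l with (Cmod l); auto.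
  replace (Cmod l * (4 / Cmod l * dist1 (z w0) (z w))) with (4 * dist1 (z w0) (z w)) by (field; lra).
  exact G.
Qed.

(** Newton's iteration with frozen derivative. *)
Lemma hm_open w0 : Im w0 < 0 -> exists eps, 0 < eps /\
  forall q, dist1 (z w0) q < eps -> exists w, Im w < 0 /\ z w = q.
Proof.
  intros H0. assert (PK := hm_K_ge0).
  set (l := zd w0). assert (Pl : 0 < Cmod l) by (apply Cmod_pos, (hm_regular _ _ _ H); lra).
  (* The first bound keeps the box around [w0] inside the half-plane, the second makes the iteration
     contract by 1/4. *)
  set (eta := Rmin (- Im w0 / 2) (Cmod l / (100 * (K + 1)))).
  assert (Pe : 0 < eta) by (apply Rmin_pos; [lra | apply Rdiv_lt_0_compat; lra]).
  assert (E1 : eta <= - Im w0 / 2) by apply Rmin_l.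
  assert (E2 : 100 * (K + 1) * eta <= Cmod l).
  { assert (E : eta <= Cmod l / (100 * (K + 1))) by apply Rmin_r.
    apply Rmult_le_compat_l with (r := 100 * (K + 1)) in E; [| lra].
    replace (100 * (K + 1) * (Cmod l / (100 * (K + 1)))) with (Cmod l) in E by (field; lra). exact E. }
  exists (eta * Cmod l / 4). split; [apply Rmult_lt_0_compat; [apply Rmult_lt_0_compat |]; lra |]. intros q Hq.
  assert (Nl : l <> RtoC 0) by (apply (hm_regular _ _ _ H); lra).
  (* Points are recoded as families over [bool] for [contraction_fixed_point]. *)
  set (of := fun x : bool -> R => (x true, x false) : C).
  set (to := fun (w : C) (i : bool) => if i then Re w else Im w).
  set (T := fun w => Cminus w (Cdiv (Cminus (z w) q) l)).
  set (adm := fun x : bool -> R => Rabs (x true - Re w0) <= eta /\ Rabs (x false - Im w0) <= eta).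
  set (cl := fun (x y : bool -> R) M => dist1 (of x) (of y) <= M).
  assert (Adm : forall x, adm x -> Im (of x) < 0 /\ dist1 w0 (of x) <= 2 * eta).
  { intros x [A1 A2]. split; [| unfold dist1; simpl; lra].
    apply Rabs_le_between in A2. simpl. lra. }
  assert (CT : forall x y, adm x -> adm y ->
     dist1 (T (of x)) (T (of y)) <= / 4 * dist1 (of x) (of y)).
  { intros x y Ax Ay. destruct (Adm x Ax) as [X1 X2]. destruct (Adm y Ay) as [Y1 Y2].
    set (w := of x) in *. set (w' := of y) in *. set (d := dist1 w w').
    assert (D0 : 0 <= d) by apply dist1_Cmod.
    assert (D1 : d <= 4 * eta).
    { unfold d. assert (T1 := dist1_triangle w w0 w'). rewrite (dist1_sym w w0) in T1. lra. }
    assert (Q := hm_increment_dist w w' ltac:(lra) ltac:(lra)). fold d in Q.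
    destruct (hm_lip_d _ _ _ H w0 w ltac:(lra) ltac:(lra)) as [L1 L2].
    assert (L : Cmod (Cminus (zd w) l) <= 4 * K * eta).
    { eapply Rle_trans; [apply Cmod_le_Re_Im |].
      unfold l. unfold Cminus, Cplus, Copp, Re, Im in *. cbn [fst snd].
      fold (snd (zd w) - snd (zd w0)). fold (fst (zd w) - fst (zd w0)).
      assert (K * dist1 w0 w <= K * (2 * eta)) by (apply Rmult_le_compat_l; auto).
      unfold Rminus in *. lra. }
    assert (E : Cminus (T w') (T w) =
      Copp (Cdiv (Cplus (increment z (zd w) w w') (Cmult (Cminus (zd w) l) (Cminus w' w))) l)).
    { unfold T, increment. field. exact Nl. }
    assert (N : Cmod (Cminus (T w') (T w)) <= / 8 * d).
    { rewrite E, Cmod_opp, Cmod_div by exact Nl.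
      apply Rmult_le_reg_r with (Cmod l); auto. unfold Rdiv. rewrite Rmult_assoc, Rinv_l, Rmult_1_r by lra.
      eapply Rle_trans; [apply Cmod_triangle |]. rewrite Cmod_mult.
      assert (M1 := Cmod_le_dist1 w w'). fold d in M1. assert (M2 := Cmod_ge_0 (Cminus w' w)).
      assert (Cmod (Cminus (zd w) l) * Cmod (Cminus w' w) <= 4 * K * eta * d).
      { apply Rmult_le_compat; auto. apply Cmod_ge_0. }
      assert (2 * K * (d * d) <= 2 * K * (4 * eta * d)).
      { apply Rmult_le_compat_l; [lra |]. apply Rmult_le_compat_r; lra. }
      assert (100 * (K + 1) * eta * d <= Cmod l * d) by (apply Rmult_le_compat_r; auto).
      assert (0 <= K * eta * d) by (apply Rmult_le_pos; [apply Rmult_le_pos; lra | auto]).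
      assert (0 <= eta * d) by (apply Rmult_le_pos; lra).
      lra. }
    assert (M3 := proj2 (dist1_Cmod (T w) (T w'))). lra. }
  assert (A0 : adm (to w0)).
  { split; simpl; rewrite Rminus_diag, Rabs_R0; lra. }
  assert (Eof : forall w, of (to w) = w) by (intros [a b]; reflexivity).
  assert (Dist0 : dist1 w0 (T w0) <= eta / 2).
  { eapply Rle_trans; [apply dist1_Cmod |].
    replace (Cminus (T w0) w0) with (Copp (Cdiv (Cminus (z w0) q) l)) by (unfold T; field; exact Nl).
    rewrite Cmod_opp, Cmod_div by exact Nl.
    assert (M1 := Cmod_le_dist1 q (z w0)). rewrite dist1_sym in M1.
    assert (Cmod (Cminus (z w0) q) / Cmod l <= eta / 4); [| lra].
    apply Rmult_le_reg_r with (Cmod l); auto. unfold Rdiv at 1. rewrite Rmult_assoc, Rinv_l by lra. lra. }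
  destruct (contraction_fixed_point bool cl adm (fun x => to (T (of x))) (/ 4) 1 eta (to w0))
    as [x [Ax Ex]]; unfold cl.
  - lra.
  - intros x. unfold dist1. rewrite !Rminus_diag, Rabs_R0. lra.
  - intros x y M. rewrite dist1_sym. auto.
  - intros x y w M N HM HN. assert (T1 := dist1_triangle (of x) (of y) (of w)). lra.
  - intros x y M N HM HN. lra.
  - intros x y M [|] HM; unfold dist1 in HM; simpl in HM; rewrite Rabs_minus_sym;
      generalize (Rabs_pos (y true - x true)) (Rabs_pos (y false - x false)); lra.
  - intros x lx y M HM HL.
    assert (L : is_lim_seq (fun j => dist1 (of (x j)) (of y)) (dist1 (of lx) (of y))).
    { unfold dist1. simpl. apply is_lim_seq_plus'.
      - apply (is_lim_seq_abs _ (y true - lx true)), is_lim_seq_minus'; auto using is_lim_seq_const.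
      - apply (is_lim_seq_abs _ (y false - lx false)), is_lim_seq_minus'; auto using is_lim_seq_const. }
    apply (is_lim_seq_le _ (fun _ => M) _ M HM L), is_lim_seq_const.
  - intros x lx HA HL. split.
    + apply (is_lim_seq_le (fun j => Rabs (x j true - Re w0)) (fun _ => eta) (Rabs (lx true - Re w0)) eta).
      * intros j; apply (HA j).
      * apply (is_lim_seq_abs _ (lx true - Re w0)), is_lim_seq_minus'; auto using is_lim_seq_const.
      * apply is_lim_seq_const.
    + apply (is_lim_seq_le (fun j => Rabs (x j false - Im w0)) (fun _ => eta) (Rabs (lx false - Im w0)) eta).
      * intros j; apply (HA j).
      * apply (is_lim_seq_abs _ (lx false - Im w0)), is_lim_seq_minus'; auto using is_lim_seq_const.
      * apply is_lim_seq_const.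
  - exact A0.
  - intros x Ax.
    assert (CT' := CT (to w0) x A0 Ax). rewrite Eof in CT'.
    destruct (Adm x Ax) as [_ X2].
    assert (T1 := dist1_triangle w0 (T w0) (T (of x))).
    assert (D : dist1 w0 (T (of x)) <= eta) by lra.
    unfold dist1 in D.
    change (Rabs (Re (T (of x)) - Re w0) <= eta /\ Rabs (Im (T (of x)) - Im w0) <= eta).
    generalize (Rabs_pos (Re (T (of x)) - Re w0)) (Rabs_pos (Im (T (of x)) - Im w0)). lra.
  - intros x y M Ax Ay HM. rewrite !Eof. assert (CT' := CT x y Ax Ay). lra.
  - lra.
  - lra.
  - rewrite !Eof. rewrite dist1_sym. lra.
  - exists (of x). destruct (Adm x Ax) as [X1 _]. split; auto.
    assert (F : T (of x) = of x).
    { apply injective_projections; [apply (Ex true) | apply (Ex false)]. }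
    unfold T in F.
    assert (G : z (of x) = Cplus q (Cmult l (Cminus (of x) (Cminus (of x) (Cdiv (Cminus (z (of x)) q) l)))))
      by (field; exact Nl).
    rewrite F in G. rewrite G. apply injective_projections; simpl; ring.
Qed.

End Half_plane_map.

(** * Interface with the filter-based notions *)

Lemma ball_dist1 (p q : R * R) (e : R) (He : 0 < e) : 
  dist1 p q < e -> ball p (mkposreal e He) q.
Proof.
  intros D. unfold dist1, Re, Im in D.
  generalize (Rabs_pos (fst q - fst p)) (Rabs_pos (snd q - snd p)). intros.
  split; unfold ball; simpl; unfold AbsRing_ball, abs, minus, plus, opp; simpl; unfold Rminus in *; lra.
Qed.

Lemma dist1_ball (p q : R * R) (e : posreal) : ball p e q -> dist1 p q < 2 * e.
Proof.
  intros [B1 B2]. unfold ball in B1, B2. simpl in B1, B2.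
  unfold AbsRing_ball, abs, minus, plus, opp in *. simpl in *.
  unfold dist1, Re, Im, Rminus. lra.
Qed.

Lemma locally_dist1 (p : R * R) (P : R * R -> Prop) :
  locally p P <-> exists e, 0 < e /\ forall q, dist1 p q < e -> P q.
Proof.
  split.
  - intros [e He]. exists e. split; [apply cond_pos |]. intros q Hq. apply He.
    destruct e as [e Pe]. apply ball_dist1, Hq.
  - intros (e & Pe & He). assert (P2 : 0 < e / 2) by lra. exists (mkposreal _ P2).
    intros q Hq. apply He. apply dist1_ball in Hq. simpl in Hq. lra.
Qed.

Lemma prod_norm_bounds (v : R * R) :
  Rabs (fst v) <= @norm R_AbsRing (prod_NormedModule R_AbsRing R_NormedModule R_NormedModule) v /\
  Rabs (snd v) <= @norm R_AbsRing (prod_NormedModule R_AbsRing R_NormedModule R_NormedModule) v.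
Proof.
  change (Rabs (fst v) <= sqrt (Rabs (fst v) ^ 2 + Rabs (snd v) ^ 2) /\
          Rabs (snd v) <= sqrt (Rabs (fst v) ^ 2 + Rabs (snd v) ^ 2)).
  assert (H1 := Rabs_pos (fst v)). assert (H2 := Rabs_pos (snd v)).
  assert (S1 := pow2_ge_0 (Rabs (fst v))). assert (S2 := pow2_ge_0 (Rabs (snd v))).
  split.
  - rewrite <- (sqrt_pow2 (Rabs (fst v)) H1) at 1. apply sqrt_le_1_alt. lra.
  - rewrite <- (sqrt_pow2 (Rabs (snd v)) H2) at 1. apply sqrt_le_1_alt. lra.
Qed.

Lemma filterdiff_of_eps (E : R * R -> Prop) (f : R * R -> R) (p : R * R) (a b : R) :
  E p ->
  (forall eps, 0 < eps -> exists d, 0 < d /\ forall q, E q -> dist1 p q < d ->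
     Rabs (f q - f p - (a * (fst q - fst p) + b * (snd q - snd p))) <= eps * dist1 p q) ->
  @filterdiff R_AbsRing (prod_NormedModule R_AbsRing R_NormedModule R_NormedModule)
      R_NormedModule f (within E (locally p)) (fun v : R * R => a * fst v + b * snd v).
Proof.
  intros Ep Hf. split.
  - split.
    + intros [x1 x2] [y1 y2]. unfold plus. simpl. unfold plus. simpl. ring.
    + intros k [x1 x2]. unfold scal. simpl. unfold scal. simpl. unfold mult. simpl. ring.
    + exists (Rabs a + Rabs b + 1).
      generalize (Rabs_pos a) (Rabs_pos b). intros PA PB. split; [lra |].
      intros x. destruct (prod_norm_bounds x) as [B1 B2].
      change (Rabs (a * @fst R R x + b * @snd R R x) <= (Rabs a + Rabs b + 1) *
        @norm R_AbsRing (prod_NormedModule R_AbsRing R_NormedModule R_NormedModule) x).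
      set (n := @norm R_AbsRing (prod_NormedModule R_AbsRing R_NormedModule R_NormedModule) x) in *.
      eapply Rle_trans; [apply Rabs_triang |]. rewrite !Rabs_mult.
      assert (0 <= n) by (eapply Rle_trans; [apply Rabs_pos | exact B1]). nra.
  - intros x Hx.
    (* The filter has no limit other than [p], because [p] itself belongs to [E]. *)
    assert (Ex : x = p).
    { symmetry. apply dist1_eq_0. apply Rle_antisym; [| apply dist1_Cmod].
      apply Rnot_lt_le. intros L.
      assert (W : within E (locally p) (fun q => dist1 x q < dist1 p x)).
      { apply Hx. apply locally_dist1. exists (dist1 p x). split; auto. }
      apply locally_dist1 in W. destruct W as (e & Pe & He).
      assert (D : dist1 p p < e) by (unfold dist1; rewrite !Rminus_diag, Rabs_R0; lra).
      specialize (He p D Ep). rewrite dist1_sym in He. lra. }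
    subst x. intros [eps Pe].
    destruct (Hf (eps / 2) ltac:(lra)) as (d & Pd & Hd).
    apply locally_dist1. exists d. split; auto. intros q Hq Eq.
    specialize (Hd q Eq Hq).
    change (Rabs (f q - f p - (a * (fst q - fst p) + b * (snd q - snd p))) <=
       eps * @norm R_AbsRing (prod_NormedModule R_AbsRing R_NormedModule R_NormedModule)
         (fst q - fst p, snd q - snd p)).
    destruct (prod_norm_bounds (fst q - fst p, snd q - snd p)) as [B1 B2].
    simpl fst in *; simpl snd in *. set (n := norm _) in *.
    eapply Rle_trans; [exact Hd |]. unfold dist1, Re, Im. nra.
Qed.

Lemma continuous_on_of_eps (E : R * R -> Prop) (g : R * R -> R * R) :
  (forall p, E p -> forall eps, 0 < eps -> exists d, 0 < d /\
     forall q, E q -> dist1 p q < d -> dist1 (g p) (g q) < eps) ->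
  continuous_on E g.
Proof.
  intros Hg p Ep P HP. apply locally_dist1 in HP. destruct HP as (e & Pe & He).
  destruct (Hg p Ep e Pe) as (d & Pd & Hd).
  apply locally_dist1. exists d. split; auto.
Qed.

Lemma is_derive_of_eps (f : C -> C) (w l : C) :
  (forall eps, 0 < eps -> exists d, 0 < d /\ forall w', Cmod (Cminus w' w) < d ->
     Cmod (increment f l w w') <= eps * Cmod (Cminus w' w)) ->
  @is_derive C_AbsRing C_NormedModule f w l.
Proof.
  intros Hf. split.
  - apply is_linear_scal_l.
  - intros x Hx.
    assert (Ex : w = x).
    { apply (@is_filter_lim_locally_unique C_AbsRing (AbsRing_NormedModule C_AbsRing)). exact Hx. }
    subst x.
    intros [eps Pe]. destruct (Hf eps Pe) as (d & Pd & Hd).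
    exists (mkposreal d Pd). intros w' Hw'.
    specialize (Hd w' Hw'). 
    unfold increment in Hd. rewrite (Cmult_comm l) in Hd. exact Hd.
Qed.

(** * The image domain and its inverse parametrization *)

Section Domain.
Context (z zd : C -> C) (K : R) (H : half_plane_map z zd K).

Definition image_domain (p : R * R) : Prop := exists w, Im w < 0 /\ z w = p.
Definition image_closed (p : R * R) : Prop := exists w, Im w <= 0 /\ z w = p.

Lemma image_closed_iff p : image_closed p <-> image_domain p \/ free_surface z p.
Proof.
  split.
  - intros [w [Hw E]]. destruct (Rlt_dec (Im w) 0) as [L | L].
    + left. exists w. auto.
    + right. exists (Re w). rewrite <- E. f_equal. apply injective_projections; simpl; auto.
      unfold Im in *. lra.
  - intros [[w [Hw E]] | [a E]].
    + exists w. split; auto. lra.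
    + exists (a, 0). split; auto. simpl. lra.
Qed.

Lemma image_domain_open : open image_domain.
Proof.
  intros p [w [Hw E]]. apply locally_dist1. subst p.
  destruct (hm_open z zd K H w Hw) as (e & Pe & He). exists e. split; auto.
Qed.

(** Along the image of a segment, a separation would yield a continuous function taking only the
    values -1 and 1. *)
Lemma image_domain_connected : connected image_domain.
Proof.
  intros U V OU OV Cov [p1 [[w1 [H1 E1]] U1]] [p2 [[w2 [H2 E2]] V2]].
  apply NNPP. intros N.
  assert (PK := hm_K_ge0 z zd K H).
  set (ga := fun s => z (segment w1 w2 (clamp s))).
  assert (Lw : forall s, Im (segment w1 w2 (clamp s)) < 0).
  { intros s. assert (B := clamp_bounds s). unfold segment, Im in *. simpl. nra. }
  assert (Dom : forall s, image_domain (ga s)).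
  { intros s. exists (segment w1 w2 (clamp s)). auto. }
  assert (Ga : forall s s', dist1 (ga s) (ga s') <= 2 * K * (Rabs (s' - s) * dist1 w1 w2)).
  { intros s s'. eapply Rle_trans.
    - apply (hm_dist_le z zd K H); left; apply Lw.
    - apply Rmult_le_compat_l; [lra |]. rewrite dist1_segment.
      apply Rmult_le_compat_r; [apply dist1_Cmod | apply clamp_lipschitz]. }
  set (f := fun s => if excluded_middle_informative (U (ga s)) then -1 else 1).
  assert (Loc : forall s, exists d, 0 < d /\ forall s', Rabs (s' - s) < d -> f s' = f s).
  { intros s.
    assert (G : forall W : R * R -> Prop, open W -> W (ga s) ->
       exists d, 0 < d /\ forall s', Rabs (s' - s) < d -> W (ga s')).
    { intros W OW Ws. specialize (OW _ Ws). apply locally_dist1 in OW.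
      destruct OW as (e & Pe & He).
      assert (D0 := proj1 (dist1_Cmod w1 w2)).
      assert (PL : 0 <= 2 * K * dist1 w1 w2) by (apply Rmult_le_pos; lra).
      exists (e / (2 * K * dist1 w1 w2 + 1)). split; [apply Rdiv_lt_0_compat; lra |].
      intros s' Hs'. apply He. eapply Rle_lt_trans; [apply Ga |].
      apply Rmult_lt_compat_r with (r := 2 * K * dist1 w1 w2 + 1) in Hs'; [| lra].
      replace (e / (2 * K * dist1 w1 w2 + 1) * (2 * K * dist1 w1 w2 + 1)) with e in Hs' by (field; lra).
      generalize (Rabs_pos (s' - s)). intros. lra. }
    unfold f. destruct (excluded_middle_informative (U (ga s))) as [Us | Us].
    - destruct (G U OU Us) as (d & Pd & Hd). exists d. split; auto. intros s' Hs'.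
      destruct (excluded_middle_informative (U (ga s'))) as [| C]; auto. elim C. auto.
    - destruct (Cov _ (Dom s)) as [| Vs]; [contradiction |].
      destruct (G V OV Vs) as (d & Pd & Hd). exists d. split; auto. intros s' Hs'.
      destruct (excluded_middle_informative (U (ga s'))) as [C |]; auto.
      elim N. exists (ga s'). auto. }
  assert (Cf : continuity f).
  { intros s eps He. destruct (Loc s) as (d & Pd & Hd). exists d. split; auto.
    intros s' [_ Hs']. simpl in *. unfold R_dist in *. rewrite (Hd s' Hs'), Rminus_diag, Rabs_R0. exact He. }
  assert (F0 : f 0 = -1).
  { unfold f, ga. rewrite clamp_id, segment_0, E1 by lra.
    destruct (excluded_middle_informative (U p1)); [reflexivity | contradiction]. }
  assert (F1 : f 1 = 1).
  { unfold f, ga. rewrite clamp_id, segment_1, E2 by lra.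
    destruct (excluded_middle_informative (U p2)); [| reflexivity].
    elim N. exists p2. repeat split; auto. exists w2. auto. }
  destruct (IVT f 0 1 Cf ltac:(lra) ltac:(lra) ltac:(lra)) as [s [_ Es]].
  unfold f in Es. destruct (excluded_middle_informative (U (ga s))); lra.
Qed.

Lemma image_domain_near a eps : 0 < eps -> exists q, image_domain q /\ dist1 (z (a, 0)) q < eps.
Proof.
  intros He. assert (PK := hm_K_ge0 z zd K H).
  set (s := eps / (2 * K + 1) / 2).
  assert (Hs : 0 < s) by (unfold s; apply Rdiv_lt_0_compat; [apply Rdiv_lt_0_compat |]; lra).
  exists (z (a, - s)). split.
  - exists (a, - s). split; auto. simpl. lra.
  - eapply Rle_lt_trans; [apply (hm_dist_le z zd K H); simpl; lra |].
    unfold dist1. simpl. rewrite Rminus_diag, Rabs_R0, Rplus_0_l, Rminus_0_r, Rabs_Ropp, Rabs_right by lra.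
    assert (E : (2 * K + 1) * s = eps / 2) by (unfold s; field; lra). nra.
Qed.

Lemma image_domain_frontier p : frontier image_domain p <-> free_surface z p.
Proof.
  split.
  - intros [F1 F2].
    destruct (classic (image_closed p)) as [I | I].
    + apply image_closed_iff in I. destruct I as [I |]; auto.
      elim F1. apply image_domain_open, I.
    + exfalso. apply F2.
      (* The point [(0, 1)] is at distance at least 1 from the whole half-plane, so [hm_far] covers
         every [w]. *)
      destruct (hm_far z zd K H p (0, 1) 1 ltac:(lra)) as (eta & Pe & He).
      * intros w Hw _ E. apply I. exists w. auto.
      * apply locally_dist1. exists eta. split; auto. intros q Hq [w [Hw E]]. subst q.
        apply (Rlt_not_le _ _ Hq). apply He; [lra |].
        unfold dist1. simpl. generalize (Rabs_pos (Re w - 0)) (Rle_abs (- (Im w - 1))).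
        rewrite Rabs_Ropp. lra.
  - intros [a E]. subst p. split; intros L; apply locally_dist1 in L; destruct L as (e & Pe & He).
    + destruct (He (z (a, 0))) as [w [Hw E]].
      { unfold dist1. rewrite !Rminus_diag, Rabs_R0. lra. }
      assert (E' := hm_injective z zd K H w (a, 0) ltac:(lra) ltac:(simpl; lra) E).
      subst w. simpl in Hw. lra.
    + destruct (image_domain_near a e Pe) as (q & Dq & Hq). apply (He q Hq Dq).
Qed.

Lemma image_fluid_domain : fluid_domain image_domain (free_surface z).
Proof.
  split.
  - split; [apply image_domain_open | split; [| apply image_domain_connected]].
    exists (z (0, -1)). exists (0, -1). split; auto. simpl. lra.
  - intros M. set (b := Rmin (-1) (M - K - 1)).
    assert (b <= -1) by apply Rmin_l. assert (b <= M - K - 1) by apply Rmin_r.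
    exists (z (0, b)). split.
    + exists (0, b). split; auto. simpl. lra.
    + destruct (hm_bounded _ _ _ H (0, b) ltac:(simpl; lra)) as [_ B].
      apply Rabs_le_between in B. unfold Im in B. simpl in B. lra.
  - apply image_domain_frontier.
Qed.

Definition inverse (p : R * R) : C :=
  epsilon (inhabits (RtoC 0)) (fun w => Im w <= 0 /\ z w = p).

Lemma inverse_spec p : image_closed p -> Im (inverse p) <= 0 /\ z (inverse p) = p.
Proof. apply (epsilon_spec (inhabits (RtoC 0)) (fun w => Im w <= 0 /\ z w = p)). Qed.

Lemma inverse_z w : Im w <= 0 -> inverse (z w) = w.
Proof.
  intros Hw. destruct (inverse_spec (z w)) as [I1 I2]; [exists w; auto |].
  apply (hm_injective z zd K H); auto.
Qed.

(** The real differential is encoded by a complex number [l], with gradient [(Re l, - Im l)]. The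
    chain rule for a conformal map is then multiplication by its derivative. *)
Definition rdiff (f : C -> R) (l w : C) : Prop :=
  forall eps, 0 < eps -> exists d, 0 < d /\ forall w', Im w' <= 0 -> dist1 w w' < d ->
    Rabs (f w' - f w - Re (Cmult l (Cminus w' w))) <= eps * dist1 w w'.

Definition continuous_at_closed (f : C -> C) (w : C) : Prop :=
  forall eps, 0 < eps -> exists d, 0 < d /\ forall w', Im w' <= 0 -> dist1 w w' < d ->
    dist1 (f w) (f w') < eps.

(** The difference [q - p] is [zd (w' - w)] up to a remainder quadratic in [w' - w], and
    [hm_inverse_lipschitz] makes that small compared with [q - p]. The argument works at surface
    points as well, relative to [E]. *)
Lemma inverse_filterdiff (E : R * R -> Prop) f l p : image_closed p -> E p ->
  (forall q, E q -> image_closed q) -> rdiff f l (inverse p) ->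
  @filterdiff R_AbsRing (prod_NormedModule R_AbsRing R_NormedModule R_NormedModule)
      R_NormedModule (fun q => f (inverse q)) (within E (locally p))
      (fun v : R * R => Re (Cdiv l (zd (inverse p))) * fst v
                        + - Im (Cdiv l (zd (inverse p))) * snd v).
Proof.
  intros Ip Ep HE Hf. assert (PK := hm_K_ge0 z zd K H).
  destruct (inverse_spec p Ip) as [W1 W2]. set (w := inverse p) in *.
  assert (Nz := hm_regular _ _ _ H w W1).
  set (mu := Cdiv l (zd w)).
  apply filterdiff_of_eps; auto.
  intros eps He.
  destruct (hm_inverse_lipschitz z zd K H w W1) as (c & eta & Pc & Pe & HL).
  set (m := Cmod mu). assert (Pm : 0 <= m) by apply Cmod_ge_0.
  (* [c] converts distances in the half-plane into distances in the image, and two errors share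
     [eps]. *)
  set (e1 := eps / c / 2).
  assert (Pe1 : 0 < e1) by (unfold e1; apply Rdiv_lt_0_compat; [apply Rdiv_lt_0_compat |]; lra).
  destruct (Hf e1 Pe1) as (d & Pd & Hd).
  assert (PmK : 0 <= m * K) by (apply Rmult_le_pos; auto).
  set (d2 := e1 / (2 * (m * K) + 1)).
  assert (Pd2 : 0 < d2) by (apply Rdiv_lt_0_compat; lra).
  exists (Rmin eta (Rmin (d / c) (d2 / c))). split.
  { repeat apply Rmin_pos; auto; apply Rdiv_lt_0_compat; auto. }
  intros q Eq Hq.
  assert (Q1 : dist1 p q < eta) by (eapply Rlt_le_trans; [exact Hq | apply Rmin_l]).
  assert (Q2 : dist1 p q < d / c)
    by (eapply Rlt_le_trans; [exact Hq | eapply Rle_trans; [apply Rmin_r | apply Rmin_l]]).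
  assert (Q3 : dist1 p q < d2 / c)
    by (eapply Rlt_le_trans; [exact Hq | eapply Rle_trans; [apply Rmin_r | apply Rmin_r]]).
  destruct (inverse_spec q (HE q Eq)) as [X1 X2]. set (w' := inverse q) in *.
  assert (L : dist1 w w' <= c * dist1 p q).
  { rewrite <- X2, <- W2. apply HL; auto. rewrite W2, X2. exact Q1. }
  assert (M1 : c * dist1 p q < d).
  { apply Rmult_lt_compat_l with (r := c) in Q2; auto. replace (c * (d / c)) with d in Q2 by (field; lra). exact Q2. }
  assert (M2 : c * dist1 p q < d2).
  { apply Rmult_lt_compat_l with (r := c) in Q3; auto. replace (c * (d2 / c)) with d2 in Q3 by (field; lra). exact Q3. }
  assert (A := Hd w' X1 ltac:(lra)).
  assert (B := hm_increment_dist z zd K H w w' W1 X1).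
  set (h := dist1 w w') in *. assert (h0 : 0 <= h) by apply dist1_Cmod.
  assert (Eq1 : f w' - f w - (Re mu * (fst q - fst p) + - Im mu * (snd q - snd p)) =
    (f w' - f w - Re (Cmult l (Cminus w' w))) - Re (Cmult mu (increment z (zd w) w w'))).
  { replace (Cmult l (Cminus w' w)) with (Cmult mu (Cmult (zd w) (Cminus w' w)))
      by (unfold mu; field; exact Nz).
    unfold increment. rewrite W2, X2.
    set (u := Cmult (zd w) (Cminus w' w)).
    unfold Cminus, Cplus, Copp, Cmult, Re, Im. cbn [fst snd]. ring. }
  change (Rabs (f w' - f w - (Re mu * (fst q - fst p) + - Im mu * (snd q - snd p))) <= eps * dist1 p q).
  rewrite Eq1. eapply Rle_trans; [apply Rabs_triang |]. rewrite Rabs_Ropp.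
  assert (Bm : Rabs (Re (Cmult mu (increment z (zd w) w w'))) <= e1 * h).
  { eapply Rle_trans; [apply Re_Im_bound |]. rewrite Cmod_mult. fold m.
    apply Rle_trans with (m * (2 * K * (h * h))); [apply Rmult_le_compat_l; auto |].
    assert (E2 : (2 * (m * K) + 1) * d2 = e1) by (unfold d2; field; lra).
    assert (m * K * (h * h) <= m * K * (d2 * h)).
    { apply Rmult_le_compat_l; auto. apply Rmult_le_compat_r; lra. }
    rewrite <- E2. assert (0 <= d2 * h) by (apply Rmult_le_pos; lra). lra. }
  apply Rle_trans with (2 * e1 * h); [lra |].
  apply Rle_trans with (2 * e1 * (c * dist1 p q)); [apply Rmult_le_compat_l; lra |].
  apply Req_le. unfold e1. field. lra.
Qed.

Lemma inverse_continuous (E : R * R -> Prop) (f : C -> C) :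
  (forall q, E q -> image_closed q) ->
  (forall p, E p -> continuous_at_closed f (inverse p)) ->
  continuous_on E (fun q => f (inverse q)).
Proof.
  intros HE Hf. apply continuous_on_of_eps. intros p Ep eps He.
  destruct (inverse_spec p (HE p Ep)) as [W1 W2].
  destruct (hm_inverse_lipschitz z zd K H _ W1) as (c & eta & Pc & Pe & HL).
  destruct (Hf p Ep eps He) as (d & Pd & Hd).
  exists (Rmin eta (d / c)). split; [apply Rmin_pos; auto; apply Rdiv_lt_0_compat; auto |].
  intros q Eq Hq.
  assert (Q1 : dist1 p q < eta) by (eapply Rlt_le_trans; [exact Hq | apply Rmin_l]).
  assert (Q2 : dist1 p q < d / c) by (eapply Rlt_le_trans; [exact Hq | apply Rmin_r]).
  destruct (inverse_spec q (HE q Eq)) as [X1 X2].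
  apply Hd; auto. eapply Rle_lt_trans; [apply HL; auto; rewrite W2, X2; auto |].
  rewrite W2, X2. apply Rmult_lt_compat_l with (r := c) in Q2; auto.
  replace (c * (d / c)) with d in Q2 by (field; lra). exact Q2.
Qed.

Lemma hm_is_derive w : Im w < 0 -> @is_derive C_AbsRing C_NormedModule z w (zd w).
Proof.
  intros Hw. assert (PK := hm_K_ge0 z zd K H). apply is_derive_of_eps. intros eps He.
  exists (Rmin (- Im w) (eps / (8 * K + 1))).
  split; [apply Rmin_pos; [lra | apply Rdiv_lt_0_compat; lra] |].
  intros w' Hw'.
  assert (Q1 : Cmod (Cminus w' w) < - Im w) by (eapply Rlt_le_trans; [exact Hw' | apply Rmin_l]).
  assert (Q2 : Cmod (Cminus w' w) < eps / (8 * K + 1)) by (eapply Rlt_le_trans; [exact Hw' | apply Rmin_r]).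
  destruct (Re_Im_bound (Cminus w' w)) as [_ B].
  assert (Lw : Im w' <= 0).
  { unfold Cminus, Cplus, Copp, Im in *. cbn [fst snd] in *.
    generalize (Rle_abs (snd w' + - snd w)). lra. }
  assert (I := hm_increment_dist z zd K H w w' ltac:(lra) Lw).
  eapply Rle_trans; [exact I |].
  destruct (dist1_Cmod w w') as [D0 D1]. set (d := dist1 w w') in *.
  set (c := Cmod (Cminus w' w)) in *. assert (c0 : 0 <= c) by apply Cmod_ge_0.
  assert (d * d <= 4 * (c * c)) by nra.
  assert (K * (d * d) <= K * (4 * (c * c))) by (apply Rmult_le_compat_l; auto).
  apply Rmult_lt_compat_l with (r := 8 * K + 1) in Q2; [| lra].
  replace ((8 * K + 1) * (eps / (8 * K + 1))) with eps in Q2 by (field; lra).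
  assert ((8 * K + 1) * c * c <= eps * c) by (apply Rmult_le_compat_r; lra).
  assert (0 <= c * c) by (apply Rmult_le_pos; auto). lra.
Qed.

Lemma rdiff_of_increment (f : C -> R) (l w : C) (M : R) : 0 <= M ->
  (forall w', Im w' <= 0 -> Rabs (f w' - f w - Re (Cmult l (Cminus w' w))) <= M * (dist1 w w' * dist1 w w')) ->
  rdiff f l w.
Proof.
  intros PM Hf eps He. exists (eps / (M + 1)). split; [apply Rdiv_lt_0_compat; lra |].
  intros w' Hw' D. eapply Rle_trans; [apply Hf; auto |].
  destruct (dist1_Cmod w w') as [D0 _]. set (d := dist1 w w') in *.
  apply Rmult_lt_compat_l with (r := M + 1) in D; [| lra].
  replace ((M + 1) * (eps / (M + 1))) with eps in D by (field; lra). nra.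
Qed.

Lemma hm_rdiff w : Im w <= 0 ->
  rdiff (fun w => Re (z w)) (zd w) w /\ rdiff (fun w => Im (z w)) (Cmult (Copp Ci) (zd w)) w.
Proof.
  intros Hw. assert (PK := hm_K_ge0 z zd K H).
  split; apply rdiff_of_increment with K; auto; intros w' Hw';
    destruct (hm_quad _ _ _ H w w' Hw Hw') as [Q1 Q2].
  - replace (Re (z w') - Re (z w) - Re (Cmult (zd w) (Cminus w' w))) with (Re (increment z (zd w) w w')); auto.
  - replace (Im (z w') - Im (z w) - Re (Cmult (Cmult (Copp Ci) (zd w)) (Cminus w' w)))
      with (Im (increment z (zd w) w w')); auto.
    unfold increment, Cminus, Cplus, Copp, Cmult, Ci, Re, Im. cbn [fst snd]. ring.
Qed.

Lemma C1_on_of_rdiff (f : C -> R) (l : C -> C) :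
  (forall w, Im w <= 0 -> rdiff f (l w) w) -> (forall w, Im w <= 0 -> continuous_at_closed l w) ->
  C1_on closed_lower_half_plane f.
Proof.
  intros Hf Hl. exists (fun w => (Re (l w), - Im (l w))). split.
  - intros p Hp. cbn [fst snd]. apply filterdiff_of_eps; auto.
    intros eps He. destruct (Hf p Hp eps He) as (d & Pd & Hd). exists d. split; auto.
    intros q Eq Hq. specialize (Hd q Eq Hq).
    replace (Re (l p) * (fst q - fst p) + - Im (l p) * (snd q - snd p)) with (Re (Cmult (l p) (Cminus q p))); auto.
    unfold Cminus, Cplus, Copp, Cmult, Re, Im. cbn [fst snd]. ring.
  - apply continuous_on_of_eps. intros p Hp eps He.
    destruct (Hl p Hp eps He) as (d & Pd & Hd). exists d. split; auto.
    intros q Eq Hq. specialize (Hd q Eq Hq). unfold dist1, Re, Im in *. cbn [fst snd] in *.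
    replace (- snd (l q) - - snd (l p)) with (- (snd (l q) - snd (l p))) by ring.
    rewrite Rabs_Ropp. exact Hd.
Qed.

Lemma continuous_of_lipschitz (f : C -> C) (w : C) (M : R) : 0 <= M ->
  (forall w', Im w' <= 0 -> dist1 (f w) (f w') <= M * dist1 w w') -> continuous_at_closed f w.
Proof.
  intros PM Hf eps He. exists (eps / (M + 1)). split; [apply Rdiv_lt_0_compat; lra |].
  intros w' Hw' D. eapply Rle_lt_trans; [apply Hf; auto |].
  apply Rmult_lt_compat_l with (r := M + 1) in D; [| lra].
  replace ((M + 1) * (eps / (M + 1))) with eps in D by (field; lra).
  generalize (proj1 (dist1_Cmod w w')). lra.
Qed.

Lemma hm_zd_continuous w : Im w <= 0 -> continuous_at_closed zd w.
Proof.
  intros Hw. assert (PK := hm_K_ge0 z zd K H).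
  apply continuous_of_lipschitz with (2 * K); [lra |]. intros w' Hw'.
  destruct (hm_lip_d _ _ _ H w w' Hw Hw'). unfold dist1 at 1. lra.
Qed.

Lemma hm_C1 : C1_on closed_lower_half_plane (fun w => Re (z w)) /\
  C1_on closed_lower_half_plane (fun w => Im (z w)).
Proof.
  assert (PK := hm_K_ge0 z zd K H).
  split; [apply C1_on_of_rdiff with zd | apply C1_on_of_rdiff with (fun w => Cmult (Copp Ci) (zd w))];
    intros w Hw; try apply hm_rdiff; auto.
  - apply hm_zd_continuous; auto.
  - intros eps He. destruct (hm_zd_continuous w Hw eps He) as (d & Pd & Hd).
    exists d. split; auto. intros w' Hw' D. specialize (Hd w' Hw' D).
    unfold dist1, Cmult, Copp, Ci, Re, Im in *. cbn [fst snd] in *.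
    replace (- (0) * fst (zd w') - - (1) * snd (zd w') - (- (0) * fst (zd w) - - (1) * snd (zd w)))
      with (snd (zd w') - snd (zd w)) by ring.
    replace (- (0) * snd (zd w') + - (1) * fst (zd w') - (- (0) * snd (zd w) + - (1) * fst (zd w)))
      with (- (fst (zd w') - fst (zd w))) by ring.
    rewrite Rabs_Ropp. lra.
Qed.

Lemma rdiff_boundary (f : C -> R) l (x : R) : rdiff f l (x, 0) ->
  is_derive (fun t => f (t, 0)) x (Re l).
Proof.
  intros Hf. apply is_derive_Reals. intros eps He.
  destruct (Hf (eps / 2) ltac:(lra)) as (d & Pd & Hd). exists (mkposreal d Pd).
  intros h Hh Hlt. simpl in Hlt.
  assert (D : dist1 (x, 0) (x + h, 0) = Rabs h).
  { unfold dist1. simpl. rewrite Rminus_diag, Rabs_R0, Rplus_0_r. f_equal. ring. }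
  specialize (Hd (x + h, 0) ltac:(simpl; lra) ltac:(rewrite D; auto)). rewrite D in Hd.
  assert (Ph := Rabs_pos_lt h Hh).
  replace (Re (Cmult l (Cminus (x + h, 0) (x, 0)))) with (Re l * h) in Hd
    by (unfold Cminus, Cplus, Copp, Cmult, Re, Im; cbn [fst snd]; ring).
  change (Rabs ((f (x + h, 0) - f (x, 0)) / h - Re l) < eps).
  match goal with |- Rabs ?u < _ =>
    replace u with ((f (x + h, 0) - f (x, 0) - Re l * h) * / h) by (field; auto) end.
  rewrite Rabs_mult, Rabs_inv. apply Rmult_lt_reg_r with (Rabs h); auto.
  rewrite Rmult_assoc, Rinv_l, Rmult_1_r by lra. nra.
Qed.

Lemma hm_x_alpha (a : R) : is_derive (fun t => Re (z (t, 0))) a (Re (zd (a, 0))) /\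
  is_derive (fun t => Im (z (t, 0))) a (Im (zd (a, 0))).
Proof.
  destruct (hm_rdiff (a, 0) ltac:(simpl; lra)) as [R1 R2].
  split.
  - apply (rdiff_boundary (fun w => Re (z w)) (zd (a, 0)) a R1).
  - assert (G2 := rdiff_boundary (fun w => Im (z w)) _ a R2).
    replace (Im (zd (a, 0))) with (Re (Cmult (Copp Ci) (zd (a, 0)))); auto.
    unfold Cmult, Copp, Ci, Re, Im; cbn [fst snd]. ring.
Qed.

Lemma hm_x_alpha_eq (a : R) : x_alpha z a = Re (zd (a, 0)) /\ y_alpha z a = Im (zd (a, 0)).
Proof.
  destruct (hm_x_alpha a). split; apply is_derive_unique; auto.
Qed.

Lemma hm_conformal_description :
  (forall a b, b <= 0 -> Re (z (a + 2 * PI, b)) = Re (z (a, b)) + 2 * PI /\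
                          Im (z (a + 2 * PI, b)) = Im (z (a, b))) ->
  conformal_description image_domain z.
Proof.
  intros Per. split.
  - split; [| split].
    + intros w Hw. exists (zd w). split; [apply hm_is_derive; auto |].
      apply (hm_regular _ _ _ H). unfold lower_half_plane in Hw. lra.
    + intros w1 w2 H1 H2. unfold lower_half_plane in *. apply (hm_injective z zd K H); lra.
    + intros p. reflexivity.
  - apply hm_C1.
  - apply hm_C1.
  - intros w1 w2 H1 H2. apply (hm_injective z zd K H); auto.
  - intros a. destruct (hm_x_alpha_eq a) as [-> ->]. intros E.
    apply (hm_regular _ _ _ H (a, 0) ltac:(simpl; lra)). injection E as E1 E2.
    apply injective_projections; [exact E1 | exact E2].
  - intros a b Hb. destruct (Per a b Hb) as [-> _]. ring.
  - intros a b Hb. apply Per, Hb.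
  - exists K. intros a b Hb. apply (hm_bounded _ _ _ H (a, b)). simpl. exact Hb.
Qed.

End Domain.

(** * Signs for profiles close to the vertical Crapper wave *)

Lemma mode_1 a b : mode 1 (a, b) = (exp b * cos a, - (exp b * sin a)).
Proof. unfold mode, Re, Im. cbn [fst snd]. simpl INR. rewrite !Rmult_1_l. reflexivity. Qed.

(** With [m = mode 1 w], the factor [d] is [|1 - A m| ^ 2], which avoids a division. The shifted
    series [Q] satisfies [Q = 2 A + A m Q], and the full one is [1 + m Q]. *)
Lemma fourier_crapper A w : 0 <= A -> A * rho < 1 -> Im w <= 0 ->
  let x := Re (mode 1 w) in let y := Im (mode 1 w) in
  let d := (1 - A * x) * (1 - A * x) + A * y * (A * y) in
  d * Re (fourier (crapper A) w) = 1 - A * A * (x * x + y * y) /\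
  d * Im (fourier (crapper A) w) = 2 * (A * y).
Proof.
  intros HA HAr Hw x y d.
  assert (Hp := l1_crapper A HA HAr).
  assert (S0 := l1_summable _ _ Hp).
  assert (S1 := l1_summable _ _ (l1_shift _ _ 1 Hp)).
  assert (S2 := l1_summable _ _ (l1_shift _ _ 2 Hp)).
  assert (S1' : summable (fun n => crapper A (S n))).
  { apply ex_series_ext with (2 := S1). intros n. do 2 f_equal. lia. }
  assert (S2' : summable (fun n => crapper A (S (S n)))).
  { apply ex_series_ext with (2 := S2). intros n. do 2 f_equal. lia. }
  assert (E1 := fourier_shift (crapper A) w Hw S0 S1').
  assert (E2 := fourier_shift (fun n => crapper A (S n)) w Hw S1' S2').
  rewrite (fourier_ext (fun n => crapper A (S (S n))) (fun n => A * crapper A (S n))) in E2.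
  2: { intros n. cbn [crapper]. simpl. ring. }
  rewrite fourier_scal in E2. cbv beta in E2. rewrite crapper_p1 in E2.
  set (F := fourier (crapper A) w) in *.
  set (Q := fourier (fun n => crapper A (S n)) w) in *.
  unfold d. clear d.
  assert (F1 := f_equal fst E1). assert (F2 := f_equal snd E1).
  assert (Q1 := f_equal fst E2). assert (Q2 := f_equal snd E2).
  unfold Cplus, Cmult, RtoC in F1, F2, Q1, Q2. cbn [fst snd crapper] in F1, F2, Q1, Q2.
  change (fst (mode 1 w)) with x in *. change (snd (mode 1 w)) with y in *.
  change (Re F) with (fst F). change (Im F) with (snd F).
  set (u := fst F) in *. set (v := snd F) in *. set (q := fst Q) in *. set (s := snd Q) in *.
  (* u + i v = (1 + A m) / (1 - A m) with m = x + i y *)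
  assert (G1 : u * (1 - A * x) + v * (A * y) = 1 + A * x).
  { assert (u = 1 + (x * q - y * s)) by lra. assert (v = x * s + y * q) by lra.
    assert (I1 : q * (1 - A * x) + s * (A * y) = 2 * A) by lra.
    assert (I2 : s * (1 - A * x) - q * (A * y) = 0) by lra.
    rewrite H, H0.
    replace ((1 + (x * q - y * s)) * (1 - A * x) + (x * s + y * q) * (A * y))
      with (1 - A * x + x * (q * (1 - A * x) + s * (A * y)) - y * (s * (1 - A * x) - q * (A * y))) by ring.
    rewrite I1, I2. ring. }
  assert (G2 : v * (1 - A * x) - u * (A * y) = A * y).
  { assert (u = 1 + (x * q - y * s)) by lra. assert (v = x * s + y * q) by lra.
    assert (I1 : q * (1 - A * x) + s * (A * y) = 2 * A) by lra.
    assert (I2 : s * (1 - A * x) - q * (A * y) = 0) by lra.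
    rewrite H, H0.
    replace ((x * s + y * q) * (1 - A * x) - (1 + (x * q - y * s)) * (A * y))
      with (y * (q * (1 - A * x) + s * (A * y)) + x * (s * (1 - A * x) - q * (A * y)) - A * y) by ring.
    rewrite I1, I2. ring. }
  split.
  - replace (((1 - A * x) * (1 - A * x) + A * y * (A * y)) * u)
      with ((1 - A * x) * (u * (1 - A * x) + v * (A * y)) - A * y * (v * (1 - A * x) - u * (A * y))) by ring.
    rewrite G1, G2. ring.
  - replace (((1 - A * x) * (1 - A * x) + A * y * (A * y)) * v)
      with (A * y * (u * (1 - A * x) + v * (A * y)) + (1 - A * x) * (v * (1 - A * x) - u * (A * y))) by ring.
    rewrite G1, G2. ring.
Qed.

Lemma one_minus_pow_le r n : 0 <= r <= 1 -> 0 <= 1 - r ^ n <= INR n * (1 - r).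
Proof.
  intros Hr. induction n as [|n [I1 I2]].
  - simpl. lra.
  - rewrite S_INR. assert (0 <= r ^ n) by (apply pow_le; lra). simpl pow. nra.
Qed.

Lemma exp_INR_pow n b : exp (INR n * b) = exp b ^ n.
Proof.
  induction n as [|n IH].
  - simpl. rewrite Rmult_0_l. apply exp_0.
  - rewrite S_INR. replace ((INR n + 1) * b) with (b + INR n * b) by ring.
    rewrite exp_plus, IH. reflexivity.
Qed.

(** From [1 - r ^ n <= n (1 - r)] with [r = exp b]. The bound vanishes at the surface at the rate
    [1 - r] on which [near_crapper_interior] relies. *)
Lemma fourier_radial a M (x b : R) : b <= 0 -> l1_le a M ->
  Rabs (Re (fourier a (x, b)) - Re (fourier a (x, 0))) <= (1 - exp b) * (250 * M) /\
  Rabs (Im (fourier a (x, b)) - Im (fourier a (x, 0))) <= (1 - exp b) * (250 * M).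
Proof.
  intros Hb Ha.
  assert (Hr : 0 <= exp b <= 1).
  { destruct (exp_INR_le_1 1 b Hb) as [H1 H2]. rewrite Rmult_1_l in H1, H2. lra. }
  assert (Sa := l1_summable _ _ Ha). destruct (nmul_series1 _ _ Ha) as [Sn Ln].
  destruct (fourier_ex a (x, b) ltac:(simpl; lra) Sa) as [A1 A2].
  destruct (fourier_ex a (x, 0) ltac:(simpl; lra) Sa) as [A3 A4].
  assert (G : forall n c, Rabs c <= 1 -> Rabs (exp (INR n * b) * c - exp (INR n * 0) * c) <= INR n * (1 - exp b)).
  { intros n c Hc. rewrite Rmult_0_r, exp_0, exp_INR_pow.
    replace (exp b ^ n * c - 1 * c) with (- ((1 - exp b ^ n) * c)) by ring.
    destruct (one_minus_pow_le (exp b) n Hr). rewrite Rabs_Ropp, Rabs_mult, (Rabs_right (1 - exp b ^ n)) by lra.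
    generalize (Rabs_pos c). nra. }
  split; (eapply Rle_trans; [| apply Rmult_le_compat_l; [lra | exact Ln]]); unfold fourier; cbn [Re Im fst snd];
    apply Series_increment_le; auto; try lra; intros n; unfold mode, Re, Im; cbn [fst snd].
  - apply G, Rabs_le_between, COS_bound.
  - replace (- (exp (INR n * b) * sin (INR n * x)) - - (exp (INR n * 0) * sin (INR n * x)))
      with (exp (INR n * b) * - sin (INR n * x) - exp (INR n * 0) * - sin (INR n * x)) by ring.
    apply G. rewrite Rabs_Ropp. apply Rabs_le_between, SIN_bound.
Qed.

Lemma abs_sin_INR n x : Rabs (sin (INR n * x)) <= INR n * Rabs (sin x).
Proof.
  induction n as [|n IH].
  - simpl. rewrite Rmult_0_l, sin_0, Rabs_R0. lra.
  - rewrite S_INR, !Rmult_plus_distr_r, !Rmult_1_l, sin_plus.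
    eapply Rle_trans; [apply Rabs_triang |]. rewrite !Rabs_mult.
    assert (Rabs (cos x) <= 1) by (apply Rabs_le_between, COS_bound).
    assert (Rabs (cos (INR n * x)) <= 1) by (apply Rabs_le_between, COS_bound).
    generalize (Rabs_pos (sin x)) (Rabs_pos (sin (INR n * x))). intros. nra.
Qed.

(** With real coefficients the imaginary part vanishes where [sin x] does, and
    [|sin (n x)| <= n |sin x|] makes this quantitative. *)
Lemma fourier_Im_circle a M (x : R) : l1_le a M ->
  Rabs (Im (fourier a (x, 0))) <= Rabs (sin x) * (250 * M).
Proof.
  intros Ha.
  assert (Sa := l1_summable _ _ Ha). destruct (nmul_series1 _ _ Ha) as [Sn Ln].
  destruct (fourier_ex a (x, 0) ltac:(simpl; lra) Sa) as [_ A2].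
  eapply Rle_trans; [| apply Rmult_le_compat_l; [apply Rabs_pos | exact Ln]].
  unfold fourier; cbn [Re Im fst snd].
  replace (Series (fun n => a n * Im (mode n (x, 0)))) with
    (Series (fun n => a n * Im (mode n (x, 0))) - Series (fun n => a n * 0)).
  2: { rewrite Series_scal_r. ring. }
  apply Series_increment_le; auto.
  - apply Rabs_pos.
  - apply ex_series_scal_r. apply summable_ex, Sa.
  - intros n. unfold mode, Re, Im. cbn [fst snd].
    rewrite Rmult_0_r, exp_0, Rmult_1_l, Rminus_0_r, Rabs_Ropp. apply abs_sin_INR.
Qed.

Section Near_crapper.
Context (p t : nat -> R) (N : near_crapper p t).

Let m (w : C) := mode 1 w.
(** The squared modulus of [1 - A0 * m w], the denominator of Crapper's profile. *)
Let d (w : C) := (1 - A0 * Re (m w)) * (1 - A0 * Re (m w)) + A0 * Im (m w) * (A0 * Im (m w)).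
Let err (n : nat) := p n - P0 n.

Lemma near_crapper_split w : Im w <= 0 ->
  fourier p w = Cplus (fourier P0 w) (fourier err w).
Proof.
  intros Hw. rewrite <- fourier_plus; auto.
  - apply fourier_ext. intros n. unfold err. ring.
  - apply (l1_summable _ _ nb_P0).
  - apply (l1_summable _ rad). apply N.
Qed.

Lemma near_crapper_XT w : Im w <= 0 ->
  d w * Re (fourier p w) = 1 - A0 * A0 * (Re (m w) * Re (m w) + Im (m w) * Im (m w)) + d w * Re (fourier err w) /\
  d w * Im (fourier p w) = 2 * (A0 * Im (m w)) + d w * Im (fourier err w).
Proof.
  intros Hw. assert (B := A0_bounds).
  destruct (fourier_crapper A0 w ltac:(lra) ltac:(unfold rho; lra) Hw) as [F1 F2].
  fold P0 in F1, F2. fold (m w) in F1, F2. fold (d w) in F1, F2.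
  rewrite (near_crapper_split w Hw).
  split; [rewrite <- F1 | rewrite <- F2]; unfold Cplus, Re, Im; cbn [fst snd]; ring.
Qed.

Lemma near_crapper_d w : Im w <= 0 -> 0 < d w <= 202 / 100.
Proof.
  intros Hw. assert (B := A0_bounds). destruct (mode_bound 1 w Hw) as [B1 B2].
  fold (m w) in B1, B2. set (x := Re (m w)) in *. set (y := Im (m w)) in *.
  apply Rabs_le_between in B1. apply Rabs_le_between in B2.
  assert (XY : x * x + y * y <= 1).
  { unfold x, y, m, mode, Re, Im. cbn [fst snd]. simpl INR. rewrite !Rmult_1_l.
    assert (SC := sin2_cos2 (fst w)). unfold Rsqr in SC.
    destruct (exp_INR_le_1 1 (snd w) Hw) as [E1 E2]. rewrite Rmult_1_l in E1, E2.
    replace (exp (snd w) * cos (fst w) * (exp (snd w) * cos (fst w)) +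
      - (exp (snd w) * sin (fst w)) * - (exp (snd w) * sin (fst w)))
      with (exp (snd w) * exp (snd w) * (sin (fst w) * sin (fst w) + cos (fst w) * cos (fst w))) by ring.
    rewrite SC. nra. }
  assert (S := A0_sqr).
  unfold d. fold x y.
  replace ((1 - A0 * x) * (1 - A0 * x) + A0 * y * (A0 * y)) with
    (1 - 2 * (A0 * x) + A0 * A0 * (x * x + y * y)) by ring.
  split; [| nra].
  assert (0 < (1 - A0 * x) * (1 - A0 * x)) by (apply Rmult_lt_0_compat; nra).
  assert (0 <= A0 * y * (A0 * y)) by apply Rle_0_sqr. lra.
Qed.

Lemma near_crapper_err w : Im w <= 0 ->
  Rabs (Re (fourier err w)) <= rad /\ Rabs (Im (fourier err w)) <= rad.
Proof. intros Hw. apply fourier_bound; auto. apply N. Qed.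

Lemma near_crapper_Re_pos w : Im w <= 0 -> 1 / 10 <= Re (fourier p w).
Proof.
  intros Hw. assert (B := A0_bounds). destruct (near_crapper_XT w Hw) as [X _].
  destruct (near_crapper_d w Hw) as [D1 D2]. destruct (near_crapper_err w Hw) as [E _].
  destruct (mode_bound 1 w Hw) as [B1 B2]. fold (m w) in B1, B2.
  apply Rabs_le_between in B1. apply Rabs_le_between in B2. apply Rabs_le_between in E.
  assert (S := A0_sqr). unfold rad in E.
  apply Rmult_le_reg_l with (d w); auto. rewrite X.
  assert (Re (m w) * Re (m w) <= 1) by nra. assert (Im (m w) * Im (m w) <= 1) by nra.
  assert (A0 * A0 * (Re (m w) * Re (m w) + Im (m w) * Im (m w)) <= A0 * A0 * 2) by (apply Rmult_le_compat_l; nra).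
  assert (- (1 / 1000) <= d w * Re (fourier err w)) by nra.
  lra.
Qed.

(** For Crapper's wave [d * Im] is [- 2 * A0 * sin x]; the perturbation, below [0.01 * |sin x|],
    cannot compensate it unless [sin x = 0]. *)
Lemma near_crapper_Im_zero (x : R) : Im (fourier p (x, 0)) = 0 -> sin x = 0.
Proof.
  intros E. assert (B := A0_bounds). assert (Hw : Im (x, 0) <= 0) by (simpl; lra).
  destruct (near_crapper_XT (x, 0) Hw) as [_ T]. rewrite E, Rmult_0_r in T.
  destruct (near_crapper_d (x, 0) Hw) as [D1 D2].
  assert (F := fourier_Im_circle err rad x (proj1 (proj2 N))).
  unfold m in T. rewrite mode_1, exp_0, Rmult_1_l in T. unfold Im at 1 in T. cbn [snd] in T.
  set (e := Im (fourier err (x, 0))) in *. set (dd := d (x, 0)) in *.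
  assert (Ed : Rabs (dd * e) <= 202 / 100 * (Rabs (sin x) * (250 * rad))).
  { rewrite Rabs_mult, (Rabs_right dd) by lra. apply Rmult_le_compat; auto using Rabs_pos; lra. }
  assert (Es : Rabs (dd * e) = 2 * A0 * Rabs (sin x)).
  { replace (dd * e) with (2 * A0 * sin x) by lra. rewrite Rabs_mult, (Rabs_right (2 * A0)) by lra. reflexivity. }
  assert (P := Rabs_pos (sin x)). unfold rad in Ed.
  apply Rabs_eq_0. nra.
Qed.

(** Let [r = exp b]. Below the surface, Crapper's [d * Im] is multiplied by [r], while
    [d * Re = 1 - A0 ^ 2 r ^ 2] gains at least [0.17 * (1 - r)]. The perturbations contribute only a
    few hundredths of [1 - r], so the cone condition becomes strict. *)
Lemma near_crapper_interior (x b : R) : b < 0 ->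
  Rabs (Im (fourier p (x, 0))) <= Re (fourier p (x, 0)) ->
  Rabs (Im (fourier p (x, b))) < Re (fourier p (x, b)).
Proof.
  intros Hb H0. assert (B := A0_bounds). assert (SQ := A0_sqr).
  set (w := (x, b) : C). set (w0 := (x, 0) : C).
  assert (Hw : Im w <= 0) by (simpl; lra). assert (Hw0 : Im w0 <= 0) by (simpl; lra).
  destruct (near_crapper_XT w Hw) as [X T]. destruct (near_crapper_XT w0 Hw0) as [X0 T0].
  destruct (near_crapper_d w Hw) as [D1 D2]. destruct (near_crapper_d w0 Hw0) as [D3 D4].
  destruct (near_crapper_err w Hw) as [E1 E2]. destruct (near_crapper_err w0 Hw0) as [E3 E4].
  destruct (fourier_radial err rad x b ltac:(lra) (proj1 (proj2 N))) as [R1 R2].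
  fold w w0 in R1, R2.
  set (r := exp b) in *.
  assert (Hr : 0 < r < 1).
  { unfold r. split; [apply exp_pos |]. rewrite <- exp_0. apply exp_increasing. lra. }
  assert (Em : Re (m w) = r * cos x /\ Im (m w) = - (r * sin x)).
  { unfold m, w. rewrite mode_1. split; reflexivity. }
  assert (Em0 : Re (m w0) = cos x /\ Im (m w0) = - sin x).
  { unfold m, w0. rewrite mode_1, exp_0, !Rmult_1_l. split; reflexivity. }
  destruct Em as [M1 M2]. destruct Em0 as [M3 M4].
  assert (SC := sin2_cos2 x). unfold Rsqr in SC.
  assert (Bc : -1 <= cos x <= 1) by apply COS_bound.
  assert (Nm : Re (m w) * Re (m w) + Im (m w) * Im (m w) = r * r).
  { rewrite M1, M2. replace (r * cos x * (r * cos x) + - (r * sin x) * - (r * sin x))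
      with (r * r * (sin x * sin x + cos x * cos x)) by ring. rewrite SC. ring. }
  assert (Nm0 : Re (m w0) * Re (m w0) + Im (m w0) * Im (m w0) = 1).
  { rewrite M3, M4. lra. }
  assert (Dd : Rabs (d w - d w0) <= 2 * (1 - r)).
  { replace (d w) with (1 - 2 * (A0 * (r * cos x)) + A0 * A0 * (r * r)).
    2: { rewrite <- Nm. unfold d. rewrite M1. ring. }
    replace (d w0) with (1 - 2 * (A0 * cos x) + A0 * A0 * 1).
    2: { transitivity (1 - 2 * (A0 * cos x) + A0 * A0 * (Re (m w0) * Re (m w0) + Im (m w0) * Im (m w0))).
         - rewrite Nm0. reflexivity.
         - unfold d. rewrite M3. ring. }
    replace (1 - 2 * (A0 * (r * cos x)) + A0 * A0 * (r * r) - (1 - 2 * (A0 * cos x) + A0 * A0 * 1))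
      with ((1 - r) * (2 * (A0 * cos x) - A0 * A0 * (1 + r))) by ring.
    rewrite Rabs_mult, (Rabs_right (1 - r)) by lra. replace (2 * (1 - r)) with ((1 - r) * 2) by ring.
    apply Rmult_le_compat_l; [lra |]. apply Rabs_le_between. nra. }
  rewrite Nm in X. rewrite Nm0 in X0. rewrite M2 in T. rewrite M4 in T0.
  (* the perturbation is Lipschitz in r with a constant below A0 ^ 2 *)
  assert (Pert : forall e e0, Rabs e <= rad -> Rabs e0 <= rad -> Rabs (e - e0) <= (1 - r) * (250 * rad) ->
    Rabs (d w * e - d w0 * e0) <= (1 - r) * (1 / 100)).
  { intros e e0 He He0 Hee.
    replace (d w * e - d w0 * e0) with ((d w - d w0) * e + d w0 * (e - e0)) by ring.
    eapply Rle_trans; [apply Rabs_triang |]. rewrite !Rabs_mult, (Rabs_right (d w0)) by lra.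
    apply Rle_trans with (2 * (1 - r) * rad + 202 / 100 * ((1 - r) * (250 * rad))).
    - apply Rplus_le_compat; apply Rmult_le_compat; auto using Rabs_pos; lra.
    - unfold rad. lra. }
  assert (P1 := Pert _ _ E1 E3 R1). assert (P2 := Pert _ _ E2 E4 R2).
  set (f1 := d w * Re (fourier err w)) in *. set (f2 := d w0 * Re (fourier err w0)) in *.
  set (h1 := d w * Im (fourier err w)) in *. set (h2 := d w0 * Im (fourier err w0)) in *.
  assert (Hh2 : Rabs h2 <= 3 * rad).
  { unfold h2. rewrite Rabs_mult, (Rabs_right (d w0)) by lra.
    apply Rle_trans with (202 / 100 * rad); [apply Rmult_le_compat; auto using Rabs_pos; lra | unfold rad; lra]. }
  assert (B0 : Rabs (d w0 * Im (fourier p w0)) <= d w0 * Re (fourier p w0)).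
  { rewrite Rabs_mult, (Rabs_right (d w0)) by lra. apply Rmult_le_compat_l; [lra | exact H0]. }
  assert (Goal' : Rabs (d w * Im (fourier p w)) < d w * Re (fourier p w)).
  { rewrite X, T. rewrite X0 in B0. set (T1 := d w0 * Im (fourier p w0)) in *.
    (* The surface value scaled by [r], plus an error of order [1 - r]. *)
    replace (2 * (A0 * - (r * sin x)) + h1) with (r * T1 + ((h1 - h2) + (1 - r) * h2)) by (rewrite T0; ring).
    eapply Rle_lt_trans; [apply Rabs_triang |].
    rewrite Rabs_mult, (Rabs_right r) by lra.
    assert (Rabs (h1 - h2 + (1 - r) * h2) <= (1 - r) * (2 / 100)).
    { eapply Rle_trans; [apply Rabs_triang |]. rewrite (Rabs_mult (1 - r)), (Rabs_right (1 - r)) by lra.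
      assert ((1 - r) * Rabs h2 <= (1 - r) * (3 * rad)) by (apply Rmult_le_compat_l; lra).
      unfold rad in *. lra. }
    apply Rabs_le_between in P1.
    assert (PT := Rabs_pos T1).
    assert (A0 * A0 * (r * r) <= A0 * A0 - 17 / 100 * (1 - r)).
    { assert (r * r <= r) by nra. assert (A0 * A0 * (r * r) <= A0 * A0 * r) by (apply Rmult_le_compat_l; lra).
      assert (17 / 100 * (1 - r) <= A0 * A0 * (1 - r)) by (apply Rmult_le_compat_r; lra). lra. }
    assert (r * Rabs T1 <= 1 * Rabs T1) by (apply Rmult_le_compat_r; lra).
    lra. }
  rewrite Rabs_mult, (Rabs_right (d w)) in Goal' by lra.
  apply Rmult_lt_reg_l with (1 := D1). exact Goal'.
Qed.

End Near_crapper.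

(** * The critical amplitude *)

(** As [dz/dw = p ^ 2], this is [x_alpha] on the surface; see [wave_x_alpha]. *)
Definition slope (p : nat -> R) (x : R) : R := Re (fourier (conv p p) (x, 0)).

Lemma slope_eq p M x : l1_le p M -> slope p x =
  Re (fourier p (x, 0)) * Re (fourier p (x, 0)) - Im (fourier p (x, 0)) * Im (fourier p (x, 0)).
Proof.
  intros Hp. assert (S := l1_summable _ _ Hp). unfold slope.
  rewrite fourier_conv by (auto; simpl; lra). reflexivity.
Qed.

Lemma slope_diff p p' e x : l1_le p (245 / 100) -> l1_le p' (245 / 100) -> l1_le (fun n => p n - p' n) e ->
  Rabs (slope p x - slope p' x) <= 10 * e.
Proof.
  intros Hp Hp' He. assert (Hw : Im (x, 0) <= 0) by (simpl; lra).
  rewrite (slope_eq _ _ x Hp), (slope_eq _ _ x Hp').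
  destruct (fourier_bound _ _ _ Hw Hp) as [A1 A2]. destruct (fourier_bound _ _ _ Hw Hp') as [A3 A4].
  destruct (fourier_bound _ _ _ Hw He) as [D1 D2].
  rewrite fourier_minus in D1, D2 by eauto using l1_summable.
  set (F := fourier p (x, 0)) in *. set (G := fourier p' (x, 0)) in *.
  unfold Cminus, Cplus, Copp, Re, Im in D1, D2. cbn [fst snd] in D1, D2.
  unfold Re, Im in *.
  replace (fst F * fst F - snd F * snd F - (fst G * fst G - snd G * snd G)) with
    ((fst F + - fst G) * (fst F + fst G) - (snd F + - snd G) * (snd F + snd G)) by ring.
  assert (S1 : Rabs (fst F + fst G) <= 5) by (eapply Rle_trans; [apply Rabs_triang |]; lra).
  assert (S2 : Rabs (snd F + snd G) <= 5) by (eapply Rle_trans; [apply Rabs_triang |]; lra).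
  eapply Rle_trans; [apply Rabs_triang |]. rewrite Rabs_Ropp, !Rabs_mult.
  apply Rle_trans with (e * 5 + e * 5); [| lra].
  apply Rplus_le_compat; apply Rmult_le_compat; auto using Rabs_pos.
Qed.

Lemma slope_lipschitz p M x x' : l1_le p M -> Rabs (slope p x' - slope p x) <= 250 * (M * M) * Rabs (x' - x).
Proof.
  intros Hp. assert (Hc := l1_conv _ _ _ _ Hp Hp). destruct (nmul_series1 _ _ Hc) as [S1 L1].
  destruct (fourier_lipschitz (conv p p) (x, 0) (x', 0)) as [L _]; try (simpl; lra); auto.
  - apply (l1_summable _ _ Hc).
  - unfold slope. eapply Rle_trans; [exact L |].
    unfold dist1. simpl. rewrite Rminus_diag, Rabs_R0, Rplus_0_r, Rmult_comm.
    apply Rmult_le_compat_r; [apply Rabs_pos | exact L1].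
Qed.

(** Reflection in a multiple of [PI] conjugates every mode, and the coefficients are real. This is
    the source of the crest and trough symmetries. *)
Lemma fourier_reflect a (x0 x b : R) : sin x0 = 0 ->
  fourier a (2 * x0 - x, b) = Cconj (fourier a (x, b)).
Proof.
  intros S0.
  assert (E : forall n, mode n (2 * x0 - x, b) = Cconj (mode n (x, b))).
  { intros n. assert (Sn := abs_sin_INR n x0). rewrite S0, Rabs_R0, Rmult_0_r in Sn.
    assert (Sn0 : sin (INR n * x0) = 0).
    { apply Rabs_eq_0. apply Rle_antisym; [exact Sn | apply Rabs_pos]. }
    unfold mode, Cconj, Re, Im. cbn [fst snd].
    replace (INR n * (2 * x0 - x)) with (2 * (INR n * x0) - INR n * x) by ring.
    rewrite cos_minus, sin_minus, sin_2a, cos_2a_sin, Sn0. f_equal; ring. }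
  unfold fourier, Cconj. cbn [fst snd]. f_equal.
  - apply Series_ext. intros n. rewrite E. reflexivity.
  - rewrite <- Series_opp. apply Series_ext. intros n. rewrite E.
    unfold Cconj, Im. cbn [snd]. ring.
Qed.

Lemma fourier_opp a (x b : R) : fourier a (- x, b) = Cconj (fourier a (x, b)).
Proof.
  rewrite <- (fourier_reflect a 0 x b sin_0). do 2 f_equal. ring.
Qed.

Lemma fourier_period a (x b : R) k : fourier a (x + 2 * INR k * PI, b) = fourier a (x, b).
Proof.
  assert (E : forall n, mode n (x + 2 * INR k * PI, b) = mode n (x, b)).
  { intros n. unfold mode, Re, Im. cbn [fst snd].
    replace (INR n * (x + 2 * INR k * PI)) with (INR n * x + 2 * INR (n * k) * PI)
      by (rewrite mult_INR; ring).
    rewrite cos_period, sin_period. reflexivity. }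
  unfold fourier. f_equal; apply Series_ext; intros n; rewrite E; reflexivity.
Qed.

Lemma slope_reduce p x : exists y, 0 <= y <= 2 * PI /\ slope p y = slope p x.
Proof.
  assert (PP := PI_RGT_0).
  assert (A : exists y, 0 <= y /\ slope p y = slope p x).
  { destruct (Rle_dec 0 x) as [L | L]; [exists x; auto |].
    exists (- x). split; [lra |]. unfold slope. rewrite fourier_opp. reflexivity. }
  destruct A as [y [Hy Ey]].
  destruct (nfloor_ex (y / (2 * PI))) as [k [K1 K2]].
  { apply Rmult_le_pos; [auto |]. left. apply Rinv_0_lt_compat. lra. }
  exists (y - 2 * INR k * PI). split.
  - assert (E : y = y / (2 * PI) * (2 * PI)) by (field; lra).
    set (q := y / (2 * PI)) in *. rewrite E. nra.
  - rewrite <- Ey. unfold slope. rewrite <- (fourier_period _ (y - 2 * INR k * PI) 0 k).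
    do 3 f_equal. ring.
Qed.

Lemma slope_min p M : l1_le p M -> exists x0, forall x, slope p x0 <= slope p x.
Proof.
  intros Hp. assert (PP := PI_RGT_0).
  destruct (continuity_ab_min (slope p) 0 (2 * PI)) as [x0 [H0 _]]; [lra | |].
  - intros x _ eps He. set (L := 250 * (M * M) + 1).
    assert (HL : 0 < L) by (unfold L; assert (H := Rle_0_sqr M); unfold Rsqr in H; lra).
    exists (eps / L). split; [apply Rdiv_lt_0_compat; lra |].
    intros x' [_ Hx']. simpl in *. unfold R_dist in *.
    assert (S := slope_lipschitz p M x x' Hp).
    apply Rmult_lt_compat_l with (r := L) in Hx'; auto.
    replace (L * (eps / L)) with eps in Hx' by (field; lra).
    unfold L in Hx'. generalize (Rabs_pos (x' - x)). lra.
  - exists x0. intros x. destruct (slope_reduce p x) as [y [Hy <-]]. apply H0; auto.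
Qed.

Definition eta0 : R := delta0 / 4.
(** Gravity changes [slope] by at most [10 * 3000 * gmax], below [eta0 / 2]. Crapper's slope is at
    least [0.9 * eta0] everywhere for the amplitude [A0 - eta0], and at most [- eta0] at [PI / 2]
    for [A0 + eta0]. *)
Definition gmax : R := 1 / 1000000000000000.

(** Where [sin x ^ 2 = 1] the right side is [(1 - A ^ 2 - 2 A) (1 - A ^ 2 + 2 A)], which changes
    sign at [A0] by [A0_sqr]. *)
Lemma slope_crapper A x : Rabs (A - A0) <= delta0 ->
  let y := sin x in let d := (1 - A * cos x) * (1 - A * cos x) + A * y * (A * y) in
  d * d * slope (crapper A) x = (1 - A * A) * (1 - A * A) - 4 * (A * A) * (y * y).
Proof.
  intros HA y d. assert (B := A0_bounds).
  assert (BA : 41 / 100 <= A <= 42 / 100).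
  { apply Rabs_le_between in HA. unfold delta0 in HA. lra. }
  destruct (fourier_crapper A (x, 0) ltac:(lra) ltac:(unfold rho; lra) ltac:(simpl; lra)) as [F1 F2].
  rewrite mode_1, exp_0, !Rmult_1_l in F1, F2. unfold Re at 1 2 4 5, Im at 1 2 3 4 in F1.
  unfold Re at 1 2, Im at 1 2 4 in F2. cbn [fst snd] in F1, F2. fold y in F1, F2.
  rewrite (slope_eq _ _ x (l1_crapper A ltac:(lra) ltac:(unfold rho; lra))).
  set (u := Re (fourier (crapper A) (x, 0))) in *. set (v := Im (fourier (crapper A) (x, 0))) in *.
  assert (SC := sin2_cos2 x). unfold Rsqr in SC. fold y in SC.
  assert (D1 : d * u = 1 - A * A).
  { transitivity (1 - A * A * (cos x * cos x + - y * - y)).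
    - rewrite <- F1. unfold d. ring.
    - replace (cos x * cos x + - y * - y) with (y * y + cos x * cos x) by ring. rewrite SC. ring. }
  assert (D2 : d * v = - (2 * (A * y))).
  { transitivity (2 * (A * - y)); [rewrite <- F2; unfold d; ring | ring]. }
  replace (d * d * (u * u - v * v)) with (d * u * (d * u) - d * v * (d * v)) by ring.
  rewrite D1, D2. ring.
Qed.

Lemma solves_bound a g p t : solves a g p t -> l1_le p (245 / 100).
Proof. intros [N _]. apply (near_crapper_bounds p t N). Qed.

Lemma solves_near_crapper A g p t : Rabs (A - A0) <= eta0 -> Rabs g <= gmax ->
  solves (2 * A) g p t -> forall x, Rabs (slope p x - slope (crapper A) x) <= eta0 / 2.
Proof.
  intros HA Hg Hs x.
  assert (HA' : Rabs (A - A0) <= delta0) by (unfold eta0, delta0 in *; lra).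
  assert (Ha : Rabs (2 * A - 2 * A0) <= delta0).
  { replace (2 * A - 2 * A0) with (2 * (A - A0)) by ring. rewrite Rabs_mult, (Rabs_right 2) by lra.
    unfold eta0, delta0 in *. lra. }
  assert (C := crapper_solves A HA').
  assert (L := solution_lipschitz (2 * A) (2 * A) g 0 p t _ _ gmax Hs C Ha Ha).
  eapply Rle_trans; [apply (slope_diff _ _ (3000 * gmax)) |].
  - apply (solves_bound _ _ _ _ Hs).
  - apply (solves_bound _ _ _ _ C).
  - unfold gmax, delta0 in *. apply L; rewrite ?Rminus_diag, ?Rminus_0_r, ?Rabs_R0; lra.
  - unfold gmax, eta0, delta0. lra.
Qed.

Lemma subcritical_slope g p t : Rabs g <= gmax -> solves (2 * (A0 - eta0)) g p t ->
  forall x, 0 <= slope p x.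
Proof.
  intros Hg Hs x. assert (B := A0_bounds). assert (SQ := A0_sqr).
  set (A := A0 - eta0) in *.
  assert (HA : Rabs (A - A0) <= eta0).
  { unfold A. replace (A0 - eta0 - A0) with (- eta0) by ring. rewrite Rabs_Ropp, Rabs_right; unfold eta0, delta0; lra. }
  assert (D := solves_near_crapper A g p t HA Hg Hs x).
  assert (S := slope_crapper A x ltac:(unfold eta0, delta0 in *; lra)). cbv zeta in S.
  set (d := (1 - A * cos x) * (1 - A * cos x) + A * sin x * (A * sin x)) in *.
  assert (SC := sin2_cos2 x). unfold Rsqr in SC. assert (Bc := COS_bound x).
  assert (E0 : 0 < eta0 <= 1 / 1000) by (unfold eta0, delta0; lra).
  assert (BA : 41 / 100 <= A <= 42 / 100) by (unfold A; lra).
  assert (Ed : d = 1 - 2 * A * cos x + A * A).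
  { unfold d. transitivity (1 - 2 * A * cos x + A * A * (sin x * sin x + cos x * cos x)); [ring |].
    rewrite SC. ring. }
  assert (Bd : 1 / 10 <= d <= 21 / 10).
  { rewrite Ed.
    assert (Q : forall u c, 41 / 100 <= u <= 42 / 100 -> -1 <= c <= 1 -> - u <= u * c <= u)
      by (clear; intros u c Hu Hc; split; nra).
    assert (A1 := Q A (cos x) BA Bc).
    assert (41 / 100 * (41 / 100) <= A * A <= 42 / 100 * (42 / 100))
      by (split; apply Rmult_le_compat; lra).
    lra. }
  (* [1 - A ^ 2 - 2 A] vanishes at [A0] with derivative about -2.83, and the other factor exceeds
     1.5. Dividing by [d ^ 2 <= 4.41] leaves [0.9 * eta0]. *)
  assert (Num : 4 * eta0 <= (1 - A * A) * (1 - A * A) - 4 * (A * A) * (sin x * sin x)).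
  { apply Rle_trans with ((1 - A * A) * (1 - A * A) - 4 * (A * A) * 1).
    - replace ((1 - A * A) * (1 - A * A) - 4 * (A * A) * 1) with ((1 - A * A - 2 * A) * (1 - A * A + 2 * A)) by ring.
      assert (28 / 10 * eta0 <= 1 - A * A - 2 * A).
      { replace (1 - A * A - 2 * A) with ((1 - 2 * A0 - A0 * A0) + (2 * A0 + 2 - eta0) * eta0)
          by (unfold A; ring).
        rewrite SQ. assert (28 / 10 * eta0 <= (2 * A0 + 2 - eta0) * eta0); [| lra].
        apply Rmult_le_compat_r; lra. }
      assert (A * A <= 42 / 100 * (42 / 100)) by (apply Rmult_le_compat; lra).
      apply Rle_trans with (28 / 10 * eta0 * (15 / 10)); [lra |].
      apply Rmult_le_compat; lra.
    - assert (4 * (A * A) * (sin x * sin x) <= 4 * (A * A) * 1); [| lra].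
      apply Rmult_le_compat_l; [generalize (Rle_0_sqr A); unfold Rsqr; lra |].
      generalize (Rle_0_sqr (cos x)); unfold Rsqr; lra. }
  apply Rabs_le_between in D.
  assert (d * d <= 21 / 10 * (21 / 10)) by (apply Rmult_le_compat; lra).
  assert (0 < d * d) by (apply Rmult_lt_0_compat; lra).
  rewrite <- S in Num.
  assert (9 / 10 * eta0 <= slope (crapper A) x); [| lra].
  apply Rnot_lt_le. intros C.
  assert (d * d * slope (crapper A) x < d * d * (9 / 10 * eta0)) by (apply Rmult_lt_compat_l; auto).
  assert (d * d * (9 / 10 * eta0) <= 21 / 10 * (21 / 10) * (9 / 10 * eta0)) by (apply Rmult_le_compat_r; lra).
  lra.
Qed.

Lemma supercritical_slope g p t : Rabs g <= gmax -> solves (2 * (A0 + eta0)) g p t ->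
  slope p (PI / 2) < 0.
Proof.
  intros Hg Hs. assert (B := A0_bounds). assert (SQ := A0_sqr).
  set (A := A0 + eta0) in *.
  assert (HA : Rabs (A - A0) <= eta0).
  { unfold A. replace (A0 + eta0 - A0) with eta0 by ring. rewrite Rabs_right; unfold eta0, delta0; lra. }
  assert (D := solves_near_crapper A g p t HA Hg Hs (PI / 2)).
  assert (S := slope_crapper A (PI / 2) ltac:(unfold eta0, delta0 in *; lra)). cbv zeta in S.
  rewrite sin_PI2, cos_PI2 in S.
  set (d := (1 - A * 0) * (1 - A * 0) + A * 1 * (A * 1)) in *.
  assert (E0 : 0 < eta0 <= 1 / 1000) by (unfold eta0, delta0; lra).
  assert (BA : 41 / 100 <= A <= 42 / 100) by (unfold A; lra).
  assert (Ed : d = 1 + A * A) by (unfold d; ring).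
  assert (Bd : 1 <= d <= 12 / 10).
  { rewrite Ed. assert (0 <= A * A <= 42 / 100 * (42 / 100)); [| lra].
    split; [apply Rle_0_sqr | apply Rmult_le_compat; lra]. }
  assert (Num : (1 - A * A) * (1 - A * A) - 4 * (A * A) * (1 * 1) <= - (4 * eta0)).
  { replace ((1 - A * A) * (1 - A * A) - 4 * (A * A) * (1 * 1)) with ((1 - A * A - 2 * A) * (1 - A * A + 2 * A)) by ring.
    assert (28 / 10 * eta0 <= - (1 - A * A - 2 * A)).
    { replace (- (1 - A * A - 2 * A)) with (- (1 - 2 * A0 - A0 * A0) + (2 * A0 + 2 + eta0) * eta0)
        by (unfold A; ring).
      rewrite SQ. assert (28 / 10 * eta0 <= (2 * A0 + 2 + eta0) * eta0); [| lra].
      apply Rmult_le_compat_r; lra. }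
    assert (A * A <= 42 / 100 * (42 / 100)) by (apply Rmult_le_compat; lra).
    assert (28 / 10 * eta0 * (15 / 10) <= - (1 - A * A - 2 * A) * (1 - A * A + 2 * A)); [| lra].
    apply Rmult_le_compat; lra. }
  apply Rabs_le_between in D.
  assert (d * d <= 12 / 10 * (12 / 10)) by (apply Rmult_le_compat; lra).
  assert (1 * 1 <= d * d) by (apply Rmult_le_compat; lra).
  rewrite <- S in Num.
  assert (slope (crapper A) (PI / 2) <= - eta0); [| lra].
  apply Rnot_lt_le. intros C.
  assert (d * d * - eta0 < d * d * slope (crapper A) (PI / 2)) by (apply Rmult_lt_compat_l; lra).
  assert (d * d * eta0 <= 12 / 10 * (12 / 10) * eta0) by (apply Rmult_le_compat_r; lra). lra.
Qed.

(** Take the supremum of the amplitudes [a] for which the wave does not overhang. *)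
Lemma critical_solution g : Rabs g <= gmax -> exists a p t,
  Rabs (a - 2 * A0) <= delta0 /\ solves a g p t /\
  (forall x, 0 <= slope p x) /\ exists x, slope p x = 0.
Proof.
  intros Hg. assert (E0 : 0 < eta0) by (unfold eta0, delta0; lra).
  set (a1 := 2 * (A0 - eta0)). set (a2 := 2 * (A0 + eta0)).
  assert (Hg' : Rabs g <= delta0) by (unfold gmax, delta0 in *; lra).
  assert (Ex : forall a, a1 <= a <= a2 -> Rabs (a - 2 * A0) <= delta0).
  { intros a Ha. apply Rabs_le_between. unfold a1, a2, eta0, delta0 in *. lra. }
  (* Asking for one solution is enough: [Cmp] below compares any solution with the one at the
     supremum. *)
  set (Good := fun a => a1 <= a <= a2 /\ exists p t, solves a g p t /\ forall x, 0 <= slope p x).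
  assert (G1 : Good a1).
  { split; [unfold a1, a2; lra |].
    destruct (solution_exists a1 g (Ex a1 ltac:(unfold a1, a2; lra)) Hg') as (p & t & Hs).
    exists p, t. split; auto. apply (subcritical_slope g p t Hg Hs). }
  destruct (completeness Good) as [a [Ub Lub]].
  { exists a2. intros a [Ha _]. lra. }
  { exists a1. exact G1. }
  assert (Ha : a1 <= a <= a2).
  { split; [apply Ub, G1 |]. apply Lub. intros b [Hb _]. lra. }
  destruct (solution_exists a g (Ex a Ha) Hg') as (p & t & Hs).
  assert (Cmp : forall b q s x, a1 <= b <= a2 -> solves b g q s ->
     Rabs (slope q x - slope p x) <= 30000 * Rabs (b - a)).
  { intros b q s x Hb Hq.
    replace (30000 * Rabs (b - a)) with (10 * (3000 * Rabs (b - a))) by ring.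
    apply slope_diff; [apply (solves_bound _ _ _ _ Hq) | apply (solves_bound _ _ _ _ Hs) |].
    apply (solution_lipschitz b a g g q s p t); auto; try lra.
    rewrite Rminus_diag, Rabs_R0. apply Rabs_pos. }
  assert (Nonneg : forall x, 0 <= slope p x).
  { intros x. apply Rnot_lt_le. intros L.
    (* By the Lipschitz constant [30000 = 10 * 3000], a negative slope at the supremum would persist
       for all amplitudes within [mu]. *)
    set (mu := - slope p x / 60000). assert (Pm : 0 < mu) by (unfold mu; lra).
    assert (W : exists b, Good b /\ a - mu < b).
    { apply NNPP. intros W. assert (U : is_upper_bound Good (a - mu)).
      { intros b Gb. apply Rnot_lt_le. intros C. apply W. exists b. auto. }
      generalize (Lub _ U). lra. }
    destruct W as (b & Gb & Hb). assert (Hba := Ub b Gb).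
    destruct Gb as (Hb' & q & s & Hq & Pq).
    assert (D := Cmp b q s x Hb' Hq). rewrite (Rabs_left1 (b - a)) in D by lra.
    apply Rabs_le_between in D. generalize (Pq x). unfold mu in *. lra. }
  exists a, p, t. split; [apply Ex, Ha |]. split; [exact Hs |]. split; [exact Nonneg |].
  destruct (slope_min p _ (solves_bound _ _ _ _ Hs)) as [x0 H0].
  exists x0. destruct (Nonneg x0) as [P | E]; [| auto]. exfalso.
  (* [a = a2] is excluded, because there the slope is negative at [PI / 2]. *)
  assert (La : a < a2).
  { destruct (proj2 Ha) as [| E]; auto. exfalso. rewrite E in Hs.
    assert (S := supercritical_slope g p t Hg Hs). generalize (H0 (PI / 2)). lra. }
  (* A positive minimum leaves room for a larger amplitude that is still [Good], against the choice
     of [a]. *)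
  set (b := Rmin a2 (a + slope p x0 / 30000)).
  assert (Hb : a < b) by (apply Rmin_glb_lt; lra).
  assert (Hb1 : b <= a2) by apply Rmin_l.
  assert (Hb2 : b <= a + slope p x0 / 30000) by apply Rmin_r.
  assert (Gb : Good b).
  { split; [lra |]. destruct (solution_exists b g (Ex b ltac:(lra)) Hg') as (q & s & Hq).
    exists q, s. split; auto. intros x.
    assert (D := Cmp b q s x ltac:(lra) Hq). rewrite (Rabs_right (b - a)) in D by lra.
    apply Rabs_le_between in D. generalize (H0 x). lra. }
  generalize (Ub b Gb). lra.
Qed.

(** * Differentiation up to the boundary *)

Lemma rdiff_plus f g l k w : rdiff f l w -> rdiff g k w ->
  rdiff (fun w => f w + g w) (Cplus l k) w.
Proof.
  intros Hf Hg eps He.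
  destruct (Hf (eps / 2) ltac:(lra)) as (d1 & P1 & H1).
  destruct (Hg (eps / 2) ltac:(lra)) as (d2 & P2 & H2).
  exists (Rmin d1 d2). split; [apply Rmin_pos; auto |]. intros w' Hw' D.
  specialize (H1 w' Hw' ltac:(eapply Rlt_le_trans; [exact D | apply Rmin_l])).
  specialize (H2 w' Hw' ltac:(eapply Rlt_le_trans; [exact D | apply Rmin_r])).
  replace (f w' + g w' - (f w + g w) - Re (Cmult (Cplus l k) (Cminus w' w))) with
    ((f w' - f w - Re (Cmult l (Cminus w' w))) + (g w' - g w - Re (Cmult k (Cminus w' w))))
    by (unfold Cplus, Cmult, Cminus, Copp, Re, Im; cbn [fst snd]; ring).
  eapply Rle_trans; [apply Rabs_triang |]. lra.
Qed.

Lemma rdiff_const (c : R) w : rdiff (fun _ => c) (RtoC 0) w.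
Proof.
  intros eps He. exists 1. split; [lra |]. intros w' _ _.
  replace (c - c - Re (Cmult (RtoC 0) (Cminus w' w))) with 0
    by (unfold Cmult, RtoC, Cplus, Cminus, Copp, Re, Im; cbn [fst snd]; ring).
  rewrite Rabs_R0. destruct (dist1_Cmod w w') as [D _]. nra.
Qed.

Lemma rdiff_scal (c : R) f l w : rdiff f l w -> rdiff (fun w => c * f w) (Cmult (RtoC c) l) w.
Proof.
  intros Hf eps He. assert (Pc := Rabs_pos c).
  destruct (Hf (eps / (Rabs c + 1)) ltac:(apply Rdiv_lt_0_compat; lra)) as (d & P & H).
  exists d. split; auto. intros w' Hw' D. specialize (H w' Hw' D).
  replace (c * f w' - c * f w - Re (Cmult (Cmult (RtoC c) l) (Cminus w' w))) with
    (c * (f w' - f w - Re (Cmult l (Cminus w' w))))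
    by (unfold RtoC, Cplus, Cmult, Cminus, Copp, Re, Im; cbn [fst snd]; ring).
  rewrite Rabs_mult.
  apply Rle_trans with (Rabs c * (eps / (Rabs c + 1) * dist1 w w')); [apply Rmult_le_compat_l; auto |].
  destruct (dist1_Cmod w w') as [D0 _].
  replace (Rabs c * (eps / (Rabs c + 1) * dist1 w w')) with (Rabs c / (Rabs c + 1) * (eps * dist1 w w')) by (field; lra).
  rewrite <- (Rmult_1_l (eps * dist1 w w')) at 2.
  apply Rmult_le_compat_r; [apply Rmult_le_pos; lra |].
  apply Rmult_le_reg_r with (Rabs c + 1); [lra |]. unfold Rdiv. rewrite Rmult_assoc, Rinv_l by lra. lra.
Qed.

Lemma rdiff_eq f g l k w : (forall w, f w = g w) -> l = k -> rdiff f l w -> rdiff g k w.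
Proof.
  intros E <- Hf eps He. destruct (Hf eps He) as (d & P & H). exists d. split; auto.
  intros w' Hw' D. rewrite <- !E. auto.
Qed.

Lemma rdiff_sqr f l w : rdiff f l w -> rdiff (fun w => f w * f w) (Cmult (RtoC (2 * f w)) l) w.
Proof.
  intros Hf eps He.
  set (m := Cmod l). assert (Pm : 0 <= m) by apply Cmod_ge_0.
  assert (Pf := Rabs_pos (f w)).
  set (e1 := eps / (2 * (2 * Rabs (f w) + 1))).
  assert (Pe1 : 0 < e1) by (apply Rdiv_lt_0_compat; lra).
  destruct (Hf e1 Pe1) as (d1 & P1 & H1). destruct (Hf 1 ltac:(lra)) as (d2 & P2 & H2).
  set (d3 := eps / (2 * ((m + 1) * (m + 1)))).
  assert (Pm2 : 0 < (m + 1) * (m + 1)) by (apply Rmult_lt_0_compat; lra).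
  assert (P3 : 0 < d3) by (apply Rdiv_lt_0_compat; lra).
  exists (Rmin d1 (Rmin d2 d3)). split; [repeat apply Rmin_pos; auto |]. intros w' Hw' D.
  assert (D1 : dist1 w w' < d1) by (eapply Rlt_le_trans; [exact D | apply Rmin_l]).
  assert (D2 : dist1 w w' < d2)
    by (eapply Rlt_le_trans; [exact D | eapply Rle_trans; [apply Rmin_r | apply Rmin_l]]).
  assert (D3 : dist1 w w' < d3)
    by (eapply Rlt_le_trans; [exact D | eapply Rle_trans; [apply Rmin_r | apply Rmin_r]]).
  specialize (H1 w' Hw' D1). specialize (H2 w' Hw' D2).
  set (h := dist1 w w') in *. assert (h0 : 0 <= h) by apply dist1_Cmod.
  set (L := Re (Cmult l (Cminus w' w))) in *.
  assert (BL : Rabs L <= m * h).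
  { unfold L. eapply Rle_trans; [apply Re_Im_bound |]. rewrite Cmod_mult.
    apply Rmult_le_compat_l; auto. apply Cmod_le_dist1. }
  assert (Bf : Rabs (f w' - f w) <= (m + 1) * h).
  { replace (f w' - f w) with ((f w' - f w - L) + L) by ring.
    eapply Rle_trans; [apply Rabs_triang |]. lra. }
  replace (f w' * f w' - f w * f w - Re (Cmult (Cmult (RtoC (2 * f w)) l) (Cminus w' w))) with
    (2 * f w * (f w' - f w - L) + (f w' - f w) * (f w' - f w))
    by (unfold L, RtoC, Cplus, Cmult, Cminus, Copp, Re, Im; cbn [fst snd]; ring).
  eapply Rle_trans; [apply Rabs_triang |]. rewrite !Rabs_mult, (Rabs_right 2) by lra.
  assert (T1 : 2 * Rabs (f w) * Rabs (f w' - f w - L) <= eps / 2 * h).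
  { apply Rle_trans with (2 * Rabs (f w) * (e1 * h)); [apply Rmult_le_compat_l; lra |].
    assert (E : (2 * Rabs (f w) + 1) * e1 = eps / 2) by (unfold e1; field; lra).
    rewrite <- E. assert (0 <= e1 * h) by (apply Rmult_le_pos; lra). lra. }
  assert (T2 : Rabs (f w' - f w) * Rabs (f w' - f w) <= eps / 2 * h).
  { apply Rle_trans with ((m + 1) * h * ((m + 1) * h)).
    - apply Rmult_le_compat; auto using Rabs_pos.
    - assert (E : (m + 1) * (m + 1) * d3 = eps / 2) by (unfold d3; field; lra).
      rewrite <- E. replace ((m + 1) * h * ((m + 1) * h)) with ((m + 1) * (m + 1) * h * h) by ring.
      apply Rmult_le_compat_r; auto. apply Rmult_le_compat_l; lra. }
  lra.
Qed.

(** Complex differentiability up to the boundary; the second multiplier comes from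
    [Im u = Re (- i u)]. *)
Definition cdiff (f : C -> C) (l w : C) : Prop :=
  rdiff (fun w => Re (f w)) l w /\ rdiff (fun w => Im (f w)) (Cmult (Copp Ci) l) w.

Lemma cdiff_of_increment f l w M : 0 <= M ->
  (forall w', Im w' <= 0 -> Cmod (increment f l w w') <= M * (dist1 w w' * dist1 w w')) ->
  cdiff f l w.
Proof.
  intros PM Hf. split; apply rdiff_of_increment with M; auto; intros w' Hw';
    destruct (Re_Im_bound (increment f l w w')) as [B1 B2]; specialize (Hf w' Hw').
  - replace (Re (f w') - Re (f w) - Re (Cmult l (Cminus w' w))) with (Re (increment f l w w')); [lra | reflexivity].
  - replace (Im (f w') - Im (f w) - Re (Cmult (Cmult (Copp Ci) l) (Cminus w' w)))
      with (Im (increment f l w w')); [lra |].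
    unfold increment, Cminus, Cplus, Copp, Cmult, Ci, Re, Im. cbn [fst snd]. ring.
Qed.

Lemma fourier_increment a M w w' : Im w <= 0 -> Im w' <= 0 -> l1_le a M ->
  Cmod (increment (fourier a) (Cmult (Copp Ci) (fourier (nmul a) w)) w w')
    <= 125000 * M * (dist1 w w' * dist1 w w').
Proof.
  intros Hw Hw' Ha. destruct (fourier_remainder a M w w' Hw Hw' Ha) as [R1 R2].
  eapply Rle_trans; [apply Cmod_le_Re_Im |].
  replace (Re (increment (fourier a) (Cmult (Copp Ci) (fourier (nmul a) w)) w w')) with
    (Re (fourier a w') - Re (fourier a w)
    - ((Im w' - Im w) * Re (fourier (nmul a) w) + (Re w' - Re w) * Im (fourier (nmul a) w)))
    by (unfold increment, Cminus, Cplus, Copp, Cmult, Ci, Re, Im; cbn [fst snd]; ring).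
  replace (Im (increment (fourier a) (Cmult (Copp Ci) (fourier (nmul a) w)) w w')) with
    (Im (fourier a w') - Im (fourier a w)
    - ((Im w' - Im w) * Im (fourier (nmul a) w) - (Re w' - Re w) * Re (fourier (nmul a) w)))
    by (unfold increment, Cminus, Cplus, Copp, Cmult, Ci, Re, Im; cbn [fst snd]; ring).
  lra.
Qed.

Lemma fourier_cdiff a M w : Im w <= 0 -> l1_le a M ->
  cdiff (fourier a) (Cmult (Copp Ci) (fourier (nmul a) w)) w.
Proof.
  intros Hw Ha. apply cdiff_of_increment with (125000 * M).
  - generalize (l1_ge0 _ _ Ha). lra.
  - intros w' Hw'. apply fourier_increment; auto.
Qed.

Lemma fourier_Cmod_bound a w : Im w <= 0 -> summable a ->
  Cmod (fourier a w) <= 2 * Series (fun n => Rabs (a n)).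
Proof.
  intros Hw Ha. eapply Rle_trans; [apply Cmod_le_Re_Im |].
  assert (Rabs (Re (fourier a w)) <= 1 * Series (fun n => Rabs (a n))).
  { unfold fourier; cbn [Re Im fst snd]. apply (Series_abs_le a (fun n => Re (mode n w))); auto.
    intros; apply mode_bound, Hw. }
  assert (Rabs (Im (fourier a w)) <= 1 * Series (fun n => Rabs (a n))).
  { unfold fourier; cbn [Re Im fst snd]. apply (Series_abs_le a (fun n => Im (mode n w))); auto.
    intros; apply mode_bound, Hw. }
  lra.
Qed.

Lemma fourier_Cmod_lipschitz a M w w' : Im w <= 0 -> Im w' <= 0 -> l1_le a M ->
  Cmod (Cminus (fourier a w') (fourier a w)) <= 500 * M * dist1 w w'.
Proof.
  intros Hw Hw' Ha. destruct (nmul_series1 _ _ Ha) as [Sn Ln].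
  destruct (fourier_lipschitz a w w' Hw Hw' (l1_summable _ _ Ha) Sn) as [L1 L2].
  eapply Rle_trans; [apply Cmod_le_Re_Im |].
  unfold Cminus, Cplus, Copp, Re, Im in *. cbn [fst snd]. unfold Rminus in *.
  destruct (dist1_Cmod w w') as [D0 _].
  set (s := Series _) in *. assert (dist1 w w' * s <= dist1 w w' * (250 * M)) by (apply Rmult_le_compat_l; auto).
  lra.
Qed.

Lemma Rdiv_le_compat_bounds x y u v : 0 <= x -> x <= y -> 0 < u -> u <= v -> x / v <= y / u.
Proof.
  intros Hx Hxy Hu Huv. apply Rmult_le_compat; auto.
  - left. apply Rinv_0_lt_compat. lra.
  - apply Rinv_le_contravar; auto.
Qed.

(** The remainder splits exactly into two terms: the numerator of the derivative times the change of
    [fourier b], and the remainders of the two series. Both are quadratic in the distance, over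
    denominators bounded below by powers of [beta]. *)
Lemma fourier_quotient_cdiff a b Ma Mb beta w : Im w <= 0 -> l1_le a Ma -> l1_le b Mb -> 0 < beta ->
  (forall w, Im w <= 0 -> beta <= Cmod (fourier b w)) ->
  cdiff (fun w => Cdiv (fourier a w) (fourier b w))
    (Cmult (Copp Ci) (Cdiv (Cminus (Cmult (fourier (nmul a) w) (fourier b w))
                                   (Cmult (fourier a w) (fourier (nmul b) w)))
                           (Cmult (fourier b w) (fourier b w)))) w.
Proof.
  intros Hw Ha Hb Pb Hbeta.
  assert (Nb : forall w, Im w <= 0 -> fourier b w <> RtoC 0).
  { intros w' Hw' E. specialize (Hbeta w' Hw'). rewrite E, Cmod_0 in Hbeta. lra. }
  set (A := fourier a w). set (B := fourier b w). set (A1 := fourier (nmul a) w). set (B1 := fourier (nmul b) w).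
  assert (PMa := l1_ge0 _ _ Ha). assert (PMb := l1_ge0 _ _ Hb).
  set (N := Cminus (Cmult A1 B) (Cmult A B1)).
  set (k1 := Cmod N). set (k2 := Cmod A). set (k3 := Cmod B).
  assert (P1 : 0 <= k1) by apply Cmod_ge_0. assert (P2 : 0 <= k2) by apply Cmod_ge_0.
  assert (P3 : beta <= k3) by (apply Hbeta; auto).
  set (M := k1 * (500 * Mb) / (beta * beta * beta) + (125000 * Ma * k3 + k2 * (125000 * Mb)) / (beta * beta)).
  assert (PM : 0 <= M).
  { unfold M. apply Rplus_le_le_0_compat; apply Rmult_le_pos.
    - apply Rmult_le_pos; lra.
    - left. apply Rinv_0_lt_compat. repeat apply Rmult_lt_0_compat; auto.
    - apply Rplus_le_le_0_compat; apply Rmult_le_pos; lra.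
    - left. apply Rinv_0_lt_compat. repeat apply Rmult_lt_0_compat; auto. }
  apply cdiff_of_increment with M; auto. intros w' Hw'.
  assert (I1 := fourier_increment a Ma w w' Hw Hw' Ha).
  assert (I2 := fourier_increment b Mb w w' Hw Hw' Hb).
  assert (L := fourier_Cmod_lipschitz b Mb w w' Hw Hw' Hb).
  assert (N1 := Nb w Hw). assert (N2 := Nb w' Hw'). assert (Bw' := Hbeta w' Hw').
  fold B in N1, L. fold A1 in I1. fold B1 in I2.
  set (r1 := increment (fourier a) (Cmult (Copp Ci) A1) w w') in *.
  set (r2 := increment (fourier b) (Cmult (Copp Ci) B1) w w') in *.
  set (B' := fourier b w') in *. set (A' := fourier a w').
  set (h := Cminus w' w). set (d := dist1 w w') in *.
  assert (E : increment (fun w => Cdiv (fourier a w) (fourier b w))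
      (Cmult (Copp Ci) (Cdiv N (Cmult B B))) w w' =
    Cplus (Cdiv (Cmult (Cmult (Cmult Ci N) h) (Cminus B' B)) (Cmult (Cmult B B) B'))
          (Cdiv (Cminus (Cmult r1 B) (Cmult A r2)) (Cmult B B'))).
  { unfold increment at 1. fold A B A' B' h.
    replace r1 with (Cminus (Cminus A' A) (Cmult (Cmult (Copp Ci) A1) h)) by reflexivity.
    replace r2 with (Cminus (Cminus B' B) (Cmult (Cmult (Copp Ci) B1) h)) by reflexivity.
    unfold N. field. auto. }
  fold N. rewrite E. clear E.
  assert (Mh : Cmod h <= d) by apply Cmod_le_dist1.
  assert (h0 := Cmod_ge_0 h). assert (d0 : 0 <= d) by lra.
  assert (NB : Cmult B B <> RtoC 0) by (apply Cmult_neq_0; auto).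
  eapply Rle_trans; [apply Cmod_triangle |].
  rewrite !Cmod_div by (repeat apply Cmult_neq_0; auto).
  rewrite !Cmod_mult, Cmod_Ci, Rmult_1_l. fold k1 k3.
  unfold M. rewrite Rmult_plus_distr_r. apply Rplus_le_compat.
  - replace (k1 * (500 * Mb) / (beta * beta * beta) * (d * d))
      with (k1 * d * (500 * Mb * d) / (beta * beta * beta)) by (field; lra).
    apply Rdiv_le_compat_bounds.
    + repeat apply Rmult_le_pos; auto. apply Cmod_ge_0.
    + apply Rmult_le_compat; auto; [apply Rmult_le_pos; auto | apply Cmod_ge_0 | apply Rmult_le_compat_l; auto].
    + repeat apply Rmult_lt_0_compat; auto.
    + apply Rmult_le_compat; try lra; [apply Rmult_le_pos; lra | apply Rmult_le_compat; lra].
  - replace ((125000 * Ma * k3 + k2 * (125000 * Mb)) / (beta * beta) * (d * d))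
      with ((125000 * Ma * (d * d) * k3 + k2 * (125000 * Mb * (d * d))) / (beta * beta)) by (field; lra).
    apply Rdiv_le_compat_bounds.
    + apply Cmod_ge_0.
    + unfold Cminus at 1. eapply Rle_trans; [apply Cmod_triangle |]. rewrite Cmod_opp, !Cmod_mult.
      fold k2 k3. apply Rplus_le_compat.
      * apply Rmult_le_compat_r; [lra | exact I1].
      * apply Rmult_le_compat_l; [auto | exact I2].
    + apply Rmult_lt_0_compat; auto.
    + apply Rmult_le_compat; lra.
Qed.

(** * Continuity up to the boundary *)

Definition rcont (f : C -> R) (w : C) : Prop :=
  filterlim f (within closed_lower_half_plane (locally w)) (locally (f w)).

Lemma rcont_plus f g w : rcont f w -> rcont g w -> rcont (fun w => f w + g w) w.
Proof.
  intros Hf Hg.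
  apply (@filterlim_comp_2 C R R R (within closed_lower_half_plane (locally w))
    (locally (f w)) (locally (g w)) (locally (f w + g w)) _ f g Rplus Hf Hg).
  apply (filterlim_plus (f w) (g w)).
Qed.

Lemma rcont_mult f g w : rcont f w -> rcont g w -> rcont (fun w => f w * g w) w.
Proof.
  intros Hf Hg.
  apply (@filterlim_comp_2 C R R R (within closed_lower_half_plane (locally w))
    (locally (f w)) (locally (g w)) (locally (f w * g w)) _ f g Rmult Hf Hg).
  apply (filterlim_mult (f w) (g w)).
Qed.

Lemma rcont_opp f w : rcont f w -> rcont (fun w => - f w) w.
Proof.
  intros Hf. apply (filterlim_comp _ _ _ f Ropp _ _ _ Hf). apply (filterlim_opp (f w)).
Qed.

Lemma rcont_inv f w : f w <> 0 -> rcont f w -> rcont (fun w => / f w) w.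
Proof.
  intros N Hf. apply (filterlim_comp _ _ _ f Rinv _ _ _ Hf).
  apply continuity_pt_filterlim.
  apply (continuity_pt_inv id); [apply derivable_continuous_pt, derivable_pt_id | exact N].
Qed.

Lemma rcont_const (c : R) w : rcont (fun _ => c) w.
Proof. apply filterlim_const. Qed.

Lemma ccont_parts f w : continuous_at_closed f w <->
  rcont (fun w => Re (f w)) w /\ rcont (fun w => Im (f w)) w.
Proof.
  split.
  - intros Hf. split; intros P [e He]; destruct (Hf e (cond_pos e)) as (d & Pd & Hd);
      apply locally_dist1; exists d; split; auto; intros w' D Hw'; apply He;
      specialize (Hd w' Hw' D); unfold dist1 in Hd;
      generalize (Rabs_pos (Re (f w') - Re (f w))) (Rabs_pos (Im (f w') - Im (f w)));
      intros; unfold ball; simpl; unfold AbsRing_ball, abs, minus, plus, opp; simpl;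
      unfold Rminus in *; lra.
  - intros [H1 H2] eps He.
    assert (P2 : 0 < eps / 2) by lra.
    destruct (proj1 (locally_dist1 w _) (H1 _ (locally_ball _ (mkposreal _ P2)))) as (d1 & Pd1 & Hd1).
    destruct (proj1 (locally_dist1 w _) (H2 _ (locally_ball _ (mkposreal _ P2)))) as (d2 & Pd2 & Hd2).
    exists (Rmin d1 d2). split; [apply Rmin_pos; auto |]. intros w' Hw' D.
    assert (B1 := Hd1 w' ltac:(eapply Rlt_le_trans; [exact D | apply Rmin_l]) Hw').
    assert (B2 := Hd2 w' ltac:(eapply Rlt_le_trans; [exact D | apply Rmin_r]) Hw').
    change (Rabs (Re (f w') - Re (f w)) < eps / 2) in B1.
    change (Rabs (Im (f w') - Im (f w)) < eps / 2) in B2.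
    unfold dist1. lra.
Qed.

Lemma continuous_at_closed_plus f g w : continuous_at_closed f w -> continuous_at_closed g w ->
  continuous_at_closed (fun w => Cplus (f w) (g w)) w.
Proof.
  intros Hf Hg. apply ccont_parts in Hf. apply ccont_parts in Hg.
  apply ccont_parts. split.
  - apply (rcont_plus (fun w => Re (f w)) (fun w => Re (g w))); tauto.
  - apply (rcont_plus (fun w => Im (f w)) (fun w => Im (g w))); tauto.
Qed.

Lemma continuous_at_closed_mult f g w : continuous_at_closed f w -> continuous_at_closed g w ->
  continuous_at_closed (fun w => Cmult (f w) (g w)) w.
Proof.
  intros Hf Hg. apply ccont_parts in Hf. apply ccont_parts in Hg.
  destruct Hf as [F1 F2]. destruct Hg as [G1 G2].
  apply ccont_parts. split.
  - apply (rcont_plus (fun w => Re (f w) * Re (g w)) (fun w => - (Im (f w) * Im (g w)))).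
    + apply rcont_mult; auto.
    + apply (rcont_opp (fun w => Im (f w) * Im (g w))), rcont_mult; auto.
  - apply (rcont_plus (fun w => Re (f w) * Im (g w)) (fun w => Im (f w) * Re (g w)));
      apply rcont_mult; auto.
Qed.

Lemma continuous_at_closed_inv f w : f w <> RtoC 0 -> continuous_at_closed f w ->
  continuous_at_closed (fun w => Cinv (f w)) w.
Proof.
  intros N Hf. apply ccont_parts in Hf. destruct Hf as [F1 F2].
  assert (D : rcont (fun w => / (Re (f w) * Re (f w) + Im (f w) * Im (f w))) w).
  { apply (rcont_inv (fun w => Re (f w) * Re (f w) + Im (f w) * Im (f w))).
    - intros E. apply N. apply Rplus_sqr_eq_0 in E. destruct E.
      apply injective_projections; auto.
    - apply (rcont_plus (fun w => Re (f w) * Re (f w)) (fun w => Im (f w) * Im (f w)));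
        apply rcont_mult; auto. }
  assert (E : forall u : C, Re (Cinv u) = Re u * / (Re u * Re u + Im u * Im u) /\
                            Im (Cinv u) = - Im u * / (Re u * Re u + Im u * Im u)).
  { intros [x y]. unfold Cinv, Re, Im. cbn [fst snd]. rewrite <- !Rsqr_pow2. split; reflexivity. }
  apply ccont_parts. split.
  - apply filterlim_ext with (fun w => Re (f w) * / (Re (f w) * Re (f w) + Im (f w) * Im (f w))).
    + intros u. symmetry. apply E.
    + rewrite (proj1 (E (f w))). apply (rcont_mult (fun w => Re (f w))); auto.
  - apply filterlim_ext with (fun w => - Im (f w) * / (Re (f w) * Re (f w) + Im (f w) * Im (f w))).
    + intros u. symmetry. apply E.
    + rewrite (proj2 (E (f w))). apply (rcont_mult (fun w => - Im (f w))); auto.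
      apply rcont_opp; auto.
Qed.

Lemma continuous_at_closed_const (c : C) w : continuous_at_closed (fun _ => c) w.
Proof. apply ccont_parts. split; apply rcont_const. Qed.

Lemma fourier_continuous a w : Im w <= 0 -> summable a -> summable (nmul a) ->
  continuous_at_closed (fourier a) w.
Proof.
  intros Hw Ha Hn.
  set (s := Series (fun n => Rabs (nmul a n))).
  assert (Ps : 0 <= s).
  { unfold s. rewrite <- (Rmult_0_l (Series (fun _ => 0))), <- Series_scal_l.
    apply Series_le; auto. intros n. rewrite Rmult_0_l. split; [lra | apply Rabs_pos]. }
  apply continuous_of_lipschitz with (2 * s); [lra |].
  intros w' Hw'. destruct (fourier_lipschitz a w w' Hw Hw' Ha Hn).
  unfold dist1 at 1. fold s in H, H0. lra.
Qed.

(** * Transfer from the half-plane to the fluid domain *)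

Section Transfer.
Context (z zd : C -> C) (K : R) (H : half_plane_map z zd K).

(** If the differential in the half-plane is [mu * zd], dividing by [zd] leaves [mu] as the
    differential in the fluid, hence the gradient [(Re mu, - Im mu)]. *)
Lemma C1_transfer (E : R * R -> Prop) (f : C -> R) (mu : C -> C) :
  (forall q, E q -> image_closed z q) ->
  (forall w, Im w <= 0 -> E (z w) -> rdiff f (Cmult (mu w) (zd w)) w) ->
  (forall w, Im w <= 0 -> E (z w) -> continuous_at_closed mu w) ->
  C1_with_gradient E (fun q => f (inverse z q))
    (fun q => (Re (mu (inverse z q)), - Im (mu (inverse z q)))).
Proof.
  intros HE Hf Hmu. split.
  - intros p Ep. destruct (inverse_spec z p (HE p Ep)) as [W1 W2].
    assert (F := inverse_filterdiff z zd K H E f _ p (HE p Ep) Ep HE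
      (Hf (inverse z p) W1 ltac:(rewrite W2; exact Ep))).
    replace (Cdiv (Cmult (mu (inverse z p)) (zd (inverse z p))) (zd (inverse z p)))
      with (mu (inverse z p)) in F.
    2: { unfold Cdiv. rewrite <- Cmult_assoc, Cinv_r, Cmult_1_r; auto. apply (hm_regular _ _ _ H), W1. }
    exact F.
  - apply (inverse_continuous z zd K H E (fun w => (Re (mu w), - Im (mu w)))); auto.
    intros p Ep. destruct (inverse_spec z p (HE p Ep)) as [W1 W2].
    assert (Cm := Hmu (inverse z p) W1 ltac:(rewrite W2; exact Ep)).
    apply ccont_parts in Cm. apply ccont_parts. cbn [Re Im fst snd]. split; [tauto |].
    apply (rcont_opp (fun w => Im (mu w))). tauto.
Qed.

(** A symmetry of the plane is lifted to [tau] on the half-plane; [tau'] lifts its inverse and gives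
    the converse inclusion for the domain. *)
Lemma invariant_lift (T T' : R * R -> R * R) (tau tau' : C -> C) (f : C -> R) :
  (forall p, T' (T p) = p) ->
  (forall w, Im w <= 0 -> z (tau w) = T (z w)) -> (forall w, Im w <= 0 -> z (tau' w) = T' (z w)) ->
  (forall w, Im (tau w) = Im w) -> (forall w, Im (tau' w) = Im w) ->
  (forall w, Im w <= 0 -> f (tau w) = f w) ->
  invariant_under T (image_domain z) (free_surface z) (fun q => f (inverse z q)).
Proof.
  intros TT E1 E2 I1 I2 Ef. split.
  - intros p. split.
    + intros [w [Hw E]]. exists (tau' w). rewrite I2. split; auto.
      rewrite E2, E, TT by lra. reflexivity.
    + intros [w [Hw E]]. exists (tau w). rewrite I1. split; auto. rewrite E1, E by lra. reflexivity.
  - intros p Hp. apply image_closed_iff in Hp. destruct Hp as [w [Hw <-]].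
    rewrite <- E1, !(inverse_z z zd K H) by (rewrite ?I1; auto). apply Ef, Hw.
Qed.

End Transfer.

(** * The wave *)

Section Wave.
Context (a g : R) (p t : nat -> R).
Context (Hs : solves a g p t) (Hg : Rabs g <= gmax) (Ha : Rabs (a - 2 * A0) <= delta0).
Context (Hslope : forall x, 0 <= slope p x).

Let N : near_crapper p t := proj1 Hs.
Let c : R := speed a g p t.
Let v : nat -> R := vcoef p.
Let Hp : l1_le p (245 / 100) := proj1 (near_crapper_bounds p t N).
Let Ht : l1_le t 7 := proj2 (near_crapper_bounds p t N).

(** [a] is close to [2 * A0] and the gravity term is tiny. Positivity allows the division by [2 * c]
    in [y0]. *)
Lemma wave_speed_pos : 0 < c.
Proof.
  assert (B := A0_bounds). destruct (ycoef_near p t N) as [Y _].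
  unfold c, speed. apply Rdiv_lt_0_compat; [| lra].
  assert (Z := l1_coeff _ _ 1 (l1_zcoef _ _ _ _ Hp Ht)).
  assert (Rabs (g * zcoef p t 1) <= gmax * (245 / 100 * 7)).
  { rewrite Rabs_mult. apply Rmult_le_compat; auto using Rabs_pos. }
  apply Rabs_le_between in H. apply Rabs_le_between in Ha. unfold gmax, delta0 in *. lra.
Qed.

(* The constant term of the antianalytic part of [s conj p - (m + 2 c y) p]. *)
Let q0 : R := p 0%nat + g * zcoef p t 0 - c * ycoef p 0.
Let m : R := q0 - c * conv v p 0.
Let y0 : R := (m - 1) / (2 * c).
(* The analytic part, whose value at infinity vanishes by the choice of [m]; shifting [y] by
   [y0] turns [m + 2 c y] into [1 + 2 c y]. *)
Let kap (n : nat) : R :=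
  g / 2 * hank t p n - c * conv v p n - c * hank p v n - m * p n
  + delta_seq (q0 - g / 2 * hank t p 0 + c * hank p v 0) n.

Let Hv : l1_le v (245 / 100 * (245 / 100)) := l1_vcoef p _ Hp.

Lemma wave_kap_l1 : exists M, l1_le kap M.
Proof.
  eexists. apply l1_plus; [apply l1_minus; [apply l1_minus; [apply l1_minus |] |] |].
  - apply l1_scal, l1_hank; [exact Ht | exact Hp].
  - apply l1_scal, l1_conv; [exact Hv | exact Hp].
  - apply l1_scal, l1_hank; [exact Hp | exact Hv].
  - apply l1_scal, Hp.
  - apply l1_delta_seq.
Qed.

Lemma wave_kap_0 : kap 0 = 0.
Proof.
  assert (p0 := proj1 N). unfold kap, m. rewrite p0. simpl delta_seq. ring.
Qed.

Definition wave_z (w : C) : C := (Re w - Im (fourier v w), Im w + Re (fourier v w) + y0).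
Definition wave_zd (w : C) : C := fourier (conv p p) w.

Lemma wave_zd_eq w : Im w <= 0 -> wave_zd w = Cmult (fourier p w) (fourier p w).
Proof. intros Hw. apply fourier_conv; auto; apply (l1_summable _ _ Hp). Qed.

(** The derivative of [i v] is [fourier (nmul v)], so this is [dz/dw = p ^ 2] for [z = w + i v]; the
    constant term 1 of [p ^ 2] comes from [w]. *)
Lemma wave_nmul_v w : Im w <= 0 -> fourier (nmul v) w = Cminus (wave_zd w) (RtoC 1).
Proof.
  intros Hw. unfold wave_zd. rewrite <- (fourier_delta_seq 1 w), <- fourier_minus; auto.
  - apply fourier_ext. intros [|n]; unfold nmul, v, vcoef, int0.
    + assert (p0 := proj1 N). unfold conv, PS_mult. simpl. rewrite p0. ring.
    + rewrite S_INR. simpl delta_seq. assert (P := pos_INR n). field. lra.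
  - apply (l1_summable _ _ (l1_conv _ _ _ _ Hp Hp)).
  - apply (l1_summable _ _ (l1_delta_seq 1)).
Qed.

Lemma wave_p_pos w : Im w <= 0 -> 1 / 10 <= Re (fourier p w).
Proof. exact (near_crapper_Re_pos p t N w). Qed.

Lemma wave_p_neq_0 w : Im w <= 0 -> fourier p w <> RtoC 0.
Proof.
  intros Hw E. assert (P := wave_p_pos w Hw). rewrite E in P. simpl in P. lra.
Qed.

Lemma wave_boundary_cone x : Rabs (Im (fourier p (x, 0))) <= Re (fourier p (x, 0)).
Proof.
  assert (S := Hslope x). rewrite (slope_eq p _ x Hp) in S.
  assert (P := wave_p_pos (x, 0) ltac:(simpl; lra)).
  set (u := Re (fourier p (x, 0))) in *. set (y := Im (fourier p (x, 0))) in *.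
  apply Rnot_lt_le. intros C. assert (E := Rabs_mult_self y). nra.
Qed.

(** The surface values of [p] lie in the cone [|Im| <= Re] by the assumption on [slope], the
    interior ones strictly inside by [near_crapper_interior], and squaring maps the open cone into
    the right half-plane. *)
Lemma wave_zd_pos w : Im w < 0 -> 0 < Re (wave_zd w).
Proof.
  intros Hw. rewrite wave_zd_eq by lra. destruct w as [x b]. simpl in Hw.
  assert (I := near_crapper_interior p t N x b Hw (wave_boundary_cone x)).
  set (F := fourier p (x, b)) in *. unfold Cmult, Re, Im in *. cbn [fst snd].
  assert (E := Rabs_mult_self (snd F)). assert (P := Rabs_pos (snd F)). nra.
Qed.

Lemma wave_half_plane_map : exists K, half_plane_map wave_z wave_zd K.
Proof.
  (* The largest constant is [62500 * 2.45 ^ 2], from the quadratic remainder of [v]; the shift [y0]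
     enters the distance from the identity. *)
  set (K := 1000000 + Rabs y0). assert (P0 := Rabs_pos y0).
  assert (Hpp := l1_conv _ _ _ _ Hp Hp).
  destruct (nmul_series1 _ _ Hpp) as [Spp Lpp]. destruct (nmul_series1 _ _ Hv) as [Sv Lv].
  exists K. split.
  - intros w w' Hw Hw'.
    destruct (fourier_remainder v _ w w' Hw Hw' Hv) as [R1 R2].
    rewrite wave_nmul_v in R1, R2 by auto.
    assert (D := proj1 (dist1_Cmod w w')).
    assert (D2 : 0 <= dist1 w w' * dist1 w w') by (apply Rmult_le_pos; auto).
    assert (L : 62500 * (245 / 100 * (245 / 100)) * (dist1 w w' * dist1 w w') <= K * (dist1 w w' * dist1 w w')).
    { apply Rmult_le_compat_r; auto. unfold K. lra. }
    unfold Cminus, Cplus, Copp, RtoC, Re, Im in R1, R2. cbn [fst snd] in R1, R2.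
    unfold increment, wave_z, Cminus, Cplus, Copp, Cmult, Re, Im. cbn [fst snd].
    split; (eapply Rle_trans; [| exact L]).
    + rewrite <- Rabs_Ropp. eapply Rle_trans; [| exact R2]. apply Req_le. f_equal. ring.
    + eapply Rle_trans; [| exact R1]. apply Req_le. f_equal. ring.
  - intros w w' Hw Hw'.
    destruct (fourier_lipschitz _ w w' Hw Hw' (l1_summable _ _ Hpp) Spp) as [L1 L2].
    assert (D := proj1 (dist1_Cmod w w')).
    assert (L : dist1 w w' * Series (fun n => Rabs (nmul (conv p p) n)) <= K * dist1 w w').
    { rewrite Rmult_comm. apply Rmult_le_compat_r; auto. unfold K. lra. }
    unfold wave_zd. lra.
  - intros w w' Hw Hw'.
    destruct (fourier_lipschitz _ w w' Hw Hw' (l1_summable _ _ Hv) Sv) as [L1 L2].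
    assert (D := proj1 (dist1_Cmod w w')).
    assert (L : dist1 w w' * Series (fun n => Rabs (nmul v n)) <= (K - 1) * dist1 w w').
    { rewrite Rmult_comm. apply Rmult_le_compat_r; auto. unfold K. lra. }
    assert (D1 : Rabs (Re w' - Re w) <= dist1 w w' /\ Rabs (Im w' - Im w) <= dist1 w w').
    { unfold dist1. generalize (Rabs_pos (Re w' - Re w)) (Rabs_pos (Im w' - Im w)). lra. }
    change (Rabs (Re w' - Im (fourier v w') - (Re w - Im (fourier v w))) <= K * dist1 w w' /\
      Rabs (Im w' + Re (fourier v w') + y0 - (Im w + Re (fourier v w) + y0)) <= K * dist1 w w').
    split.
    + replace (Re w' - Im (fourier v w') - (Re w - Im (fourier v w))) with
        ((Re w' - Re w) - (Im (fourier v w') - Im (fourier v w))) by ring.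
      eapply Rle_trans; [apply Rabs_triang |]. rewrite Rabs_Ropp. lra.
    + replace (Im w' + Re (fourier v w') + y0 - (Im w + Re (fourier v w) + y0)) with
        ((Im w' - Im w) + (Re (fourier v w') - Re (fourier v w))) by ring.
      eapply Rle_trans; [apply Rabs_triang |]. lra.
  - apply wave_zd_pos.
  - intros w Hw. destruct (Rlt_dec (Im w) 0) as [L | L]; [left; apply wave_zd_pos, L |].
    destruct w as [x b]. assert (b = 0) by (simpl in *; lra). subst b. apply Hslope.
  - intros w Hw. rewrite wave_zd_eq by auto. apply Cmult_neq_0; apply wave_p_neq_0; auto.
  - intros w Hw. destruct (fourier_bound v _ w Hw Hv) as [B1 B2].
    change (Rabs (Re w - Im (fourier v w) - Re w) <= K /\
      Rabs (Im w + Re (fourier v w) + y0 - Im w) <= K). split.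
    + replace (Re w - Im (fourier v w) - Re w) with (- Im (fourier v w)) by ring.
      rewrite Rabs_Ropp. unfold K. lra.
    + replace (Im w + Re (fourier v w) + y0 - Im w) with (Re (fourier v w) + y0) by ring.
      eapply Rle_trans; [apply Rabs_triang |]. unfold K. lra.
Qed.

Let s (x : R) : R := 1 + g * Re (fourier t (x, 0)).

(** [fourier_mult_conj] splits the right side into two parts. The antianalytic one is the constant
    [q0] by [solves_equations], and [kap] collects the rest. *)
Lemma wave_kap_boundary x : let F := fourier p (x, 0) in
  fourier kap (x, 0) =
  Cminus (Cmult (RtoC (s x)) (Cconj F)) (Cmult (RtoC (m + 2 * c * Re (fourier v (x, 0)))) F).
Proof.
  intros F. assert (Hw : Im (x, 0) <= 0) by (simpl; lra).
  set (w := (x, 0) : C) in *.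
  assert (Sp := l1_summable _ _ Hp). assert (St := l1_summable _ _ Ht). assert (Sv := l1_summable _ _ Hv).
  assert (Shtp := l1_summable _ _ (l1_hank _ _ _ _ Ht Hp)).
  assert (Shpt := l1_summable _ _ (l1_hank _ _ _ _ Hp Ht)).
  assert (Shpv := l1_summable _ _ (l1_hank _ _ _ _ Hp Hv)).
  assert (Shvp := l1_summable _ _ (l1_hank _ _ _ _ Hv Hp)).
  assert (Sctp := l1_summable _ _ (l1_conv _ _ _ _ Ht Hp)).
  assert (Scvp := l1_summable _ _ (l1_conv _ _ _ _ Hv Hp)).
  assert (C1 := fourier_mult_conj t p _ _ x Ht Hp).
  assert (C2 := fourier_mult_conj p v _ _ x Hp Hv). fold w in C1, C2.
  assert (M1 := fourier_conv t p w Hw St Sp). assert (M2 := fourier_conv v p w Hw Sv Sp).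
  (* the antianalytic part is constant: this is the fixed point equation *)
  assert (Anti : fourier (fun n => p n + g / 2 * (conv t p n + hank p t n) + - c * hank v p n) w = RtoC q0).
  { rewrite <- fourier_delta_seq with (w := w). apply fourier_ext. intros [|n].
    - simpl. unfold q0, zcoef, ycoef. fold v. field.
    - simpl. destruct (solves_equations a g p t Hs) as [E _]. specialize (E (S n) ltac:(lia)).
      fold c in E. unfold zcoef, ycoef in E. fold v in E. lra. }
  rewrite !fourier_plus, !fourier_scal, fourier_plus in Anti
    by auto using summable_plus, summable_scal.
  unfold kap. rewrite fourier_plus, !fourier_minus, !fourier_scal, fourier_delta_seq
    by (auto; repeat first [apply summable_minus | apply summable_plus | apply summable_scal | assumption | apply (l1_summable _ _ (l1_delta_seq _))]).
  rewrite M2. rewrite M1 in Anti. fold F in C1, C2, M1, M2, Anti |- *.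
  set (T := fourier t w) in *. set (V := fourier v w) in *.
  set (h1 := fourier (hank t p) w) in *. set (h2 := fourier (hank p t) w) in *.
  set (h3 := fourier (hank p v) w) in *. set (h4 := fourier (hank v p) w) in *.
  unfold s. fold w T.
  assert (A1 := f_equal fst Anti). assert (A2 := f_equal snd Anti).
  assert (B1 := f_equal fst C1). assert (B2 := f_equal snd C1).
  assert (B3 := f_equal fst C2). assert (B4 := f_equal snd C2).
  apply (f_equal (Rmult (g / 2))) in B1. apply (f_equal (Rmult (g / 2))) in B2.
  apply (f_equal (Rmult c)) in B3. apply (f_equal (Rmult c)) in B4.
  unfold Cminus, Cplus, Copp, Cmult, Cconj, RtoC, Re, Im in *. cbn [fst snd] in *.
  apply injective_projections; cbn [fst snd]; lra.
Qed.

(** In real part, [qcoef] stands for [t ^ 2 + |t| ^ 2], that is [2 (Re t) ^ 2], and the equation for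
    [t] is the expanded square. *)
Lemma wave_bernoulli x : s x * s x = 1 - 2 * g * Re (fourier v (x, 0)).
Proof.
  assert (Hw : Im (x, 0) <= 0) by (simpl; lra). set (w := (x, 0) : C) in *.
  destruct (solves_equations a g p t Hs) as [_ E]. fold v in E.
  assert (St := l1_summable _ _ Ht). assert (Sv := l1_summable _ _ Hv).
  assert (Sh := l1_summable _ _ (l1_hank _ _ _ _ Ht Ht)).
  assert (Sc := l1_summable _ _ (l1_conv _ _ _ _ Ht Ht)).
  assert (C1 := fourier_mult_conj t t _ _ x Ht Ht). fold w in C1.
  assert (E' : fourier t w = fourier (fun n => (-1) * v n + (- (g / 4)) *
     (conv t t n + 2 * hank t t n - delta_seq (hank t t 0) n)) w).
  { apply fourier_ext. intros n. rewrite (E n) at 1. unfold qcoef. destruct n; simpl; ring. }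
  rewrite fourier_plus, !fourier_scal, fourier_minus, fourier_plus, !fourier_scal, fourier_delta_seq, fourier_conv in E'
    by (auto; repeat first [apply summable_minus | apply summable_plus | apply summable_scal | assumption | apply (l1_summable _ _ (l1_delta_seq _))]).
  unfold s. fold w. set (T := fourier t w) in *. set (V := fourier v w) in *.
  set (h := fourier (hank t t) w) in *.
  assert (E1 := f_equal fst E'). assert (B1 := f_equal fst C1).
  unfold Cminus, Cplus, Copp, Cmult, Cconj, RtoC, Re, Im in *. cbn [fst snd] in *.
  apply (f_equal (Rmult (g / 4))) in B1.
  set (T1 := fst T) in *. set (T2 := snd T) in *.
  assert (X : 2 * T1 + g * (T1 * T1) = - 2 * fst V).
  { assert (E2 : T1 = - fst V - g / 4 * (T1 * T1 - T2 * T2 + (T1 * T1 + T2 * T2))) by lra. lra. }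
  replace ((1 + g * T1) * (1 + g * T1)) with (1 + g * (2 * T1 + g * (T1 * T1))) by ring.
  rewrite X. ring.
Qed.

Lemma wave_c_y0 : 2 * c * y0 = m - 1.
Proof. assert (P := wave_speed_pos). unfold y0. field. lra. Qed.

(** Up to the factor [i], the decaying analytic part of the velocity. *)
Let Q (w : C) : C := Cdiv (fourier kap w) (fourier p w).
(* [mu = psi_x - i psi_y]. *)
Let mu (w : C) : C := Cmult Ci (Cplus (RtoC (1 + 2 * c * Im (wave_z w))) (Q w)).
(* The derivative of [i Q] with respect to [z]. *)
Let k (w : C) : C :=
  Cdiv (Cminus (Cmult (fourier (nmul kap) w) (fourier p w)) (Cmult (fourier kap w) (fourier (nmul p) w)))
    (Cmult (Cmult (fourier p w) (fourier p w)) (Cmult (fourier p w) (fourier p w))).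
(** Encodes the gradient of [psi_y = - Im mu], as [k] encodes that of [psi_x = Re mu]. *)
Let mu2 (w : C) : C := Cmult Ci (Cplus (RtoC (2 * c)) (k w)).
(** An antiderivative of the velocity: the first two terms have differential [i (1 + 2 c y) dz], the
    third [i Q dz = i kap p dw]. Because [kap 0 = 0], the latter integrates to a periodic series. *)
Let Psi0 (w : C) : R :=
  - c * (Im (wave_z w) * Im (wave_z w)) + (-1) * Im (wave_z w)
  + (-1) * Re (fourier (int0 (conv kap p)) w).
Let Psi (w : C) : R := Psi0 w - Psi0 (0, 0).
Let D := image_domain wave_z.
Let Sf := free_surface wave_z.
Let psi (q : R * R) : R := Psi (inverse wave_z q).

Lemma wave_Q_cdiff w : Im w <= 0 -> cdiff Q (Cmult (Copp Ci) (Cmult (k w) (wave_zd w))) w.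
Proof.
  intros Hw. destruct wave_kap_l1 as [M HM].
  assert (C1 := fourier_quotient_cdiff kap p M _ (1 / 10) w Hw HM Hp ltac:(lra)).
  assert (L : forall w, Im w <= 0 -> 1 / 10 <= Cmod (fourier p w)).
  { intros w' Hw'. assert (P := wave_p_pos w' Hw'). destruct (Re_Im_bound (fourier p w')) as [B _].
    generalize (Rle_abs (Re (fourier p w'))). lra. }
  specialize (C1 L).
  rewrite wave_zd_eq by auto.
  replace (Cmult (k w) (Cmult (fourier p w) (fourier p w))) with
    (Cdiv (Cminus (Cmult (fourier (nmul kap) w) (fourier p w)) (Cmult (fourier kap w) (fourier (nmul p) w)))
          (Cmult (fourier p w) (fourier p w))).
  - exact C1.
  - unfold k. assert (Np := wave_p_neq_0 w Hw). field. exact Np.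
Qed.

Lemma wave_y_rdiff w : Im w <= 0 ->
  rdiff (fun w => Im (wave_z w)) (Cmult (Copp Ci) (wave_zd w)) w.
Proof.
  destruct wave_half_plane_map as [K H]. intros Hw. apply (hm_rdiff wave_z wave_zd K H w Hw).
Qed.

Lemma wave_Psi0_rdiff w : Im w <= 0 -> rdiff Psi0 (Cmult (mu w) (wave_zd w)) w.
Proof.
  intros Hw. destruct wave_kap_l1 as [M HM].
  assert (Y := wave_y_rdiff w Hw).
  assert (Hk := l1_conv _ _ _ _ HM Hp).
  destruct (fourier_cdiff _ _ w Hw (l1_int0 _ _ Hk)) as [Ph _].
  assert (E : fourier (nmul (int0 (conv kap p))) w = Cmult (fourier kap w) (fourier p w)).
  { rewrite <- fourier_conv; auto using (l1_summable _ _ HM), (l1_summable _ _ Hp).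
    - apply fourier_ext. intros [|n]; unfold nmul, int0.
      + unfold conv, PS_mult. simpl. rewrite wave_kap_0. ring.
      + rewrite S_INR. assert (P := pos_INR n). field. lra. }
  rewrite E in Ph.
  assert (R1 := rdiff_scal (- c) _ _ _ (rdiff_sqr _ _ _ Y)).
  assert (R2 := rdiff_scal (-1) _ _ _ Y). assert (R3 := rdiff_scal (-1) _ _ _ Ph).
  refine (rdiff_eq _ _ _ _ w _ _ (rdiff_plus _ _ _ _ w (rdiff_plus _ _ _ _ w R1 R2) R3)).
  - intros w'. reflexivity.
  - unfold mu, Q. rewrite wave_zd_eq by auto. assert (Np := wave_p_neq_0 w Hw).
    set (F := fourier p w) in *. set (y := Im (wave_z w)). set (kw := fourier kap w).
    replace (Cmult (Cmult Ci (Cplus (RtoC (1 + 2 * c * y)) (Cdiv kw F))) (Cmult F F)) with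
      (Cplus (Cmult (Cmult Ci (RtoC (1 + 2 * c * y))) (Cmult F F)) (Cmult Ci (Cmult kw F)))
      by (field; exact Np).
    unfold Cplus, Copp, Cmult, RtoC, Ci. apply injective_projections; cbn [fst snd]; ring.
Qed.

Lemma wave_Psi_rdiff w : Im w <= 0 -> rdiff Psi (Cmult (mu w) (wave_zd w)) w.
Proof.
  intros Hw.
  refine (rdiff_eq _ _ _ _ w _ _ (rdiff_plus _ _ _ _ w (wave_Psi0_rdiff w Hw) (rdiff_const (- Psi0 (0, 0)) w))).
  - reflexivity.
  - apply injective_projections; simpl; ring.
Qed.

(** This identity carries both surface conditions: its argument makes the surface a streamline, its
    modulus gives the Bernoulli speed. *)
Lemma wave_mu_boundary x : Cmult (mu (x, 0)) (fourier p (x, 0)) =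
  Cmult Ci (Cmult (RtoC (s x)) (Cconj (fourier p (x, 0)))).
Proof.
  assert (Np := wave_p_neq_0 (x, 0) ltac:(simpl; lra)).
  assert (KB := wave_kap_boundary x). cbv zeta in KB.
  assert (Y : 1 + 2 * c * Im (wave_z (x, 0)) = m + 2 * c * Re (fourier v (x, 0))).
  { unfold wave_z. assert (E := wave_c_y0). unfold Im. cbn [snd].
    replace (1 + 2 * c * (0 + Re (fourier v (x, 0)) + y0)) with
      (1 + 2 * c * y0 + 2 * c * Re (fourier v (x, 0))) by ring.
    rewrite E. ring. }
  unfold mu, Q. rewrite Y, KB.
  set (F := fourier p (x, 0)) in *. set (r := RtoC (m + 2 * c * Re (fourier v (x, 0)))).
  field. exact Np.
Qed.

(** The derivative along the surface is [Re (mu p p) = Re (i s |p| ^ 2) = 0]. *)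
Lemma wave_Psi_boundary x : Psi (x, 0) = 0.
Proof.
  assert (Dx : forall x : R, is_derive (fun x => Psi (x, 0)) x 0).
  { intros x'. assert (Hw : Im (x', 0) <= 0) by (simpl; lra).
    assert (R1 := rdiff_boundary _ _ _ (wave_Psi_rdiff (x', 0) Hw)).
    assert (Z : Re (Cmult (mu (x', 0)) (wave_zd (x', 0))) = 0).
    { rewrite wave_zd_eq by auto. rewrite Cmult_assoc, wave_mu_boundary.
      unfold Cmult, Cconj, RtoC, Ci, Re. cbn [fst snd]. ring. }
    rewrite Z in R1. exact R1. }
  assert (P0 : Psi (0, 0) = 0) by (unfold Psi; ring).
  transitivity (Psi (0, 0)); [| exact P0].
  destruct (Rtotal_order x 0) as [L | [-> | L]]; auto.
  - apply (eq_is_derive (fun x => Psi (x, 0)) x 0); auto.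
  - symmetry. apply (eq_is_derive (fun x => Psi (x, 0)) 0 x); auto.
Qed.

Lemma wave_mu_norm x : Re (mu (x, 0)) ^ 2 + Im (mu (x, 0)) ^ 2 = s x * s x.
Proof.
  assert (E := wave_mu_boundary x). assert (P := wave_p_pos (x, 0) ltac:(simpl; lra)).
  assert (E1 := f_equal fst E). assert (E2 := f_equal snd E).
  unfold Cmult, Cconj, RtoC, Ci, Re, Im in *. cbn [fst snd] in *.
  set (u := fst (mu (x, 0))) in *. set (y := snd (mu (x, 0))) in *.
  set (F1 := fst (fourier p (x, 0))) in *. set (F2 := snd (fourier p (x, 0))) in *.
  assert (PF : 0 < F1 * F1 + F2 * F2).
  { assert (0 <= F2 * F2) by apply Rle_0_sqr. assert (0 < F1 * F1) by (apply Rmult_lt_0_compat; lra). lra. }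
  apply Rmult_eq_reg_r with (F1 * F1 + F2 * F2); [| lra].
  replace ((u ^ 2 + y ^ 2) * (F1 * F1 + F2 * F2)) with
    ((u * F1 - y * F2) * (u * F1 - y * F2) + (u * F2 + y * F1) * (u * F2 + y * F1)) by ring.
  rewrite E1, E2. ring.
Qed.

(** Since [kap 0 = 0], a factor [zeta] of modulus [exp (Im w)] splits off. *)
Lemma wave_Q_decay eps : 0 < eps -> exists M, forall w, Im w < M -> Im w <= 0 -> Cmod (Q w) < eps.
Proof.
  intros He. destruct wave_kap_l1 as [Mk HM].
  assert (Sk := l1_summable _ _ HM).
  assert (Sk' : summable (fun n => kap (S n))) by (apply (ex_series_incr_1 (fun n => Rabs (kap n))); exact Sk).
  (* 20 combines the 2 of [fourier_Cmod_bound] with the lower bound 1/10 for [|p|]; the added 1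
     keeps [L] positive. *)
  set (L := 20 * Series (fun n => Rabs (kap (S n))) + 1).
  assert (PS : 0 <= Series (fun n => Rabs (kap (S n)))).
  { assert (B := fourier_Cmod_bound (fun n => kap (S n)) (0, 0) ltac:(simpl; lra) Sk').
    cbv beta in B. generalize (Cmod_ge_0 (fourier (fun n => kap (S n)) (0, 0))). lra. }
  exists (ln (eps / L)). intros w Hl Hw.
  assert (PL : 0 < L) by (unfold L; lra).
  assert (Ee : exp (Im w) * L < eps).
  { apply exp_increasing in Hl. rewrite exp_ln in Hl by (apply Rdiv_lt_0_compat; lra).
    apply Rmult_lt_compat_r with (r := L) in Hl; auto.
    replace (eps / L * L) with eps in Hl by (field; lra). exact Hl. }
  assert (E : fourier kap w = Cmult (mode 1 w) (fourier (fun n => kap (S n)) w)).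
  { rewrite (fourier_shift kap w Hw Sk Sk'), wave_kap_0. apply injective_projections; simpl; ring. }
  assert (P := wave_p_pos w Hw). destruct (Re_Im_bound (fourier p w)) as [B _].
  assert (PP : 1 / 10 <= Cmod (fourier p w)) by (generalize (Rle_abs (Re (fourier p w))); lra).
  assert (M1 : Cmod (mode 1 w) = exp (Im w)).
  { destruct w as [x b]. rewrite mode_1. unfold Cmod. cbn [fst snd].
    assert (SC := sin2_cos2 x). unfold Rsqr in SC.
    replace ((exp b * cos x) ^ 2 + (- (exp b * sin x)) ^ 2) with
      (exp b * exp b * (sin x * sin x + cos x * cos x)) by ring.
    rewrite SC, Rmult_1_r. apply sqrt_square. left. apply exp_pos. }
  unfold Q. rewrite Cmod_div by (apply wave_p_neq_0; auto). rewrite E, Cmod_mult, M1.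
  assert (B2 := fourier_Cmod_bound (fun n => kap (S n)) w Hw Sk'). cbv beta in B2.
  set (f := Cmod (fourier (fun n => kap (S n)) w)) in *.
  assert (Pe := exp_pos (Im w)).
  apply Rle_lt_trans with (exp (Im w) * L); auto.
  apply Rmult_le_reg_r with (Cmod (fourier p w)); [lra |].
  unfold Rdiv. rewrite Rmult_assoc, Rinv_l, Rmult_1_r by lra. rewrite Rmult_assoc.
  apply Rmult_le_compat_l; [lra |].
  apply Rle_trans with (L * (1 / 10)); [unfold L; lra |]. apply Rmult_le_compat_l; lra.
Qed.

Lemma wave_fourier_continuous b M w : Im w <= 0 -> l1_le b M -> continuous_at_closed (fourier b) w.
Proof.
  intros Hw Hb. apply fourier_continuous; auto; [apply (l1_summable _ _ Hb) | apply (nmul_series1 _ _ Hb)].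
Qed.

Lemma wave_Q_continuous w : Im w <= 0 -> continuous_at_closed Q w.
Proof.
  intros Hw. destruct wave_kap_l1 as [M HM].
  apply (continuous_at_closed_mult (fourier kap) (fun w => Cinv (fourier p w))).
  - apply (wave_fourier_continuous _ _ w Hw HM).
  - apply continuous_at_closed_inv; [apply wave_p_neq_0; auto |].
    apply (wave_fourier_continuous _ _ w Hw Hp).
Qed.

Lemma wave_mu_continuous w : Im w <= 0 -> continuous_at_closed mu w.
Proof.
  intros Hw. apply continuous_at_closed_mult; [apply continuous_at_closed_const |].
  apply (continuous_at_closed_plus (fun w => RtoC (1 + 2 * c * Im (wave_z w)))); [| apply wave_Q_continuous; auto].
  destruct wave_half_plane_map as [K H].
  assert (Cz : continuous_at_closed wave_z w).
  { assert (PK := hm_K_ge0 _ _ _ H). apply continuous_of_lipschitz with (2 * K); [lra |].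
    intros w' Hw'. apply (hm_dist_le wave_z wave_zd K H); auto. }
  apply ccont_parts in Cz. apply ccont_parts. split; [| apply rcont_const].
  apply (rcont_plus (fun _ => 1) (fun w => 2 * c * Im (wave_z w))); [apply rcont_const |].
  apply (rcont_mult (fun _ => 2 * c)); [apply rcont_const | tauto].
Qed.

Lemma wave_nmul_continuous b M w : Im w <= 0 -> l1_le b M -> continuous_at_closed (fourier (nmul b)) w.
Proof.
  intros Hw Hb. apply fourier_continuous; auto; [apply (nmul_series1 _ _ Hb) |].
  apply ex_series_ext with (2 := proj1 (nmul_series _ _ Hb)).
  intros n. unfold nmul. rewrite Rmult_assoc. reflexivity.
Qed.

Lemma wave_k_continuous w : Im w <= 0 -> continuous_at_closed k w.
Proof.
  intros Hw. destruct wave_kap_l1 as [M HM].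
  assert (K1 := wave_fourier_continuous _ _ w Hw HM). assert (K2 := wave_nmul_continuous _ _ w Hw HM).
  assert (P1 := wave_fourier_continuous _ _ w Hw Hp). assert (P2 := wave_nmul_continuous _ _ w Hw Hp).
  assert (Np := wave_p_neq_0 w Hw).
  apply (continuous_at_closed_mult
    (fun w => Cminus (Cmult (fourier (nmul kap) w) (fourier p w)) (Cmult (fourier kap w) (fourier (nmul p) w)))
    (fun w => Cinv (Cmult (Cmult (fourier p w) (fourier p w)) (Cmult (fourier p w) (fourier p w))))).
  - apply (continuous_at_closed_plus (fun w => Cmult (fourier (nmul kap) w) (fourier p w))
      (fun w => Copp (Cmult (fourier kap w) (fourier (nmul p) w)))).
    + apply continuous_at_closed_mult; auto.
    + assert (G := continuous_at_closed_mult _ _ w K1 P2). apply ccont_parts in G. destruct G as [G1 G2].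
      apply ccont_parts. split; [exact (rcont_opp _ w G1) | exact (rcont_opp _ w G2)].
  - apply (continuous_at_closed_inv (fun w => Cmult (Cmult (fourier p w) (fourier p w)) (Cmult (fourier p w) (fourier p w)))).
    + repeat apply Cmult_neq_0; auto.
    + apply (continuous_at_closed_mult (fun w => Cmult (fourier p w) (fourier p w)) (fun w => Cmult (fourier p w) (fourier p w)));
        apply continuous_at_closed_mult; auto.
Qed.

Lemma wave_mu2_continuous w : Im w <= 0 -> continuous_at_closed mu2 w.
Proof.
  intros Hw. apply continuous_at_closed_mult; [apply continuous_at_closed_const |].
  apply (continuous_at_closed_plus (fun _ => RtoC (2 * c)) k); [apply continuous_at_closed_const |].
  apply wave_k_continuous; auto.
Qed.

Lemma wave_Re_mu_rdiff w : Im w <= 0 -> rdiff (fun w => Re (mu w)) (Cmult (k w) (wave_zd w)) w.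
Proof.
  intros Hw. destruct (wave_Q_cdiff w Hw) as [_ R2].
  refine (rdiff_eq _ _ _ _ w _ _ (rdiff_scal (-1) _ _ w R2)).
  - intros w'. unfold mu, Cmult, Cplus, Ci, RtoC, Re, Im. cbn [fst snd]. ring.
  - unfold Cmult, Copp, Ci, RtoC. apply injective_projections; cbn [fst snd]; ring.
Qed.

Lemma wave_Im_mu_rdiff w : Im w <= 0 -> rdiff (fun w => - Im (mu w)) (Cmult (mu2 w) (wave_zd w)) w.
Proof.
  intros Hw. destruct (wave_Q_cdiff w Hw) as [R1 _].
  refine (rdiff_eq _ _ _ _ w _ _ (rdiff_plus _ _ _ _ w (rdiff_const (-1) w)
    (rdiff_plus _ _ _ _ w (rdiff_scal (-2 * c) _ _ w (wave_y_rdiff w Hw)) (rdiff_scal (-1) _ _ w R1)))).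
  - intros w'. unfold mu, Cmult, Cplus, Ci, RtoC, Re, Im. cbn [fst snd]. ring.
  - unfold mu2, Cmult, Cplus, Copp, Ci, RtoC. apply injective_projections; cbn [fst snd]; ring.
Qed.

(** On the surface [y = Re v + y0], so [s ^ 2 / 2 + g y] is the constant [1/2 + g y0]. In the
    Laplacian the contributions of the analytic [k] cancel and [- 2 c] remains. *)
Lemma wave_stream_equations : stream_equations g (2 * c) (/ 2 + g * y0) D Sf psi.
Proof.
  destruct wave_half_plane_map as [K H].
  assert (Sub : forall q, D q \/ Sf q -> image_closed wave_z q) by (intros q; apply image_closed_iff).
  assert (SubD : forall q, D q -> image_closed wave_z q) by (intros q Dq; apply image_closed_iff; left; exact Dq).
  exists (fun q => (Re (mu (inverse wave_z q)), - Im (mu (inverse wave_z q)))).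
  exists (fun q => (Re (k (inverse wave_z q)), - Im (k (inverse wave_z q)))).
  exists (fun q => (Re (mu2 (inverse wave_z q)), - Im (mu2 (inverse wave_z q)))).
  refine (conj _ (conj _ (conj _ (conj _ (conj _ (conj _ _)))))).
  - apply (C1_transfer wave_z wave_zd K H (fun q => D q \/ Sf q) Psi mu Sub).
    + intros w Hw _. apply wave_Psi_rdiff; auto.
    + intros w Hw _. apply wave_mu_continuous; auto.
  - apply (C1_transfer wave_z wave_zd K H D (fun w => Re (mu w)) k SubD).
    + intros w Hw _. apply wave_Re_mu_rdiff; auto.
    + intros w Hw _. apply wave_k_continuous; auto.
  - apply (C1_transfer wave_z wave_zd K H D (fun w => - Im (mu w)) mu2 SubD).
    + intros w Hw _. apply wave_Im_mu_rdiff; auto.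
    + intros w Hw _. apply wave_mu2_continuous; auto.
  - intros q _. cbn [fst snd]. unfold mu2, Cmult, Cplus, Ci, RtoC, Re, Im. cbn [fst snd]. ring.
  - intros q [x E]. subst q. unfold psi. rewrite (inverse_z _ _ K H) by (simpl; lra).
    apply wave_Psi_boundary.
  - intros q [x E]. subst q. rewrite (inverse_z _ _ K H) by (simpl; lra). cbn [fst snd].
    replace ((- Im (mu (x, 0))) ^ 2) with (Im (mu (x, 0)) ^ 2) by ring.
    rewrite wave_mu_norm, wave_bernoulli. unfold wave_z, Im at 1. cbn [snd]. simpl. field.
  (* Deep points of the fluid come from deep [w], because [Im (wave_z w)] and [Im w] differ by at
     most [K]. *)
  - intros eps H0. destruct (wave_Q_decay eps H0) as [M HM]. exists (Rmin (M - K) 0). intros q [w [Hw E]] Hq.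
    subst q. rewrite (inverse_z _ _ K H) by lra. cbn [fst snd].
    assert (L1 : snd (wave_z w) < M - K) by (eapply Rlt_le_trans; [exact Hq | apply Rmin_l]).
    destruct (hm_bounded _ _ _ H w ltac:(lra)) as [_ B]. apply Rabs_le_between in B.
    change (snd (wave_z w)) with (Im (wave_z w)) in *.
    specialize (HM w ltac:(lra) ltac:(lra)).
    destruct (Re_Im_bound (Q w)) as [B1 B2].
    split; (eapply Rle_lt_trans; [| exact HM]).
    + eapply Rle_trans; [| exact B2]. apply Req_le. rewrite <- Rabs_Ropp. f_equal.
      unfold mu, Cmult, Cplus, Ci, RtoC, Re, Im. cbn [fst snd]. ring.
    + eapply Rle_trans; [| exact B1]. apply Req_le. rewrite <- Rabs_Ropp. f_equal.
      unfold mu, Cmult, Cplus, Ci, RtoC, Re, Im. cbn [fst snd]. ring.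
Qed.

Lemma wave_reflection x0 : sin x0 = 0 -> invariant_under (reflect_x x0) D Sf psi.
Proof.
  intros S0. destruct wave_half_plane_map as [K H].
  set (tau := fun w : C => (2 * x0 - Re w, Im w) : C).
  assert (Et : forall b w, fourier b (tau w) = Cconj (fourier b w)).
  { intros b [x y]. apply fourier_reflect, S0. }
  assert (Ez : forall w, Im w <= 0 -> wave_z (tau w) = reflect_x x0 (wave_z w)).
  { intros w Hw. unfold wave_z, reflect_x. rewrite Et. unfold tau, Cconj, Re, Im. cbn [fst snd].
    f_equal. ring. }
  apply (invariant_lift wave_z wave_zd K H (reflect_x x0) (reflect_x x0) tau tau Psi); auto.
  - intros [x y]. unfold reflect_x. cbn [fst snd]. f_equal. ring.
  - intros w Hw. unfold Psi, Psi0. rewrite Et, (Ez w Hw). reflexivity.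
Qed.

Lemma wave_fourier_shift b w : fourier b (Re w + 2 * PI, Im w) = fourier b w.
Proof.
  rewrite <- (Rmult_1_r 2) at 1. change 1 with (INR 1). rewrite fourier_period. destruct w; reflexivity.
Qed.

Lemma wave_shift : invariant_under shift_x D Sf psi.
Proof.
  destruct wave_half_plane_map as [K H].
  set (tau := fun w : C => (Re w + 2 * PI, Im w) : C).
  set (tau' := fun w : C => (Re w - 2 * PI, Im w) : C).
  assert (Et : forall b w, fourier b (tau w) = fourier b w) by (intros; apply wave_fourier_shift).
  assert (Tt : forall w, tau (tau' w) = w).
  { intros [x y]. unfold tau, tau', Re, Im. cbn [fst snd]. f_equal. ring. }
  assert (Et' : forall b w, fourier b (tau' w) = fourier b w).
  { intros b w. rewrite <- Et, Tt. reflexivity. }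
  assert (Ez : forall w, wave_z (tau w) = shift_x (wave_z w)).
  { intros w. unfold wave_z, shift_x. rewrite Et. unfold tau, Re, Im. cbn [fst snd]. f_equal. ring. }
  apply (invariant_lift wave_z wave_zd K H shift_x (fun q => (fst q - 2 * PI, snd q)) tau tau' Psi); auto.
  - intros [x y]. unfold shift_x. cbn [fst snd]. f_equal. ring.
  - intros w _. unfold wave_z. rewrite Et'. unfold tau', Re, Im. cbn [fst snd]. f_equal. ring.
  - intros w _. unfold Psi, Psi0. rewrite Et, Ez. reflexivity.
Qed.

(** Here [y_alpha = 2 Re p Im p] with [Re p > 0], so critical points of [y] occur only where
    [sin x = 0]. There [Im v] vanishes too, so the surface point lies on the vertical line with
    abscissa [x], the line of reflection. *)
Lemma wave_extremum x : y_alpha wave_z x = 0 -> sin x = 0 /\ fst (wave_z (x, 0)) = x.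
Proof.
  intros E. destruct wave_half_plane_map as [K H].
  assert (Hw : Im (x, 0) <= 0) by (simpl; lra).
  rewrite (proj2 (hm_x_alpha_eq _ _ K H x)), wave_zd_eq in E by auto.
  assert (P := wave_p_pos (x, 0) Hw).
  assert (S0 : sin x = 0).
  { apply (near_crapper_Im_zero p t N). unfold Cmult, Re, Im in *. cbn [fst snd] in E.
    assert (E' : fst (fourier p (x, 0)) * snd (fourier p (x, 0)) = 0) by lra.
    apply Rmult_integral in E'. destruct E'; [lra | auto]. }
  split; auto.
  assert (F := fourier_Im_circle v _ x Hv). rewrite S0, Rabs_R0, Rmult_0_l in F.
  assert (F0 : Im (fourier v (x, 0)) = 0).
  { apply Rabs_eq_0. apply Rle_antisym; [exact F | apply Rabs_pos]. }
  unfold wave_z. cbn [fst]. rewrite F0. simpl. ring.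
Qed.

Lemma wave_y_derivable x : derivable_pt_lim (fun x => Im (wave_z (x, 0))) x (y_alpha wave_z x).
Proof.
  destruct wave_half_plane_map as [K H]. apply is_derive_Reals.
  rewrite (proj2 (hm_x_alpha_eq _ _ K H x)). apply (hm_x_alpha _ _ K H x).
Qed.

Lemma wave_crest_symmetric q : is_crest Sf q -> invariant_under (reflect_x (fst q)) D Sf psi.
Proof.
  intros [[x ->] Hmax].
  destruct (wave_extremum x) as [S0 E].
  - assert (pr : derivable_pt (fun x => Im (wave_z (x, 0))) x) by (eexists; apply wave_y_derivable).
    rewrite <- (derive_pt_eq_0 _ _ _ pr (wave_y_derivable x)).
    apply deriv_maximum with (x - 1) (x + 1); try lra.
    intros u _ _. apply (Hmax (wave_z (u, 0))). exists u. reflexivity.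
  - rewrite E. apply wave_reflection, S0.
Qed.

Lemma wave_trough_symmetric q : is_trough Sf q -> invariant_under (reflect_x (fst q)) D Sf psi.
Proof.
  intros [[x ->] Hmin].
  destruct (wave_extremum x) as [S0 E].
  - assert (pr : derivable_pt (fun x => Im (wave_z (x, 0))) x) by (eexists; apply wave_y_derivable).
    rewrite <- (derive_pt_eq_0 _ _ _ pr (wave_y_derivable x)).
    apply deriv_minimum with (x - 1) (x + 1); try lra.
    intros u _ _. apply (Hmin (wave_z (u, 0))). exists u. reflexivity.
  - rewrite E. apply wave_reflection, S0.
Qed.

Lemma wave_x_alpha x : x_alpha wave_z x = slope p x.
Proof.
  destruct wave_half_plane_map as [K H]. apply (hm_x_alpha_eq _ _ K H x).
Qed.

Lemma wave_exists : exists B D psi, water_wave g (2 * c) B D psi wave_z.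
Proof.
  exists (/ 2 + g * y0), D, psi. destruct wave_half_plane_map as [K H]. split.
  - apply (image_fluid_domain _ _ K H).
  - apply wave_stream_equations.
  - apply wave_shift.
  - apply wave_crest_symmetric.
  - apply wave_trough_symmetric.
  - apply (hm_conformal_description _ _ K H). intros x b _.
    assert (E := wave_fourier_shift v (x, b)). unfold Re, Im in E. cbn [fst snd] in E.
    unfold wave_z, Re, Im. cbn [fst snd]. rewrite E. split; ring.
Qed.

End Wave.

Theorem corollary8 :
  exists eps0 : R, 0 < eps0 /\
  forall eps : R, 0 < eps < eps0 ->
  forall G : R, - eps < G < eps ->
  exists (Omega B : R) (D : R * R -> Prop) (psi : R * R -> R) (z : C -> C),
    water_wave G Omega B D psi z /\
    vertical_at_a_point z /\
    never_overhanging z.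
Proof.
  exists gmax. split; [unfold gmax; lra |].
  intros eps He G HG.
  assert (Hg : Rabs G <= gmax) by (apply Rabs_le_between; lra).
  destruct (critical_solution G Hg) as (a & p & t & Ha & Hs & Hpos & x & Hx).
  destruct (wave_exists a G p t Hs Hg Ha Hpos) as (B & D & psi & W).
  do 5 eexists. split; [exact W |]. split.
  - exists x. rewrite (wave_x_alpha a G p t Hs Hpos). exact Hx.
  - intros u. rewrite (wave_x_alpha a G p t Hs Hpos). apply Hpos.
Qed.
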